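(* Let $0<p<\infty$, $0<\theta\le\infty$, $L\in\mathbb N$, and $\mathbf r$ a smoothness vector as in the context with $r_1>1/p$. Choose $\boldsymbol\nu\in\mathbb R^d$ with $\nu_s=r_s$ for $s\le\mu$ and $r_1<\nu_s<r_s$ for $s>\mu$, and put $\boldsymbol\eta=\boldsymbol\nu-1/p$. Then there is $C>0$ such that for all $m\in\mathbb N$ and all $f\in S^{\mathbf r}_{p,\theta}F(\mathbb T^d)$ $$\|f-T^{L,\boldsymbol\eta}_mf\|_{L_\infty(\mathbb T^d)}\le C\,m^{(\mu-1)(1-1/p)_+}2^{-m(r_1-1/p)}\|f|S^{\mathbf r}_{p,\theta}F(\mathbb T^d)\|.$$
   Context: $a_+=\max\{a,0\}$. Smoothness vector: $\mathbf r=(r_1,\dots,r_d)$ with $r_1=\dots=r_\mu<r_{\mu+1}\le\dots\le r_d<\infty$ for some $\mu\in\{1,\dots,d\}$. $\mathbb T^d=[-\pi,\pi]^d$ with opposite points identified. Spaces: with an admissible system $(\varphi_j)\subset C_0^\infty(\mathbb R)$ ($\mathrm{supp}\,\varphi_0\subset[-A,A]$, $\mathrm{supp}\,\varphi_j\subset\{B2^j\le|\xi|\le C2^j\}$, $\sup_{\xi,j}2^{jr}|D^r\varphi_j|<\infty$, $\sum\varphi_j\equiv1$), $\delta_{\mathbf j}[f]=\sum_{\mathbf k}\varphi_{j_1}(k_1)\cdots\varphi_{j_d}(k_d)\hat f(\mathbf k)e^{i\mathbf k\cdot\mathbf x}$ and $\|f|S^{\mathbf r}_{p,\theta}F\|=\|(\sum_{\mathbf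 j}2^{\theta\mathbf r\cdot\mathbf j}|\delta_{\mathbf j}[f]|^\theta)^{1/\theta}\|_{L_p}$ (sup if $\theta=\infty$). Kernels: $\mathrm{sinc}(x)=\sin x/x$, $\mathrm{sinc}(0)=1$; for $L\ge2$, $K^L(x)=\prod_{\ell=1}^L\mathrm{sinc}(2^{-\ell}x)$, $K^L_{\pi,j}(x)=\sum_{k}K^L(2^j(x+2\pi k))$; $K^1_{\pi,0}\equiv1$, $K^1_{\pi,j}(x)=2^{-j}\sum_{k=-2^{j-1}}^{2^{j-1}-1}e^{ikx}$. With $U_0=\{0\}$, $U_j=\{-2^{j-1},\dots,2^{j-1}-1\}$: $I^L_j[f](x)=\sum_{u\in U_j}f(2\pi u/2^j)K^L_{\pi,j}(x-2\pi u/2^j)$; $\eta^L_0=I^L_0$, $\eta^L_j=I^L_j-I^L_{j-1}$; $q^L_{\mathbf j}[f]=(\eta^L_{j_1}\otimes\cdots\otimes\eta^L_{j_d})f$ (the $i$-th factor acts in the $i$-th variable). Smolyak operator: for $\boldsymbol\eta\in(0,\infty)^d$, $T^{L,\boldsymbol\eta}_mf=\sum_{\mathbf j\in\mathbb N_0^d:\ \boldsymbol\eta\cdot\mathbf j\le\eta_1m}q^L_{\mathbf j}[f]$. *)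

(* Defs.v *)
From Stdlib Require Import Reals Lra Lia ZArith Arith List ClassicalEpsilon.
Import ListNotations.
Open Scope R_scope.

(* limit of a real sequence (chosen by epsilon; meaningful when it converges) *)
Definition lim (u : nat -> R) : R := epsilon (inhabits 0) (fun l => Un_cv u l).

(* x ^ y for x >= 0, y > 0 (with 0 ^ y = 0) *)
Definition rpow (x y : R) : R := if Rle_dec x 0 then 0 else Rpower x y.

Definition rsum (n : nat) (g : nat -> R) : R := fold_right Rplus 0 (map g (seq 0 n)).
Definition rprod (n : nat) (g : nat -> R) : R := fold_right Rmult 1 (map g (seq 0 n)).

Definition Cx := (R * R)%type.
Definition C0 : Cx := (0, 0).
Definition Cof (a : R) : Cx := (a, 0).
Definition Cadd (z w : Cx) : Cx := (fst z + fst w, snd z + snd w).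
Definition Csub (z w : Cx) : Cx := (fst z - fst w, snd z - snd w).
Definition Cmul (z w : Cx) : Cx :=
  (fst z * fst w - snd z * snd w, fst z * snd w + snd z * fst w).
Definition Cscale (a : R) (z : Cx) : Cx := (a * fst z, a * snd z).
Definition Cexpi (t : R) : Cx := (cos t, sin t).
Definition Cmod (z : Cx) : R := sqrt (fst z ^ 2 + snd z ^ 2).
Definition limC (u : nat -> Cx) : Cx := (lim (fun n => fst (u n)), lim (fun n => snd (u n))).
Definition csum (n : nat) (g : nat -> Cx) : Cx := fold_right Cadd C0 (map g (seq 0 n)).
Definition csum_list (l : list Z) (g : Z -> Cx) : Cx := fold_right Cadd C0 (map g l).

(* points of R^d and multi-indices are functions on nat; only coordinates < d matter *)
Definition updN (j : nat -> nat) (i a : nat) : nat -> nat :=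
  fun k => if Nat.eqb k i then a else j k.
Definition updR (x : nat -> R) (i : nat) (t : R) : nat -> R :=
  fun k => if Nat.eqb k i then t else x k.

Fixpoint sumbox (d N : nat) (F : (nat -> nat) -> R) : R :=
  match d with
  | O => F (fun _ => 0%nat)
  | S d' => rsum N (fun a => sumbox d' N (fun j => F (updN j d' a)))
  end.
Fixpoint csumbox (d N : nat) (F : (nat -> nat) -> Cx) : Cx :=
  match d with
  | O => F (fun _ => 0%nat)
  | S d' => csum N (fun a => csumbox d' N (fun j => F (updN j d' a)))
  end.
Fixpoint maxbox (d N : nat) (F : (nat -> nat) -> R) : R :=
  match d with
  | O => F (fun _ => 0%nat)
  | S d' => fold_right Rmax 0 (map (fun a => maxbox d' N (fun j => F (updN j d' a))) (seq 0 N))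
  end.

Definition dotR (d : nat) (w : nat -> R) (j : nat -> nat) : R := rsum d (fun i => w i * INR (j i)).

(* f : T^d -> C, represented as a function on R^d depending only on the first d
   coordinates, 2pi-periodic in each of them, and continuous *)
Definition torus_fun (d : nat) (f : (nat -> R) -> Cx) : Prop :=
  (forall x y, (forall i, (i < d)%nat -> x i = y i) -> f x = f y) /\
  (forall x i, (i < d)%nat -> f (updR x i (x i + 2 * PI)) = f x) /\
  (forall x eps, 0 < eps -> exists del, 0 < del /\
     forall y, (forall i, (i < d)%nat -> Rabs (y i - x i) < del) ->
       Cmod (Csub (f y) (f x)) < eps).

(* integral over [-pi,pi]^d of a continuous function: limit of dyadic Riemann sums *)
Definition integ (d : nat) (g : (nat -> R) -> R) : R :=
  lim (fun n => (2 * PI / 2 ^ n) ^ d *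
        sumbox d (2 ^ n)%nat (fun u => g (fun i => - PI + 2 * PI * INR (u i) / 2 ^ n))).

Definition kdot (d : nat) (k : nat -> Z) (x : nat -> R) : R := rsum d (fun i => IZR (k i) * x i).

Definition fhat (d : nat) (f : (nat -> R) -> Cx) (k : nat -> Z) : Cx :=
  Cscale (/ (2 * PI) ^ d)
    (integ d (fun x => fst (Cmul (f x) (Cexpi (- kdot d k x)))),
     integ d (fun x => snd (Cmul (f x) (Cexpi (- kdot d k x))))).

Definition admissible (phi : nat -> R -> R) : Prop :=
  (exists D : nat -> nat -> R -> R,
      (forall j, D j O = phi j) /\
      (forall j n x, derivable_pt_lim (D j n) x (D j (S n) x)) /\
      (forall n, exists c, forall j xi, 2 ^ (j * n) * Rabs (D j n xi) <= c)) /\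
  (exists A, 0 < A /\ forall xi, A < Rabs xi -> phi O xi = 0) /\
  (exists B Cc, 0 < B /\ 0 < Cc /\ forall j xi, (1 <= j)%nat ->
      (Rabs xi < B * 2 ^ j \/ Cc * 2 ^ j < Rabs xi) -> phi j xi = 0) /\
  (forall xi, infinite_sum (fun j => phi j xi) 1).

(* delta_j[f](x) = sum_{k in Z^d} phi_{j_1}(k_1)...phi_{j_d}(k_d) \hat f(k) e^{i k.x},
   the sum over Z^d taken as the limit of the sums over the cubes |k_i| <= K *)
Definition delta (d : nat) (phi : nat -> R -> R) (f : (nat -> R) -> Cx)
    (j : nat -> nat) (x : nat -> R) : Cx :=
  limC (fun K => csumbox d (2 * K + 1)
    (fun a => let k := fun i => (Z.of_nat (a i) - Z.of_nat K)%Z in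
       Cscale (rprod d (fun i => phi (j i) (IZR (k i))))
              (Cmul (fhat d f k) (Cexpi (kdot d k x))))).

(* theta in (0, infinity]: None stands for theta = infinity *)
Definition theta_ok (theta : option R) : Prop :=
  match theta with Some t => 0 < t | None => True end.

(* (sum_{j in {0..N-1}^d} 2^{theta r.j} |delta_j f(x)|^theta)^{p/theta} (sup if theta = oo),
   i.e. the p-th power of the truncated square function *)
Definition GN (d : nat) (phi : nat -> R -> R) (p : R) (theta : option R) (r : nat -> R)
    (f : (nat -> R) -> Cx) (N : nat) (x : nat -> R) : R :=
  match theta with
  | Some t => rpow (sumbox d N (fun j => rpow 2 (t * dotR d r j) * rpow (Cmod (delta d phi f j x)) t)) (p / t)
  | None => rpow (maxbox d N (fun j => rpow 2 (dotR d r j) * Cmod (delta d phi f j x))) p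
  end.

(* ||f | S^r_{p,theta}F(T^d)|| <= M, via monotone convergence in the truncation N *)
Definition Snorm_le (d : nat) (phi : nat -> R -> R) (p : R) (theta : option R) (r : nat -> R)
    (f : (nat -> R) -> Cx) (M : R) : Prop :=
  forall N : nat, integ d (GN d phi p theta r f N) <= rpow M p.

(* smoothness vector r_1 = ... = r_mu < r_{mu+1} <= ... <= r_d  (0-indexed here) *)
Definition smoothness_vector (d mu : nat) (r : nat -> R) : Prop :=
  (1 <= mu)%nat /\ (mu <= d)%nat /\
  (forall s, (s < mu)%nat -> r s = r O) /\
  ((mu < d)%nat -> r O < r mu) /\
  (forall s, (mu <= s)%nat -> (S s < d)%nat -> r s <= r (S s)).

Definition sinc (x : R) : R := if Req_dec_T x 0 then 1 else sin x / x.
Definition KL (L : nat) (x : R) : R := rprod L (fun l => sinc (x / 2 ^ (S l))).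

Definition Kpi (L j : nat) (x : R) : Cx :=
  if Nat.eqb L 1 then
    match j with
    | O => Cof 1
    | S _ => Cscale (/ 2 ^ j) (csum (2 ^ j) (fun a => Cexpi ((INR a - 2 ^ (j - 1)) * x)))
    end
  else Cof (lim (fun N => rsum (2 * N + 1)
               (fun a => KL L (2 ^ j * (x + 2 * PI * (INR a - INR N)))))).

Definition Ulist (j : nat) : list Z :=
  match j with
  | O => [0%Z]
  | S _ => map (fun a => (Z.of_nat a - Z.of_nat (2 ^ (j - 1)))%Z) (seq 0 (2 ^ j))
  end.

Definition Iop (L j : nat) (g : R -> Cx) (x : R) : Cx :=
  csum_list (Ulist j) (fun u => Cmul (g (2 * PI * IZR u / 2 ^ j)) (Kpi L j (x - 2 * PI * IZR u / 2 ^ j))).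

Definition etaop (L j : nat) (g : R -> Cx) (x : R) : Cx :=
  match j with
  | O => Iop L O g x
  | S j' => Csub (Iop L (S j') g x) (Iop L j' g x)
  end.

Definition applyc (i : nat) (A : (R -> Cx) -> R -> Cx) (F : (nat -> R) -> Cx) : (nat -> R) -> Cx :=
  fun x => A (fun t => F (updR x i t)) (x i).

Fixpoint qop (d L : nat) (j : nat -> nat) (f : (nat -> R) -> Cx) : (nat -> R) -> Cx :=
  match d with
  | O => f
  | S d' => applyc d' (etaop L (j d')) (qop d' L j f)
  end.

(* T^{L,eta}_m f = sum_{j : eta.j <= eta_1 m} q_j[f]  (finite sum; written as the limit
   of the sums over the cubes {0..N-1}^d, which is eventually constant) *)
Definition smolyak (d L : nat) (eta : nat -> R) (m : nat) (f : (nat -> R) -> Cx) (x : nat -> R) : Cx :=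
  limC (fun N => csumbox d N (fun j =>
     if Rle_dec (dotR d eta j) (eta O * INR m) then qop d L j f x else C0)).

(* Main.v *)
(* Decompose [f] into its Littlewood-Paley pieces [delta_l f].  Since [q_j] reproduces low frequencies,
   [q_j f = sum q_j (delta_l f)] over [l >= j - c] only.  With [H := (sup_l 2^{r.l} |delta_l f|)^s] for an [s < p]
   close to [p], a Plancherel-Polya inequality for trigonometric polynomials and the decay [(1 + 2^j |t|)^{-1}] of
   the sampling kernels give, at every point [x], [|q_j f(x)| <= C 2^{-r.j} (A_j H (x))^{1/s}], where [A_j] averages
   against [prod_i 2^{j_i} (1 + 2^{j_i} |t_i|)^{-gamma}] with [1 - s/p < gamma < min (1, s)].  A Schur test shows that
   [sum_j 2^{-|j|} (A_j H (x))^{p/s}] is at most [C] times the integral of [H^{p/s}], a pointwise form of the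
   embedding of [S^r_{p,theta} F] into [S^{r-1/p}_{infty,p} B] that needs neither a maximal function nor the
   smoothness of [phi].  Hoelder's inequality in [j] over the set [eta.j > eta_1 m] then produces the rate.  All
   integrals are handled as Riemann sums on dyadic grids, exact for trigonometric polynomials. *)

From Stdlib Require Import Reals Lra Lia ZArith Arith List FunctionalExtensionality ClassicalEpsilon.
From Stdlib Require Import ssreflect.
From Coquelicot Require Complex Compactness.
Require Import Defs.
Import ListNotations.
Open Scope R_scope.

(** * Powers and finite sums *)

Create HintDb pos.
Ltac pos := solve [auto 12 with pos nocore].
Ltac mul_l := apply Rmult_le_compat_l; [pos|].
Ltac mul_r := apply Rmult_le_compat_r; [pos|].

(** First-order decay is all that the Dirichlet kernel of [L = 1] offers, and [Kpi_bound] keeps no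
    more for larger [L], so that all [L] are treated alike. Such a kernel is not summable uniformly
    in [j], and each factor of [A_j] has total mass of order [2^{(1 - gamma) j}]. This growth
    dictates the window for [gamma]: [gamma < min (1, s)] is what the [s]-th power of the kernel can
    afford at the nodes, while [1 - s/p < gamma] says [(1 - gamma) p/s < 1], so that the factor
    [2^{-|j|}] beats the [p/s]-th power of the mass. Constants must be independent of the function,
    whereas the grid may depend on it: every discrete estimate is uniform in the number [N] of nodes
    per variable, once [N] exceeds a multiple of the frequencies present. Hence the error is bounded
    for the trigonometric polynomials [Spart n] and then passed to the limit. That [Spart n] tends
    to [f] itself is not contained in the norm bound: the blocks give a Cauchy property, and Fejer
    means identify the limit. Grid sums of the square function only tend to its integral, so the
    final bound is proved for every [M' > M]. *)

Lemma Rdiv_ge0 x y : 0 <= x -> 0 < y -> 0 <= x / y.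
Proof. move=> hx hy; apply Rmult_le_pos => //. by apply Rlt_le, Rinv_0_lt_compat. Qed.

Lemma pow2_pos j : 0 < 2 ^ j.
Proof. apply pow_lt; lra. Qed.

Lemma pow2_ge1 j : 1 <= 2 ^ j.
Proof. apply pow_R1_Rle; lra. Qed.

Lemma rpow_Rpower x y : 0 < x -> rpow x y = Rpower x y.
Proof. move=> hx; rewrite /rpow; case: Rle_dec => // h; lra. Qed.

Lemma rpow_0 x y : x <= 0 -> rpow x y = 0.
Proof. move=> hx; rewrite /rpow; case: Rle_dec => // h; lra. Qed.

Lemma rpow_gt0 x y : 0 < x -> 0 < rpow x y.
Proof. move=> hx; rewrite rpow_Rpower //; apply exp_pos. Qed.

Lemma rpow_ge0 x y : 0 <= rpow x y.
Proof.
case: (Rle_dec x 0) => h; first by rewrite rpow_0 //; lra.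
by apply Rlt_le, rpow_gt0; lra.
Qed.

#[local] Hint Resolve Rmult_le_pos Rmult_lt_0_compat Rdiv_ge0 Rdiv_lt_0_compat Rinv_0_lt_compat rpow_ge0 rpow_gt0
  pow_le pow_lt pow2_ge_0 pow2_pos Rabs_pos pos_INR lt_0_INR : pos.
#[local] Hint Extern 1 (0 <= / _) => apply Rlt_le : pos.
#[local] Hint Extern 3 (_ <= _) => lra : pos.
#[local] Hint Extern 3 (_ < _) => lra : pos.
#[local] Hint Extern 3 (_ <> _) => lra : pos.

Lemma rpow_mul x y a : 0 <= x -> 0 <= y -> rpow (x * y) a = rpow x a * rpow y a.
Proof.
move=> hx hy.
case: (Rle_dec x 0) => h; first by rewrite (rpow_0 x) // rpow_0; nra.
case: (Rle_dec y 0) => h'; first by rewrite (rpow_0 y) // rpow_0; nra.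
rewrite !rpow_Rpower; try nra.
by rewrite Rpower_mult_distr //; lra.
Qed.

(** True for all real [x], [a], [b] because [rpow] is 0 on [x <= 0] whatever the exponent; the price
    is that [rpow_exp0] needs [0 < x]. *)
Lemma rpow_add x a b : rpow x (a + b) = rpow x a * rpow x b.
Proof.
case: (Rle_dec x 0) => h; first by rewrite !rpow_0 //; lra.
by rewrite !rpow_Rpower ?Rpower_plus //; lra.
Qed.

Lemma rpow_rpow x a b : rpow (rpow x a) b = rpow x (a * b).
Proof.
case: (Rle_dec x 0) => h; first by rewrite !rpow_0 ?rpow_0 //; lra.
have hx : 0 < x by lra.
rewrite (rpow_Rpower (rpow x a)); last pos.
by rewrite !rpow_Rpower // Rpower_mult.
Qed.

Lemma rpow_le x y a : 0 <= a -> x <= y -> rpow x a <= rpow y a.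
Proof.
move=> ha hxy.
case: (Rle_dec x 0) => h; first by rewrite (rpow_0 x) //; apply rpow_ge0.
rewrite !rpow_Rpower; try lra.
apply Rle_Rpower_l; lra.
Qed.

Lemma rpow_lt x y a : 0 < a -> 0 <= x < y -> rpow x a < rpow y a.
Proof.
move=> ha hxy.
case: (Rle_dec x 0) => h; first by rewrite (rpow_0 x) //; apply rpow_gt0; lra.
rewrite !rpow_Rpower; try lra.
rewrite /Rpower; apply exp_increasing, Rmult_lt_compat_l => //; apply ln_increasing; lra.
Qed.

Lemma rpow_opp x a : 0 < x -> rpow x (- a) = / rpow x a.
Proof. by move=> h; rewrite !rpow_Rpower // Rpower_Ropp. Qed.

Lemma rpow_le_neg x y a : a <= 0 -> 0 < x <= y -> rpow y a <= rpow x a.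
Proof.
move=> ha hxy; replace a with (- - a) by lra.
rewrite !(rpow_opp _ (- a)); try lra.
apply Rinv_le_contravar; first pos.
apply rpow_le; lra.
Qed.

Lemma rpow_1 x : 0 <= x -> rpow x 1 = x.
Proof.
move=> hx; case: (Rle_dec x 0) => h; first by rewrite rpow_0 //; lra.
by rewrite rpow_Rpower ?Rpower_1 //; lra.
Qed.

Lemma rpow_exp0 x : 0 < x -> rpow x 0 = 1.
Proof. by move=> h; rewrite rpow_Rpower // Rpower_O. Qed.

Lemma rpow_base1 a : rpow 1 a = 1.
Proof. by rewrite rpow_Rpower ?rpow_1 /Rpower ?ln_1 ?Rmult_0_r ?exp_0 //; lra. Qed.

Lemma rpow_exp_le x a b : 1 <= x -> a <= b -> rpow x a <= rpow x b.
Proof.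
move=> hx hab; rewrite !rpow_Rpower; try lra.
apply Rle_Rpower; lra.
Qed.

Lemma rpow_exp_le1 x a b : x <= 1 -> a <= b -> rpow x b <= rpow x a.
Proof.
move=> hx hab.
case: (Rle_dec x 0) => h; first by rewrite !rpow_0; lra.
have hx0 : 0 < x by lra.
have : rpow (/ x) a <= rpow (/ x) b.
  apply rpow_exp_le => //. rewrite -Rinv_1; apply Rinv_le_contravar; lra.
have e : forall c, rpow (/ x) c = / rpow x c.
  move=> c. have hi : 0 < / x by pos.
  have := rpow_mul x (/ x) c. rewrite Rinv_r ?rpow_base1; last lra.
  move=> H. have {}H := H ltac:(lra) ltac:(lra).
  have := rpow_gt0 x c hx0 => hp.
  apply Rmult_eq_reg_l with (rpow x c); last lra. rewrite -H Rinv_r //; lra.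
rewrite !e => H.
apply Rinv_le_contravar in H; last pos.
by rewrite !Rinv_inv in H.
Qed.

Lemma rpow_nat x n : 0 < x -> rpow x (INR n) = x ^ n.
Proof. by move=> h; rewrite rpow_Rpower // Rpower_pow. Qed.

Lemma rpow_inv x a : 0 < x -> rpow (/ x) a = rpow x (- a).
Proof.
move=> hx; have hi : 0 < / x by pos.
rewrite rpow_opp //.
have H := rpow_mul x (/ x) a ltac:(lra) ltac:(lra).
rewrite Rinv_r ?rpow_base1 in H; last lra.
have hp := rpow_gt0 x a hx.
apply Rmult_eq_reg_l with (rpow x a); last lra. rewrite -H Rinv_r //; lra.
Qed.

Lemma rpow_le1 x a : 0 <= a -> x <= 1 -> rpow x a <= 1.
Proof. move=> ha hx. rewrite -(rpow_base1 a). by apply rpow_le. Qed.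

Lemma rpow_ge1 x a : 0 <= a -> 1 <= x -> 1 <= rpow x a.
Proof. move=> ha hx. rewrite -(rpow_base1 a). by apply rpow_le. Qed.

Lemma rpow_root_le x y s : 0 < s -> 0 <= y -> rpow x s <= y -> x <= rpow y (/ s).
Proof.
move=> hs hy h.
case: (Rle_dec x 0) => hx; first by have := rpow_ge0 y (/ s); lra.
have H : rpow (rpow x s) (/ s) <= rpow y (/ s).
  apply rpow_le => //. by apply Rlt_le, Rinv_0_lt_compat.
rewrite rpow_rpow Rinv_r ?rpow_1 in H; lra.
Qed.

Lemma exp_tangent A m : exp m * (1 + (A - m)) <= exp A.
Proof.
replace (exp A) with (exp m * exp (A - m)) by (rewrite -exp_plus; f_equal; ring).
apply Rmult_le_compat_l; first by apply Rlt_le, exp_pos.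
case: (Req_dec (A - m) 0) => h; first by rewrite h exp_0; lra.
by apply Rlt_le, exp_ineq1.
Qed.

(** Convexity in tangent form, the source of [jensen]. With [u = ln (a / t)] it becomes Bernoulli's
    inequality, which follows from the tangent of the exponential at [u], read off at [s u] and at
    0. *)
Lemma rpow_tangent s a t : 1 <= s -> 0 <= a -> 0 < t ->
  rpow t s + s * rpow t (s - 1) * (a - t) <= rpow a s.
Proof.
move=> hs ha ht.
have ht1 : rpow t s = t * rpow t (s - 1).
  replace s with (1 + (s - 1)) at 1 by ring. by rewrite rpow_add rpow_1 //; lra.
case: (Rle_dec a 0) => h.
  rewrite (rpow_0 a) //. replace a with 0 by lra. rewrite ht1.
  have : 0 <= t * rpow t (s-1) * (s - 1) by pos.
  nra.
have hz : 1 + s * (a / t - 1) <= rpow (a / t) s.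
  have hat : 0 < a / t by pos.
  rewrite rpow_Rpower // /Rpower.
  set u := ln (a / t).
  have hu : exp u = a / t by rewrite /u exp_ln.
  have h1 := exp_tangent (s * u) u.
  have h2 := exp_tangent 0 u. rewrite exp_0 in h2.
  rewrite hu in h1 h2. nra.
have e : rpow a s = rpow (a / t) s * rpow t s.
  rewrite -rpow_mul; try lra; last pos.
  f_equal; field; lra.
rewrite e.
have : (1 + s * (a / t - 1)) * rpow t s <= rpow (a / t) s * rpow t s.
  apply Rmult_le_compat_r => //; apply rpow_ge0.
suff -> : (1 + s * (a / t - 1)) * rpow t s = rpow t s + s * rpow t (s - 1) * (a - t) by [].
rewrite ht1; field; lra.
Qed.

(** The power [s - 1] is decreasing, so [c^s >= c (a + b)^(s - 1)] for both summands [c]; add the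
    two. *)
Lemma rpow_subadd s a b : 0 < s <= 1 -> 0 <= a -> 0 <= b ->
  rpow (a + b) s <= rpow a s + rpow b s.
Proof.
move=> hs ha hb.
case: (Rle_dec (a + b) 0) => h.
  rewrite rpow_0 //; have := rpow_ge0 a s; have := rpow_ge0 b s; lra.
have H : forall c, 0 <= c <= a + b -> c * rpow (a + b) (s - 1) <= rpow c s.
  move=> c hc. case: (Rle_dec c 0) => h'.
    rewrite (rpow_0 c) //. replace c with 0 by lra. have := rpow_ge0 (a+b) (s-1); lra.
  replace s with (1 + (s - 1)) at 2 by ring. rewrite rpow_add rpow_1; last lra.
  apply Rmult_le_compat_l; first lra. apply rpow_le_neg; lra.
have e : rpow (a + b) s = (a + b) * rpow (a + b) (s - 1).
  replace s with (1 + (s - 1)) at 1 by ring. by rewrite rpow_add rpow_1 //; lra.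
have := H a ltac:(lra); have := H b ltac:(lra). rewrite e; lra.
Qed.

(** * Sums over lists and Jensen's inequality *)

Definition lsum {A} (l : list A) (f : A -> R) : R := fold_right Rplus 0 (map f l).

Lemma lsum_nil {A} (f : A -> R) : lsum [] f = 0.
Proof. by []. Qed.

Lemma lsum_cons {A} (a : A) l f : lsum (a :: l) f = f a + lsum l f.
Proof. by []. Qed.

Lemma lsum_ext {A} (l : list A) f g : (forall a, In a l -> f a = g a) -> lsum l f = lsum l g.
Proof.
elim: l => [//|a l IH] h; rewrite !lsum_cons h; last by left.
by rewrite IH // => b hb; apply h; right.
Qed.

Lemma lsum_le {A} (l : list A) f g : (forall a, In a l -> f a <= g a) -> lsum l f <= lsum l g.
Proof.
elim: l => [|a l IH] h; first by rewrite !lsum_nil; lra.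
rewrite !lsum_cons. apply Rplus_le_compat; first by apply h; left.
by apply IH => b hb; apply h; right.
Qed.

Lemma lsum_plus {A} (l : list A) f g : lsum l (fun a => f a + g a) = lsum l f + lsum l g.
Proof. by elim: l => [|a l IH]; rewrite ?lsum_nil ?lsum_cons ?IH; lra. Qed.

Lemma lsum_scal {A} (l : list A) c f : lsum l (fun a => c * f a) = c * lsum l f.
Proof. by elim: l => [|a l IH]; rewrite ?lsum_nil ?lsum_cons ?IH; lra. Qed.

Lemma lsum_scalr {A} (l : list A) c f : lsum l (fun a => f a * c) = lsum l f * c.
Proof. by elim: l => [|a l IH]; rewrite ?lsum_nil ?lsum_cons ?IH; lra. Qed.

Lemma lsum_zero {A} (l : list A) f : (forall a, In a l -> f a = 0) -> lsum l f = 0.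
Proof.
move=> h; rewrite (lsum_ext l f (fun a => 0 * 0)); last by move=> a /h ->; lra.
rewrite lsum_scal; lra.
Qed.

Lemma lsum_ge0 {A} (l : list A) f : (forall a, In a l -> 0 <= f a) -> 0 <= lsum l f.
Proof.
move=> h. rewrite -(lsum_zero l (fun _ => 0)) //. exact: lsum_le.
Qed.

Lemma lsum_const {A} (l : list A) c : lsum l (fun _ => c) = INR (length l) * c.
Proof.
elim: l => [|a l IH]; first by rewrite lsum_nil /=; lra.
rewrite lsum_cons IH; change (length (a :: l)) with (S (length l)); rewrite S_INR; ring.
Qed.

Lemma lsum_app {A} (l l' : list A) f : lsum (l ++ l') f = lsum l f + lsum l' f.
Proof. by elim: l => [|a l IH]; rewrite ?app_nil_l -?app_comm_cons ?lsum_nil ?lsum_cons ?IH; lra. Qed.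

Lemma lsum_map {A B} (l : list A) (h : A -> B) f : lsum (map h l) f = lsum l (fun a => f (h a)).
Proof. by rewrite /lsum map_map. Qed.

Lemma lsum_flat_map {A B} (l : list A) (h : A -> list B) f :
  lsum (flat_map h l) f = lsum l (fun a => lsum (h a) f).
Proof. by elim: l => [//|a l IH]; rewrite [flat_map _ _]/= lsum_app IH lsum_cons. Qed.

Lemma lsum_exch {A B} (l : list A) (l' : list B) f :
  lsum l (fun a => lsum l' (f a)) = lsum l' (fun b => lsum l (fun a => f a b)).
Proof.
elim: l => [|a l IH]; first by rewrite lsum_nil lsum_zero.
rewrite lsum_cons IH -lsum_plus. by apply lsum_ext.
Qed.

Lemma lsum_ge_term {A} (l : list A) f a : (forall b, In b l -> 0 <= f b) -> In a l -> f a <= lsum l f.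
Proof.
elim: l => [//|b l IH] h; rewrite lsum_cons; case=> [->|hin].
  have : 0 <= lsum l f by apply lsum_ge0 => c hc; apply h; right.
  lra.
have : f a <= lsum l f by apply IH => // c hc; apply h; right.
have := h b (or_introl eq_refl); lra.
Qed.

Lemma lsum_rpow_sub {A} (l : list A) f s : 0 < s <= 1 -> (forall a, In a l -> 0 <= f a) ->
  rpow (lsum l f) s <= lsum l (fun a => rpow (f a) s).
Proof.
move=> hs; elim: l => [|a l IH] h; first by rewrite !lsum_nil rpow_0; lra.
rewrite !lsum_cons.
have h0 : 0 <= lsum l f by apply lsum_ge0 => b hb; apply h; right.
have := rpow_subadd s (f a) (lsum l f) hs (h a (or_introl eq_refl)) h0.
have := IH (fun b hb => h b (or_intror hb)); lra.
Qed.

(** The weights are not normalised, whence the power of their sum: in this form it also serves as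
    Hoelder's inequality. The tangents at the weighted mean [t = S / W] are summed, and their linear
    terms cancel. *)
Lemma jensen {A} (l : list A) w f s : 1 <= s ->
  (forall a, In a l -> 0 <= w a) -> (forall a, In a l -> 0 <= f a) ->
  rpow (lsum l (fun a => w a * f a)) s
  <= rpow (lsum l w) (s - 1) * lsum l (fun a => w a * rpow (f a) s).
Proof.
move=> hs hw hf.
set S := lsum l (fun a => w a * f a). set W := lsum l w.
have hr : 0 <= lsum l (fun a => w a * rpow (f a) s).
  apply lsum_ge0 => a ha; apply Rmult_le_pos; [by apply hw|by apply rpow_ge0].
case: (Rle_dec S 0) => hS.
  rewrite rpow_0 //; apply Rmult_le_pos => //; apply rpow_ge0.
have hW : 0 < W.
  case: (Rle_dec W 0) => h; last lra. exfalso; apply hS.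
  rewrite /S lsum_zero; first lra. move=> a ha.
  have := lsum_ge_term l w a hw ha. have := hw a ha. rewrite -/W => h1 h2.
  replace (w a) with 0 by lra; lra.
set t := S / W.
have ht : 0 < t by apply Rdiv_lt_0_compat; lra.
have H : W * rpow t s <= lsum l (fun a => w a * rpow (f a) s).
  have : lsum l (fun a => (rpow t s - s * rpow t (s - 1) * t) * w a + s * rpow t (s-1) * (w a * f a))
    <= lsum l (fun a => w a * rpow (f a) s).
    apply lsum_le => a ha.
    have h1 := rpow_tangent s (f a) t hs (hf a ha) ht.
    have h2 := hw a ha. nra.
  rewrite lsum_plus !lsum_scal -/W -/S.
  have -> : S = t * W by rewrite /t; field; lra.
  lra.
have e : rpow S s = W * rpow t s * rpow W (s - 1).
  have -> : S = t * W by rewrite /t; field; lra.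
  rewrite rpow_mul; try lra.
  replace (rpow W s) with (rpow W 1 * rpow W (s - 1)); first by rewrite rpow_1; lra.
  rewrite -rpow_add; f_equal; ring.
rewrite e Rmult_comm; apply Rmult_le_compat_l => //; apply rpow_ge0.
Qed.

#[local] Hint Resolve lsum_ge0 : pos.

(** * Multi-indices, products and tensor sums *)

Definition upd {A} (j : nat -> A) (i : nat) (a : A) : nat -> A :=
  fun k => if Nat.eqb k i then a else j k.

Lemma upd_eq {A} (j : nat -> A) i a : upd j i a i = a.
Proof. by rewrite /upd Nat.eqb_refl. Qed.

Lemma upd_neq {A} (j : nat -> A) i a k : k <> i -> upd j i a k = j k.
Proof. by rewrite /upd => /Nat.eqb_neq ->. Qed.

(** The recursion mirrors [sumbox], so that sums over cubes of levels, grid points, sampling nodes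
    and frequencies are all sums over lists of this kind. Coordinates from [d] on carry the dummy
    value [a0]. *)
Fixpoint mlist {A} (a0 : A) (d : nat) (ls : nat -> list A) : list (nat -> A) :=
  match d with
  | O => [fun _ => a0]
  | S d' => flat_map (fun a => map (fun j => upd j d' a) (mlist a0 d' ls)) (ls d')
  end.

Lemma mlist_in {A} (a0 : A) d ls j : In j (mlist a0 d ls) -> forall i, (i < d)%nat -> In (j i) (ls i).
Proof.
elim: d j => [|d IH] j; first by move=> _ i; lia.
rewrite [mlist _ _ _]/= => /in_flat_map [a [ha /in_map_iff [j' [<- hj']]]] i hi.
case: (Nat.eq_dec i d) => [->|hne]; first by rewrite upd_eq.
rewrite upd_neq //; apply IH => //; lia.
Qed.

Lemma mlist_ext {A} (a0 : A) d ls ls' : (forall i, (i < d)%nat -> ls i = ls' i) ->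
  mlist a0 d ls = mlist a0 d ls'.
Proof.
elim: d => [//|d IH] h; rewrite [LHS]/= [RHS]/= h; last lia.
by rewrite IH // => i hi; apply h; lia.
Qed.

Lemma lsum_mlist_S {A} (a0 : A) d ls f :
  lsum (mlist a0 (S d) ls) f = lsum (ls d) (fun a => lsum (mlist a0 d ls) (fun j => f (upd j d a))).
Proof.
rewrite [mlist _ _ _]/= lsum_flat_map; apply lsum_ext => a _; by rewrite lsum_map.
Qed.

Lemma rprod_S n g : rprod (S n) g = rprod n g * g n.
Proof.
rewrite /rprod seq_S map_app /= .
elim: (map g (seq 0 n)) => [|a l IH] /=; [ring|rewrite IH; ring].
Qed.

Lemma rprod_ext n g h : (forall i, (i < n)%nat -> g i = h i) -> rprod n g = rprod n h.
Proof.
elim: n => [//|n IH] H; rewrite !rprod_S (IH (fun i hi => H i ltac:(lia))) H //; lia.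
Qed.

Lemma rprod_ge0 n g : (forall i, (i < n)%nat -> 0 <= g i) -> 0 <= rprod n g.
Proof.
elim: n => [|n IH] H; first by rewrite /rprod /=; lra.
rewrite rprod_S; apply Rmult_le_pos; last by apply H; lia.
apply IH => i hi; apply H; lia.
Qed.

Lemma rprod_gt0 n g : (forall i, (i < n)%nat -> 0 < g i) -> 0 < rprod n g.
Proof.
elim: n => [|n IH] H; first by rewrite /rprod /=; lra.
rewrite rprod_S; apply Rmult_lt_0_compat; last by apply H; lia.
apply IH => i hi; apply H; lia.
Qed.

#[local] Hint Resolve rprod_ge0 rprod_gt0 : pos.

Lemma rprod_le n g h : (forall i, (i < n)%nat -> 0 <= g i <= h i) -> rprod n g <= rprod n h.
Proof.
elim: n => [|n IH] H; first by rewrite /rprod /=; lra.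
rewrite !rprod_S; apply Rmult_le_compat.
- apply rprod_ge0 => i hi; apply H; lia.
- apply H; lia.
- apply IH => i hi; apply H; lia.
- apply H; lia.
Qed.

Lemma rprod_mul n g h : rprod n (fun i => g i * h i) = rprod n g * rprod n h.
Proof. elim: n => [|n IH]; first by rewrite /rprod /=; ring. rewrite !rprod_S IH; ring. Qed.

Lemma rprod_const n c : rprod n (fun _ => c) = c ^ n.
Proof. elim: n => [//|n IH]; rewrite rprod_S IH /=; ring. Qed.

Lemma rprod_rpow n g s : (forall i, (i < n)%nat -> 0 <= g i) ->
  rpow (rprod n g) s = rprod n (fun i => rpow (g i) s).
Proof.
elim: n => [|n IH] H; first by rewrite /rprod /= rpow_base1.
rewrite !rprod_S rpow_mul; last by apply H; lia.
- rewrite IH // => i hi; apply H; lia.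
- apply rprod_ge0 => i hi; apply H; lia.
Qed.

Lemma rprod_zero n g i : (i < n)%nat -> g i = 0 -> rprod n g = 0.
Proof.
elim: n => [|n IH] hi h0; first lia. rewrite rprod_S.
case: (Nat.eq_dec i n) => [e|hne]; first by rewrite -e h0; ring.
rewrite IH //; [ring|lia].
Qed.

(** Distributivity; it reduces the [d]-dimensional sums of product weights to one-variable
    bounds. *)
Lemma lsum_mlist_prod {A} (a0 : A) d ls (f : nat -> A -> R) :
  lsum (mlist a0 d ls) (fun j => rprod d (fun i => f i (j i))) = rprod d (fun i => lsum (ls i) (f i)).
Proof.
elim: d => [|d IH]; first by rewrite /lsum /rprod /=; ring.
rewrite lsum_mlist_S rprod_S -IH Rmult_comm -lsum_scalr.
apply lsum_ext => a _. rewrite -lsum_scal; apply lsum_ext => j _.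
rewrite rprod_S upd_eq Rmult_comm; congr (_ * _).
apply rprod_ext => i hi; rewrite upd_neq //; lia.
Qed.

Lemma rsum_lsum n g : rsum n g = lsum (seq 0 n) g.
Proof. by []. Qed.

Lemma rsum_S n g : rsum (S n) g = rsum n g + g n.
Proof. rewrite !rsum_lsum seq_S lsum_app lsum_cons lsum_nil /=; ring. Qed.

Lemma rsum_ext n g h : (forall i, (i < n)%nat -> g i = h i) -> rsum n g = rsum n h.
Proof. move=> H; apply lsum_ext => i /in_seq hi; apply H; lia. Qed.

Lemma rsum_le n g h : (forall i, (i < n)%nat -> g i <= h i) -> rsum n g <= rsum n h.
Proof. move=> H; apply lsum_le => i /in_seq hi; apply H; lia. Qed.

Lemma rsum_telescope n g : rsum n (fun i => g (S i) - g i) = g n - g O.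
Proof. elim: n => [|n IH]; first by rewrite /rsum /=; ring. rewrite rsum_S IH; ring. Qed.

Lemma sumbox_lsum d N F : sumbox d N F = lsum (mlist O d (fun _ => seq 0 N)) F.
Proof.
elim: d F => [|d IH] F; first by rewrite /lsum /=; ring.
rewrite lsum_mlist_S /=. apply lsum_ext => a _. by rewrite IH.
Qed.

(** * Complex sums and Dirichlet kernels *)

Definition Copp (z : Cx) : Cx := (- fst z, - snd z).
Definition C1 : Cx := Cof 1.

Lemma Cx_eq (z w : Cx) : fst z = fst w -> snd z = snd w -> z = w.
Proof. by case: z => a b; case: w => c d /= -> ->. Qed.

Lemma Cx_ring : ring_theory C0 C1 Cadd Cmul Csub Copp (@eq Cx).
Proof. split; intros; apply Cx_eq; rewrite /C1 /C0 /=; ring. Qed.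
Add Ring Cx_ring_inst : Cx_ring.

Lemma Cscale_mul a z : Cscale a z = Cmul (Cof a) z.
Proof. apply Cx_eq; rewrite /=; ring. Qed.

Lemma Cof_mul a b : Cof (a * b) = Cmul (Cof a) (Cof b).
Proof. apply Cx_eq; rewrite /=; ring. Qed.

Lemma Cmod_tri z w : Cmod (Cadd z w) <= Cmod z + Cmod w.
Proof. exact (Coquelicot.Complex.Cmod_triangle z w). Qed.

Lemma Cmod_mul z w : Cmod (Cmul z w) = Cmod z * Cmod w.
Proof. exact (Coquelicot.Complex.Cmod_mult z w). Qed.

Lemma Cmod_ge0 z : 0 <= Cmod z.
Proof. apply sqrt_pos. Qed.

#[local] Hint Resolve Cmod_ge0 : pos.

Lemma Cmod_Cof a : Cmod (Cof a) = Rabs a.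
Proof. exact (Coquelicot.Complex.Cmod_R a). Qed.

Lemma Cmod_C0 : Cmod C0 = 0.
Proof. rewrite (Cmod_Cof 0) Rabs_R0 //. Qed.

Lemma Cmod_opp z : Cmod (Copp z) = Cmod z.
Proof. exact (Coquelicot.Complex.Cmod_opp z). Qed.

Lemma Cmod_eq0 z : Cmod z = 0 -> z = C0.
Proof. exact (Coquelicot.Complex.Cmod_eq_0 z). Qed.

Lemma Csub_add z w : Csub z w = Cadd z (Copp w).
Proof. ring. Qed.

Lemma Cmod_sub_sym z w : Cmod (Csub z w) = Cmod (Csub w z).
Proof. rewrite -Cmod_opp; f_equal; ring. Qed.

Lemma Cmod_sub_tri z w : Cmod (Csub z w) <= Cmod z + Cmod w.
Proof. rewrite Csub_add -(Cmod_opp w); apply Cmod_tri. Qed.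

Lemma Cmod_scale a z : 0 <= a -> Cmod (Cscale a z) = a * Cmod z.
Proof. move=> h; rewrite Cscale_mul Cmod_mul Cmod_Cof Rabs_pos_eq //. Qed.

Lemma fst_le_Cmod z : Rabs (fst z) <= Cmod z.
Proof. have := Coquelicot.Complex.Rmax_Cmod z. have := Rmax_l (Rabs (fst z)) (Rabs (snd z)). rewrite -/(Cmod z). move=> h1 h2; exact: Rle_trans h1 h2. Qed.

Lemma snd_le_Cmod z : Rabs (snd z) <= Cmod z.
Proof. have := Coquelicot.Complex.Rmax_Cmod z. have := Rmax_r (Rabs (fst z)) (Rabs (snd z)). move=> h1 h2; exact: Rle_trans h1 h2. Qed.

Lemma Cmod_le_sum z : Cmod z <= Rabs (fst z) + Rabs (snd z).
Proof.
have -> : z = Cadd (Cof (fst z)) (Cmul (0,1) (Cof (snd z))) by apply Cx_eq; rewrite /=; ring.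
apply: Rle_trans (Cmod_tri _ _) _. rewrite Cmod_mul !Cmod_Cof.
have -> : Cmod (0,1) = 1 by rewrite /Cmod /=; transitivity (sqrt 1); [f_equal; ring|apply sqrt_1].
have -> : fst (Cadd (Cof (fst z)) (Cmul (0, 1) (Cof (snd z)))) = fst z by rewrite /=; ring.
have -> : snd (Cadd (Cof (fst z)) (Cmul (0, 1) (Cof (snd z)))) = snd z by rewrite /=; ring.
lra.
Qed.

Lemma Cexpi_add a b : Cexpi (a + b) = Cmul (Cexpi a) (Cexpi b).
Proof. apply Cx_eq; rewrite /Cexpi /= ?cos_plus ?sin_plus; ring. Qed.

Lemma Cexpi_0 : Cexpi 0 = C1.
Proof. by rewrite /Cexpi cos_0 sin_0. Qed.

Lemma Cmod_Cexpi a : Cmod (Cexpi a) = 1.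
Proof.
rewrite /Cmod /=. have := sin2_cos2 a; rewrite /Rsqr => h.
transitivity (sqrt 1); [f_equal; lra|apply sqrt_1].
Qed.

Lemma Cexpi_2PI (k : Z) a : Cexpi (a + 2 * PI * IZR k) = Cexpi a.
Proof.
have H : forall n a, Cexpi (a + 2 * PI * INR n) = Cexpi a.
  move=> n b; rewrite /Cexpi. replace (b + 2 * PI * INR n) with (b + 2 * INR n * PI) by ring.
  by rewrite cos_period sin_period.
case: (Z_le_gt_dec 0 k) => hk.
  by rewrite -(Z2Nat.id k) // -INR_IZR_INZ H.
rewrite -(H (Z.to_nat (- k))). f_equal. rewrite INR_IZR_INZ Z2Nat.id; last lia.
rewrite opp_IZR; ring.
Qed.

Definition lsumC {A} (l : list A) (f : A -> Cx) : Cx := fold_right Cadd C0 (map f l).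

Lemma lsumC_nil {A} (f : A -> Cx) : lsumC [] f = C0.
Proof. by []. Qed.

Lemma lsumC_cons {A} (a : A) l f : lsumC (a :: l) f = Cadd (f a) (lsumC l f).
Proof. by []. Qed.

Lemma lsumC_pair {A} (l : list A) f : lsumC l f = (lsum l (fun a => fst (f a)), lsum l (fun a => snd (f a))).
Proof. elim: l => [//|a l IH]; rewrite lsumC_cons !lsum_cons IH //. Qed.

Lemma lsumC_ext {A} (l : list A) f g : (forall a, In a l -> f a = g a) -> lsumC l f = lsumC l g.
Proof.
move=> h; rewrite !lsumC_pair; f_equal; apply lsum_ext => a /h -> //.
Qed.

Lemma lsumC_plus {A} (l : list A) f g : lsumC l (fun a => Cadd (f a) (g a)) = Cadd (lsumC l f) (lsumC l g).
Proof. by rewrite !lsumC_pair /Cadd /= -!lsum_plus. Qed.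

Lemma lsumC_scal {A} (l : list A) c f : lsumC l (fun a => Cmul c (f a)) = Cmul c (lsumC l f).
Proof. elim: l => [|a l IH]; rewrite ?lsumC_nil ?lsumC_cons ?IH; ring. Qed.

Lemma lsumC_scalr {A} (l : list A) c f : lsumC l (fun a => Cmul (f a) c) = Cmul (lsumC l f) c.
Proof. elim: l => [|a l IH]; rewrite ?lsumC_nil ?lsumC_cons ?IH; ring. Qed.

Lemma lsumC_sub {A} (l : list A) f g : lsumC l (fun a => Csub (f a) (g a)) = Csub (lsumC l f) (lsumC l g).
Proof. elim: l => [|a l IH]; rewrite ?lsumC_nil ?lsumC_cons ?IH; ring. Qed.

Lemma lsumC_zero {A} (l : list A) f : (forall a, In a l -> f a = C0) -> lsumC l f = C0.
Proof. move=> h; rewrite lsumC_pair !lsum_zero // => a /h ->. all: by []. Qed.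

Lemma lsumC_app {A} (l l' : list A) f : lsumC (l ++ l') f = Cadd (lsumC l f) (lsumC l' f).
Proof. rewrite !lsumC_pair !lsum_app //. Qed.

Lemma lsumC_map {A B} (l : list A) (h : A -> B) f : lsumC (map h l) f = lsumC l (fun a => f (h a)).
Proof. by rewrite /lsumC map_map. Qed.

Lemma lsumC_flat_map {A B} (l : list A) (h : A -> list B) f :
  lsumC (flat_map h l) f = lsumC l (fun a => lsumC (h a) f).
Proof. by elim: l => [//|a l IH]; rewrite [flat_map _ _]/= lsumC_app IH lsumC_cons. Qed.

Lemma lsumC_exch {A B} (l : list A) (l' : list B) f :
  lsumC l (fun a => lsumC l' (f a)) = lsumC l' (fun b => lsumC l (fun a => f a b)).
Proof.
elim: l => [|a l IH]; first by rewrite lsumC_nil lsumC_zero.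
rewrite lsumC_cons IH -lsumC_plus. by apply lsumC_ext.
Qed.

Lemma Cmod_lsumC {A} (l : list A) f : Cmod (lsumC l f) <= lsum l (fun a => Cmod (f a)).
Proof.
elim: l => [|a l IH]; first by rewrite lsumC_nil lsum_nil Cmod_C0; lra.
rewrite lsumC_cons lsum_cons; apply: Rle_trans (Cmod_tri _ _) _; lra.
Qed.

Lemma lsumC_const {A} (l : list A) c : lsumC l (fun _ => c) = Cmul (Cof (INR (length l))) c.
Proof. rewrite lsumC_pair !lsum_const; apply Cx_eq; rewrite /=; ring. Qed.

Lemma lsumC_Cof {A} (l : list A) f : lsumC l (fun a => Cof (f a)) = Cof (lsum l f).
Proof. by rewrite lsumC_pair; apply Cx_eq => //=; apply lsum_zero. Qed.

Definition cprod (n : nat) (g : nat -> Cx) : Cx := fold_right Cmul C1 (map g (seq 0 n)).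

Lemma cprod_S n g : cprod (S n) g = Cmul (cprod n g) (g n).
Proof.
rewrite /cprod seq_S map_app /=.
elim: (map g (seq 0 n)) => [|a l IH] /=; [ring|rewrite IH; ring].
Qed.

Lemma cprod_ext n g h : (forall i, (i < n)%nat -> g i = h i) -> cprod n g = cprod n h.
Proof.
elim: n => [//|n IH] H; rewrite !cprod_S (IH (fun i hi => H i ltac:(lia))) H //; lia.
Qed.

Lemma cprod_mul n g h : cprod n (fun i => Cmul (g i) (h i)) = Cmul (cprod n g) (cprod n h).
Proof. elim: n => [|n IH]; first by rewrite /cprod /=; ring. rewrite !cprod_S IH; ring. Qed.

Lemma cprod_zero n g i : (i < n)%nat -> g i = C0 -> cprod n g = C0.
Proof.
elim: n => [|n IH] hi h0; first lia. rewrite cprod_S.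
case: (Nat.eq_dec i n) => [e|hne]; first by rewrite -e h0; ring.
rewrite IH //; [ring|lia].
Qed.

Lemma Cmod_cprod n g : Cmod (cprod n g) = rprod n (fun i => Cmod (g i)).
Proof.
elim: n => [|n IH]; first by rewrite /cprod /rprod /= Cmod_Cof Rabs_R1.
by rewrite cprod_S rprod_S Cmod_mul IH.
Qed.

Lemma cprod_Cof n g : cprod n (fun i => Cof (g i)) = Cof (rprod n g).
Proof. elim: n => [//|n IH]; by rewrite cprod_S rprod_S IH Cof_mul. Qed.

Lemma cprod_one n g : (forall i, (i < n)%nat -> g i = C1) -> cprod n g = C1.
Proof.
elim: n => [//|n IH] H; rewrite cprod_S (IH (fun i hi => H i ltac:(lia))) H; [ring|lia].
Qed.

Lemma Cexpi_kdot d k x : Cexpi (kdot d k x) = cprod d (fun i => Cexpi (IZR (k i) * x i)).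
Proof.
rewrite /kdot; elim: d => [|d IH]; first by rewrite /rsum /= Cexpi_0.
by rewrite rsum_S Cexpi_add IH cprod_S.
Qed.

Lemma lsumC_mlist_S {A} (a0 : A) d ls f :
  lsumC (mlist a0 (S d) ls) f = lsumC (ls d) (fun a => lsumC (mlist a0 d ls) (fun j => f (upd j d a))).
Proof.
rewrite [mlist _ _ _]/= lsumC_flat_map; apply lsumC_ext => a _; by rewrite lsumC_map.
Qed.

Lemma lsumC_mlist_prod {A} (a0 : A) d ls (f : nat -> A -> Cx) :
  lsumC (mlist a0 d ls) (fun j => cprod d (fun i => f i (j i))) = cprod d (fun i => lsumC (ls i) (f i)).
Proof.
elim: d => [|d IH]; first by rewrite /lsumC /cprod /=; ring.
rewrite lsumC_mlist_S cprod_S -IH.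
transitivity (lsumC (ls d) (fun a => Cmul (f d a) (lsumC (mlist a0 d ls) (fun j => cprod d (fun i => f i (j i)))))).
  apply lsumC_ext => a _. rewrite -lsumC_scal; apply lsumC_ext => j _.
  rewrite cprod_S upd_eq. 
  rewrite (cprod_ext _ _ (fun i => f i (j i))); first ring.
  move=> i hi; rewrite upd_neq //; lia.
rewrite lsumC_scalr; ring.
Qed.

Lemma csumbox_lsumC d N F : csumbox d N F = lsumC (mlist O d (fun _ => seq 0 N)) F.
Proof.
elim: d F => [|d IH] F; first by rewrite /lsumC /=; ring.
rewrite lsumC_mlist_S /=. apply lsumC_ext => a _. by rewrite IH.
Qed.

Lemma csum_S n g : csum (S n) g = Cadd (csum n g) (g n).
Proof. rewrite /csum -!/(lsumC _ _) seq_S lsumC_app lsumC_cons lsumC_nil /=; ring. Qed.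

Lemma csum_lsumC n g : csum n g = lsumC (seq 0 n) g.
Proof. by []. Qed.

(** [lim] is an epsilon choice, so it can be evaluated only after convergence has been proved. *)
Lemma lim_cv u l : Un_cv u l -> lim u = l.
Proof.
move=> h. have H : Un_cv u (lim u) by apply (epsilon_spec (inhabits 0) (fun l => Un_cv u l)); exists l.
exact: UL_sequence H h.
Qed.

Lemma Un_cv_eventually u l n0 : (forall n, (n0 <= n)%nat -> u n = l) -> Un_cv u l.
Proof.
move=> h eps he; exists n0 => n hn. rewrite h; last lia. by rewrite /Rdist Rminus_diag Rabs_R0.
Qed.

Lemma limC_eventually u l n0 : (forall n, (n0 <= n)%nat -> u n = l) -> limC u = l.
Proof.
move=> h; apply Cx_eq; rewrite /limC /=; apply lim_cv, (Un_cv_eventually _ _ n0) => n hn; by rewrite h.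
Qed.

Lemma Un_cv_const c : Un_cv (fun _ => c) c.
Proof. by apply (Un_cv_eventually _ _ O). Qed.

Lemma Un_cv_lsum {A} (l : list A) u v : (forall a, In a l -> Un_cv (u a) (v a)) ->
  Un_cv (fun n => lsum l (fun a => u a n)) (lsum l v).
Proof.
elim: l => [|a l IH] h; first exact (Un_cv_const 0).
rewrite lsum_cons. apply (CV_plus (u a) (fun n => lsum l (fun b => u b n))); first by apply h; left.
apply IH => b hb; apply h; by right.
Qed.

Lemma Un_cv_ext u v l : (forall n, u n = v n) -> Un_cv u l -> Un_cv v l.
Proof. move=> h H eps he; have [N HN] := H eps he; exists N => n hn; rewrite -h; exact: HN. Qed.

Lemma Un_cv_le u l B : Un_cv u l -> (exists n0, forall n, (n0 <= n)%nat -> u n <= B) -> l <= B.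
Proof.
move=> h [n0 H]. apply Rnot_lt_le => hl.
have [N HN] := h (l - B) ltac:(lra).
have := HN (N + n0)%nat ltac:(lia). have := H (N + n0)%nat ltac:(lia).
rewrite /Rdist => h1 h2. apply Rabs_def2 in h2. lra.
Qed.

Lemma Un_cv_ge u l B : Un_cv u l -> (exists n0, forall n, (n0 <= n)%nat -> B <= u n) -> B <= l.
Proof.
move=> h [n0 H]. apply Rnot_lt_le => hl.
have [N HN] := h (B - l) ltac:(lra).
have := HN (N + n0)%nat ltac:(lia). have := H (N + n0)%nat ltac:(lia).
rewrite /Rdist => h1 h2. apply Rabs_def2 in h2. lra.
Qed.

(* A subadditive [2 pi]-periodic substitute for the distance to [2 pi Z]. *)
Definition rho (t : R) : R := Rabs (sin (t / 2)).

Lemma rho_ge0 t : 0 <= rho t.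
Proof. apply Rabs_pos. Qed.

#[local] Hint Resolve rho_ge0 : pos.

Lemma rho_le1 t : rho t <= 1.
Proof. rewrite /rho; apply Rabs_le; have := SIN_bound (t / 2); lra. Qed.

Lemma rho_opp t : rho (- t) = rho t.
Proof. rewrite /rho. replace (- t / 2) with (- (t / 2)) by field. by rewrite sin_neg Rabs_Ropp. Qed.

Lemma rho_add a b : rho (a + b) <= rho a + rho b.
Proof.
rewrite /rho. replace ((a + b) / 2) with (a / 2 + b / 2) by field. rewrite sin_plus.
apply: Rle_trans (Rabs_triang _ _) _. rewrite !Rabs_mult.
have ha : Rabs (cos (a / 2)) <= 1 by apply Rabs_le; have := COS_bound (a / 2); lra.
have hb : Rabs (cos (b / 2)) <= 1 by apply Rabs_le; have := COS_bound (b / 2); lra.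
have := Rabs_pos (sin (a / 2)); have := Rabs_pos (sin (b / 2)); nra.
Qed.

Lemma rho_2PI t (k : Z) : rho (t + 2 * PI * IZR k) = rho t.
Proof.
have H : forall t n, rho (t + 2 * PI * INR n) = rho t.
  move=> s; elim => [|n IH]; first by f_equal; rewrite /=; ring.
  rewrite -IH S_INR /rho.
  replace ((s + 2 * PI * (INR n + 1)) / 2) with ((s + 2 * PI * INR n) / 2 + PI) by field.
  by rewrite neg_sin Rabs_Ropp.
case: (Z_le_gt_dec 0 k) => hk.
  by rewrite -(Z2Nat.id k) // -INR_IZR_INZ H.
rewrite -(H _ (Z.to_nat (- k))). f_equal. rewrite INR_IZR_INZ Z2Nat.id; last lia.
rewrite opp_IZR; ring.
Qed.

(** From [sin u >= u - u^3 / 6] and [u^2 <= 4]. The crude bound [PI <= 4] puts [[0, PI / 2]] inside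
    the range. *)
Lemma sin_ge_third u : 0 <= u <= 2 -> u / 3 <= sin u.
Proof.
move=> hu.
have hpi : 2 <= PI by have := PI2_3_2; lra.
have [h _] := sin_bound u O ltac:(lra) ltac:(lra).
rewrite /sin_approx /sin_term /= in h.
have : 0 <= u * (4 - u * u) by apply Rmult_le_pos; nra.
lra.
Qed.

Lemma sin_le_id u : 0 <= u -> sin u <= u.
Proof.
move=> hu; case: (Req_dec u 0) => h; first by rewrite h sin_0; lra.
apply Rlt_le, sin_lt_x; lra.
Qed.

Lemma rho_le_abs t : rho t <= Rabs t / 2.
Proof.
have H : forall t, 0 <= t -> rho t <= t / 2.
  move=> {}t ht. rewrite /rho. 
  case: (Rle_dec (t / 2) 1) => h.
    rewrite Rabs_pos_eq; first by apply sin_le_id; lra.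
    apply sin_ge_0; have := PI2_3_2; lra.
  apply: Rle_trans (rho_le1 t) _; lra.
case: (Rle_dec 0 t) => ht; first by rewrite Rabs_pos_eq //; apply H.
rewrite -rho_opp Rabs_left; last lra. apply H; lra.
Qed.

Lemma rho_lower t : 0 <= t <= 2 * PI -> Rmin t (2 * PI - t) / 6 <= rho t.
Proof.
move=> ht. have hpi : PI <= 4 by apply PI_4.
rewrite /rho Rabs_pos_eq; last by apply sin_ge_0; lra.
case: (Rle_dec t PI) => h.
  have := sin_ge_third (t / 2) ltac:(lra). have := Rmin_l t (2 * PI - t); lra.
have := sin_ge_third (PI - t / 2) ltac:(lra). rewrite -sin_PI_x.
replace (PI - (PI - t / 2)) with (t / 2) by ring.
have := Rmin_r t (2 * PI - t); lra.
Qed.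

Lemma Cexpi_sub1 t : Cmod (Csub (Cexpi t) C1) = 2 * rho t.
Proof.
have -> : Csub (Cexpi t) C1 = Cmul (Cexpi (t / 2)) (Cmul (0, 2) (Cof (sin (t / 2)))).
  replace t with (2 * (t / 2)) at 1 by field. set u := t / 2.
  apply Cx_eq; rewrite /Cexpi /= ?cos_2a_sin ?sin_2a; ring.
rewrite !Cmod_mul Cmod_Cexpi Cmod_Cof.
have -> : Cmod (0, 2) = 2.
  rewrite /Cmod /=. replace (0 * (0 * 1) + 2 * (2 * 1)) with (2 * 2) by ring. apply sqrt_square; lra.
rewrite /rho; ring.
Qed.

Lemma geom_expi n t : Cmul (Csub (Cexpi t) C1) (csum n (fun a => Cexpi (INR a * t))) = Csub (Cexpi (INR n * t)) C1.
Proof.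
elim: n => [|n IH].
  rewrite /csum /= Rmult_0_l Cexpi_0; ring.
rewrite csum_S S_INR. replace ((INR n + 1) * t) with (t + INR n * t) by ring. rewrite Cexpi_add.
replace (Cmul (Csub (Cexpi t) C1) (Cadd (csum n (fun a => Cexpi (INR a * t))) (Cexpi (INR n * t))))
 with (Cadd (Cmul (Csub (Cexpi t) C1) (csum n (fun a => Cexpi (INR a * t)))) (Cmul (Csub (Cexpi t) C1) (Cexpi (INR n * t)))) by ring.
rewrite IH; ring.
Qed.

Lemma dirichlet_bound n t : Cmod (csum n (fun a => Cexpi (INR a * t))) * rho t <= 1.
Proof.
have h : Cmod (Cmul (Csub (Cexpi t) C1) (csum n (fun a => Cexpi (INR a * t)))) <= 2.
  rewrite geom_expi. apply: Rle_trans (Cmod_sub_tri _ _) _. rewrite Cmod_Cexpi Cmod_Cof Rabs_R1; lra.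
rewrite Cmod_mul Cexpi_sub1 in h. lra.
Qed.

Lemma dirichlet_bound' n t : Cmod (csum n (fun a => Cexpi (INR a * t))) <= INR n.
Proof.
apply: Rle_trans (Cmod_lsumC _ _) _. 
rewrite (lsum_ext _ _ (fun _ => 1)); last by move=> a _; rewrite Cmod_Cexpi.
rewrite lsum_const length_seq; lra.
Qed.

(** For [q <> 0] the ratio [Cexpi t] is an [n]-th root of unity; it differs from 1 because
    [0 < |q| < n] keeps [rho t] positive, so the geometric sum vanishes. *)
Lemma orthogonality (n : nat) (q : Z) : (Z.abs q < Z.of_nat n)%Z ->
  csum n (fun a => Cexpi (INR a * (2 * PI * IZR q / INR n))) = if Z.eqb q 0 then Cof (INR n) else C0.
Proof.
move=> hq.
have hn : 0 < INR n by apply lt_0_INR; lia.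
case: Z.eqb_spec => [->|hne].
  rewrite csum_lsumC (lsumC_ext _ _ (fun _ => C1)).
    rewrite lsumC_const length_seq; ring.
  move=> a _. replace (INR a * (2 * PI * 0 / INR n)) with 0 by (field; lra). by rewrite Cexpi_0.
set t := 2 * PI * IZR q / INR n.
have h := geom_expi n t.
have e : Cexpi (INR n * t) = C1.
  rewrite -Cexpi_0 -(Cexpi_2PI q 0). f_equal. rewrite /t; field; lra.
rewrite e in h.
have hs : Cmod (Csub (Cexpi t) C1) <> 0.
  rewrite Cexpi_sub1 => h0.
  have {}h0 : rho t = 0 by lra.
  have h1 : rho (Rabs t) = 0 by rewrite /Rabs; case: Rcase_abs => _; rewrite ?rho_opp.
  have hpi := PI_RGT_0.
  have ha : Rabs t = 2 * PI * (IZR (Z.abs q) / INR n).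
    have hc : 0 < 2 * PI / INR n by pos.
    rewrite /t. replace (2 * PI * IZR q / INR n) with (2 * PI / INR n * IZR q) by (field; lra).
    rewrite Rabs_mult (Rabs_pos_eq (2 * PI / INR n)) -?abs_IZR; last lra. field; lra.
  have hr : 0 < IZR (Z.abs q) / INR n < 1.
    have : 0 < IZR (Z.abs q) by apply IZR_lt; lia.
    have : IZR (Z.abs q) < INR n by rewrite INR_IZR_INZ; apply IZR_lt.
    move=> h2 h3; split; first by apply Rdiv_lt_0_compat.
    apply Rmult_lt_reg_r with (INR n) => //. field_simplify; lra.
  have := rho_lower (Rabs t) ltac:(rewrite ha; split; nra).
  rewrite h1 ha. rewrite /Rmin; case: Rle_dec => _; nra.
set D := csum _ _. 
have hD : Cmod D = 0.
  have : Cmod (Cmul (Csub (Cexpi t) C1) D) = 0.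
    rewrite h. replace (Csub C1 C1) with C0 by ring. apply Cmod_C0.
  rewrite Cmod_mul => /Rmult_integral; by case.
exact: Cmod_eq0.
Qed.

(** * Sums over equispaced grids *)

Lemma rsum_scal n c g : rsum n (fun a => c * g a) = c * rsum n g.
Proof. exact: lsum_scal. Qed.

Lemma rsum_plus n f g : rsum n (fun a => f a + g a) = rsum n f + rsum n g.
Proof. exact: lsum_plus. Qed.

Lemma rsum_ge0 n g : (forall i, (i < n)%nat -> 0 <= g i) -> 0 <= rsum n g.
Proof. move=> H; apply lsum_ge0 => i /in_seq hi; apply H; lia. Qed.

#[local] Hint Resolve rsum_ge0 : pos.

Lemma rsum_S_l n g : rsum (S n) g = g O + rsum n (fun i => g (S i)).
Proof. elim: n => [|n IH]; first by rewrite /rsum /=; ring. rewrite rsum_S IH rsum_S; ring. Qed.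

Lemma rsum_rev n g : rsum n g = rsum n (fun i => g (n - 1 - i)%nat).
Proof.
elim: n => [//|n IH]. rewrite rsum_S IH rsum_S_l Rplus_comm. congr (_ + _); first by f_equal; lia.
apply rsum_ext => i hi; f_equal; lia.
Qed.

Lemma rsum_le_mono n m g : (forall i, (i < m)%nat -> 0 <= g i) -> (n <= m)%nat -> rsum n g <= rsum m g.
Proof.
move=> h; elim: m h => [|m IH] h hnm; first by replace n with O by lia; lra.
case: (Nat.eq_dec n (S m)) => [->|hne]; first lra.
rewrite rsum_S. have := h m ltac:(lia).
have := IH (fun i hi => h i ltac:(lia)) ltac:(lia). lra.
Qed.

Lemma rsum_periodic (N : nat) (G : Z -> R) (m : Z) : (forall k, G (k + Z.of_nat N)%Z = G k) ->
  rsum N (fun u => G (Z.of_nat u + m)%Z) = rsum N (fun u => G (Z.of_nat u)).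
Proof.
move=> hG.
have step : forall m, rsum N (fun u => G (Z.of_nat u + (m + 1))%Z) = rsum N (fun u => G (Z.of_nat u + m)%Z).
  move=> k. have := rsum_telescope N (fun u => G (Z.of_nat u + k)%Z).
  replace (Z.of_nat N + k)%Z with (k + Z.of_nat N)%Z by lia.
  replace (Z.of_nat 0 + k)%Z with k by lia. rewrite hG.
  rewrite (rsum_ext _ _ (fun i => G (Z.of_nat i + (k + 1))%Z + -1 * G (Z.of_nat i + k)%Z)).
    rewrite rsum_plus rsum_scal; lra.
  move=> i _. replace (Z.of_nat (S i) + k)%Z with (Z.of_nat i + (k+1))%Z by lia. ring.
have H : forall n m, rsum N (fun u => G (Z.of_nat u + (m + Z.of_nat n))%Z) = rsum N (fun u => G (Z.of_nat u + m)%Z).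
  elim => [|n IH] k. 
    apply rsum_ext => i _; f_equal; lia.
  rewrite -(IH k) -(step (k + Z.of_nat n)%Z). apply rsum_ext => i _; f_equal; lia.
case: (Z_le_gt_dec 0 m) => hm.
  have -> : rsum N (fun u => G (Z.of_nat u)) = rsum N (fun u => G (Z.of_nat u + 0)%Z) by apply rsum_ext => i _; f_equal; lia.
  rewrite -(H (Z.to_nat m) 0%Z). apply rsum_ext => i _; f_equal; lia.
rewrite -(H (Z.to_nat (- m)) m). apply rsum_ext => i _; f_equal; lia.
Qed.

(** Replaces sums over a circle, with arbitrary position of [x], by a one-sided sum. The node next
    to [x] gives at most [F 0], and the nodes on either side give one copy of the sum each, whence
    the factor 3. *)
Lemma grid_sum_le (F : R -> R) (N : nat) x al : (0 < N)%nat ->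
  (forall a b, 0 <= a <= b -> F b <= F a) -> (forall a, 0 <= a -> 0 <= F a) ->
  rsum N (fun u => F (rho (x - (al + 2 * PI * INR u / INR N)))) <= 3 * rsum N (fun v => F (INR v / INR N)).
Proof.
move=> hN hdec hpos. have hN' : 0 < INR N by pos.
have hpi3 : 3 < PI by have := PI2_3_2; lra.
set w := (x - al) * INR N / (2 * PI).
set m := Int_part w. have [hm1 hm2] := base_Int_part w. rewrite -/m in hm1 hm2.
(* Offset of [x] from the preceding node; periodicity then lets the summation start there. *)
set z := x - al - 2 * PI * IZR m / INR N.
have hz : 0 <= z * INR N <= 2 * PI.
  have e : z * INR N = 2 * PI * (w - IZR m) by rewrite /z /w; field; lra.
  rewrite e; nra.
pose G (k : Z) := F (rho (2 * PI * IZR k / INR N - z)).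
have hG : forall k, G (k + Z.of_nat N)%Z = G k.
  move=> k; rewrite /G -(rho_2PI (2 * PI * IZR k / INR N - z) 1). do 2 f_equal.
  rewrite plus_IZR -INR_IZR_INZ; field; lra.
have -> : rsum N (fun u => F (rho (x - (al + 2 * PI * INR u / INR N)))) = rsum N (fun u => G (Z.of_nat u)).
  rewrite -(rsum_periodic N G (- m) hG). apply rsum_ext => i _.
  rewrite /G -rho_opp. do 2 f_equal. rewrite plus_IZR -INR_IZR_INZ opp_IZR /z; field; lra.
(* The constant [/ 6] of [rho_lower] is absorbed by [2 * PI >= 6], so that [F] is evaluated exactly
   at multiples of [/ N]. Both neighbours are kept because the nearer side is not known. *)
have hterm : forall i, (S i < N)%nat -> G (Z.of_nat (S i)) <= F (INR i / INR N) + F (INR (N - 1 - S i) / INR N).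
  move=> i hi. set th := 2 * PI * IZR (Z.of_nat (S i)) / INR N - z.
  have hth : th * INR N = 2 * PI * INR (S i) - z * INR N by rewrite /th -INR_IZR_INZ; field; lra.
  have hiN : INR (S i) <= INR N - 1.
    have : INR (S (S i)) <= INR N by apply le_INR; lia. rewrite (S_INR (S i)); lra.
  have hi0 := pos_INR i. rewrite S_INR in hth hiN.
  have h1 : 0 <= th by apply Rmult_le_reg_r with (INR N) => //; nra.
  have h2 : th <= 2 * PI by apply Rmult_le_reg_r with (INR N) => //; nra.
  have hr := rho_lower th ltac:(lra).
  have a1 : INR i / INR N <= th / 6.
    apply Rmult_le_reg_r with (INR N * 6); first lra.
    replace (INR i / INR N * (INR N * 6)) with (6 * INR i) by (field; lra).
    replace (th / 6 * (INR N * 6)) with (th * INR N) by field. nra.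
  have a2 : INR (N - 1 - S i) / INR N <= (2 * PI - th) / 6.
    have -> : INR (N - 1 - S i) = INR N - 1 - (INR i + 1) by rewrite minus_INR ?minus_INR ?(S_INR i) //=; lia.
    apply Rmult_le_reg_r with (INR N * 6); first lra.
    replace ((2 * PI - th) / 6 * (INR N * 6)) with (2 * PI * INR N - th * INR N) by field.
    replace ((INR N - 1 - (INR i + 1)) / INR N * (INR N * 6)) with (6 * (INR N - 1 - (INR i + 1))) by (field; lra).
    rewrite hth. have : 0 <= (2 * PI - 6) * (INR N - INR i - 1) by pos.
    lra.
  have p1 : 0 <= INR i / INR N by pos.
  have p2 : 0 <= INR (N - 1 - S i) / INR N by pos.
  rewrite /G -/th. move: hr. rewrite /Rmin; case: Rle_dec => _ hr.
    have := hdec (INR i / INR N) (rho th) ltac:(lra). have := hpos _ p2; lra.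
  have := hdec (INR (N - 1 - S i) / INR N) (rho th) ltac:(lra). have := hpos _ p1; lra.
have hF : forall i, 0 <= F (INR i / INR N) by pos.
case: N hN hN' @w @m hm1 hm2 @z hz @G hG hterm hF => [|n] hN hN' w m hm1 hm2 z hz G hG hterm hF; first lia.
rewrite rsum_S_l.
have h0 : G (Z.of_nat 0) <= F (INR 0 / INR (S n)).
  have -> : INR 0 / INR (S n) = 0 by rewrite /Rdiv Rmult_0_l.
  rewrite /G. apply hdec; split; [lra|apply rho_ge0].
have h1 : rsum n (fun i => G (Z.of_nat (S i))) <= rsum n (fun i => F (INR i / INR (S n))) + rsum n (fun i => F (INR i / INR (S n))).
  rewrite {2}(rsum_rev n (fun i => F (INR i / INR (S n)))) -rsum_plus.
  apply rsum_le => i hi. have := hterm i ltac:(lia).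
  by replace (S n - 1 - S i)%nat with (n - 1 - i)%nat by lia.
have h2 : rsum n (fun i => F (INR i / INR (S n))) <= rsum (S n) (fun i => F (INR i / INR (S n))).
  apply rsum_le_mono => //; lia.
have h3 : F (INR 0 / INR (S n)) <= rsum (S n) (fun i => F (INR i / INR (S n))).
  have := rsum_le_mono 1 (S n) (fun i => F (INR i / INR (S n))) (fun i _ => hF i) ltac:(lia).
  rewrite {1}/rsum /=; lra.
lra.
Qed.

(** Concavity of the power [e], read off from [rpow_tangent] for the inverse power [/ e]. The
    derivative is taken at the right end [w], the only end known to be positive. *)
Lemma rpow_concave_diff e z w : 0 < e <= 1 -> 0 <= z <= w -> 0 < w ->
  e * rpow w (e - 1) * (w - z) <= rpow w e - rpow z e.
Proof.
move=> he hz hw.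
have hie : 1 <= / e by rewrite -Rinv_1; apply Rinv_le_contravar; lra.
have := rpow_tangent (/ e) (rpow z e) (rpow w e) hie (rpow_ge0 _ _) (rpow_gt0 _ _ hw).
rewrite !rpow_rpow Rinv_r ?rpow_1; try lra.
replace (e * (/ e - 1)) with (- (e - 1)) by (field; lra).
rewrite rpow_opp //. have hp := rpow_gt0 w (e - 1) hw => h.
set A := rpow w (e - 1) in hp h *.
have : e * A * (w + / e * / A * (rpow z e - rpow w e)) <= e * A * z.
  apply Rmult_le_compat_l; nra.
replace (e * A * (w + / e * / A * (rpow z e - rpow w e))) with (e * A * w + (rpow z e - rpow w e)) by (field; lra).
lra.
Qed.

(** The right-hand side is, up to a constant, the derivative of [w^e / (1 + w^e)]: this is what lets
    sums of the left-hand side telescope. [e <= 1 - s] serves for [w <= 1] and [e <= g + s - 1] for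
    [w >= 1]. *)
Lemma weight_comparison g s e w : 0 <= g -> 0 < e -> e <= 1 - s -> e <= g + s - 1 -> 0 < w ->
  rpow (1 + w) (- g) * rpow w (- s) <= 4 * (rpow w (e - 1) / (1 + rpow w e) ^ 2).
Proof.
move=> hg he h1 h2 hw.
have pe := rpow_gt0 w e hw.
apply Rmult_le_reg_r with ((1 + rpow w e) ^ 2); first nra.
replace (4 * (rpow w (e - 1) / (1 + rpow w e) ^ 2) * (1 + rpow w e) ^ 2) with (4 * rpow w (e - 1)) by (field; lra).
have pg := rpow_gt0 (1 + w) (- g) ltac:(lra).
have ps := rpow_gt0 w (- s) ltac:(lra).
case: (Rle_dec w 1) => h.
  have a1 : rpow w (- s) <= rpow w (e - 1) by apply rpow_exp_le1; lra.
  have a2 : rpow w e <= 1 by apply rpow_le1; lra.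
  have a3 : rpow (1 + w) (- g) <= 1.
    have := rpow_le_neg 1 (1 + w) (- g) ltac:(lra) ltac:(lra). by rewrite rpow_base1.
  rewrite (Rmult_comm 4).
  apply Rmult_le_compat; try nra.
have a1 : rpow (1 + w) (- g) <= rpow w (- g) by apply rpow_le_neg; lra.
have a2 : 1 <= rpow w e by apply rpow_ge1; lra.
have a4 : rpow w (- g) * rpow w (- s) <= rpow w (- e - 1).
  rewrite -rpow_add; apply rpow_exp_le; lra.
have a5 : rpow (1 + w) (- g) * rpow w (- s) <= rpow w (- e - 1).
  apply: Rle_trans a4; apply Rmult_le_compat_r; lra.
have e1 : rpow w (- e - 1) * (4 * (rpow w e * rpow w e)) = 4 * rpow w (e - 1).
  rewrite -rpow_add (Rmult_comm 4) -Rmult_assoc -rpow_add Rmult_comm. do 2 f_equal; ring.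
rewrite -e1. apply Rmult_le_compat; try nra.
Qed.

(** A Riemann sum with mesh [h] of the integral of [(1 + w)^(-g) w^(-s)], which converges at 0 by
    [s < 1] and at infinity by [g + s > 1]. Telescoping the bounded primitive [Psi] makes the bound
    uniform in [h] and [n]. *)
Lemma power_sum_bound g s : 0 <= g -> s < 1 -> 1 < g + s -> exists C, 0 < C /\ forall h n, 0 < h ->
  rsum n (fun v => h * (rpow (1 + h * INR (S v)) (- g) * rpow (h * INR (S v)) (- s))) <= C.
Proof.
move=> hg hs hgs.
set e := Rmin 1 (Rmin (1 - s) (g + s - 1)).
have he : 0 < e by apply Rmin_glb_lt; [lra|apply Rmin_glb_lt; lra].
have he1 : e <= 1 by apply Rmin_l.
have he2 : e <= 1 - s by apply: Rle_trans (Rmin_r _ _) _; apply Rmin_l.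
have he3 : e <= g + s - 1 by apply: Rle_trans (Rmin_r _ _) _; apply Rmin_r.
exists (4 / e); split; first pos.
move=> h n hh.
pose Psi w := rpow w e / (1 + rpow w e).
have hP : forall w, 0 <= Psi w <= 1.
  move=> w; rewrite /Psi; have := rpow_ge0 w e => hp; split; first by apply Rdiv_ge0; lra.
  apply Rmult_le_reg_r with (1 + rpow w e); first lra. field_simplify; lra.
apply: Rle_trans (_ : _ <= 4 / e * (Psi (h * INR n) - Psi (h * INR 0))) _; last first.
  have : 0 < 4 / e by pos. have := hP (h * INR n). have := hP (h * INR 0). nra.
rewrite -(rsum_telescope n (fun i => Psi (h * INR i))) -rsum_scal. apply rsum_le => i _.
have hi := pos_INR i.
have hw : 0 < h * INR (S i) by rewrite S_INR; nra.
set w := h * INR (S i) in hw *. set z := h * INR i.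
have hz : 0 <= z <= w by rewrite /z /w S_INR; nra.
have hwz : w - z = h by rewrite /w /z S_INR; ring.
have h1 := rpow_concave_diff e z w ltac:(lra) hz hw. rewrite hwz in h1.
have h2 := weight_comparison g s e w hg he he2 he3 hw.
have pz := rpow_ge0 z e.
have hzw : rpow z e <= rpow w e by apply rpow_le; lra.
have h3 : (rpow w e - rpow z e) / (1 + rpow w e) ^ 2 <= Psi w - Psi z.
  have -> : Psi w - Psi z = (rpow w e - rpow z e) / ((1 + rpow w e) * (1 + rpow z e)) by rewrite /Psi; field; lra.
  mul_l. apply Rinv_le_contravar; nra.
apply: Rle_trans (_ : _ <= h * (4 * (rpow w (e - 1) / (1 + rpow w e) ^ 2))) _.
  apply Rmult_le_compat_l; lra.
apply: Rle_trans (_ : _ <= 4 / e * ((rpow w e - rpow z e) / (1 + rpow w e) ^ 2)) _; last first.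
  apply Rmult_le_compat_l => //. apply Rlt_le, Rdiv_lt_0_compat; lra.
replace (h * (4 * (rpow w (e - 1) / (1 + rpow w e) ^ 2))) with (4 / e * ((e * rpow w (e - 1) * h) / (1 + rpow w e) ^ 2)) by (field; lra).
mul_l.
apply Rmult_le_compat_r => //. apply Rlt_le, Rinv_0_lt_compat; nra.
Qed.

(** Passes from the left to the right end of a cell, since [power_sum_bound] avoids the singular
    point 0 by using right ends. *)
Lemma shift_weight h v q : 0 < h <= 1 -> 0 <= q ->
  rpow (1 + h * INR v) (- q) <= rpow 2 q * rpow (1 + h * INR (S v)) (- q).
Proof.
move=> hh hq. have hv := pos_INR v.
have -> : rpow 2 q = rpow (/ 2) (- q) by rewrite rpow_inv ?Ropp_involutive; lra.
rewrite -rpow_mul; [|lra|rewrite S_INR; nra]. apply rpow_le_neg; first lra. rewrite S_INR; nra.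
Qed.

Definition node (al : R) (N u : nat) : R := al + 2 * PI * INR u / INR N.

Lemma grid_avg_decay q : 1 < q -> exists C, 0 < C /\ forall (N : nat) B x al, (0 < N)%nat -> 0 < B <= INR N ->
  rsum N (fun u => B / INR N * rpow (1 + B * rho (x - node al N u)) (- q)) <= C.
Proof.
move=> hq.
have [C [hC H]] := power_sum_bound (q - 1/2) (1/2) ltac:(lra) ltac:(lra) ltac:(lra).
exists (3 * (rpow 2 q * C)); split; first pos.
move=> N B x al hN hB. have hN' : 0 < INR N by pos.
have hh : 0 < B / INR N <= 1.
  split; first by apply Rdiv_lt_0_compat; lra.
  apply Rmult_le_reg_r with (INR N) => //. field_simplify; lra.
rewrite rsum_scal.
have h1 := grid_sum_le (fun a => rpow (1 + B * a) (- q)) N x al hN.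
have {}h1 := h1 ltac:(move=> a b hab; apply rpow_le_neg; nra) ltac:(move=> a _; apply rpow_ge0).
apply: Rle_trans (_ : _ <= B / INR N * (3 * rsum N (fun v => rpow (1 + B * (INR v / INR N)) (- q)))) _.
  apply Rmult_le_compat_l; [lra|exact h1].
rewrite (Rmult_comm 3) -Rmult_assoc (Rmult_comm 3). mul_r.
rewrite -rsum_scal. set h := B / INR N in hh *.
apply: Rle_trans (_ : _ <= rpow 2 q * rsum N (fun v => h * (rpow (1 + h * INR (S v)) (- (q - 1/2)) * rpow (h * INR (S v)) (- (1/2))))) _; last first.
  mul_l. apply H; lra.
rewrite -rsum_scal; apply rsum_le => v _.
replace (B * (INR v / INR N)) with (h * INR v) by (rewrite /h; field; lra).
have hv := pos_INR v.
rewrite -Rmult_assoc (Rmult_comm _ h) Rmult_assoc. mul_l.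
apply: Rle_trans (shift_weight h v q hh ltac:(lra)) _.
mul_l.
replace (- q) with (- (q - 1/2) + - (1/2)) by ring. rewrite rpow_add.
mul_l.
apply rpow_le_neg; first lra. rewrite S_INR; nra.
Qed.

(** First half of the Schur test: a kernel of width [/ B] tested on a singular weight. The added
    [/ N] keeps the weight finite when [x] is a node, and after scaling it turns [v] into [S v], as
    [power_sum_bound] requires. *)
Lemma grid_avg_singular g s : 0 <= g -> s < 1 -> 1 < g + s -> 0 <= s ->
  exists C, 0 < C /\ forall (N : nat) B x al, (0 < N)%nat -> 0 < B <= INR N ->
  rsum N (fun u => B / INR N * (rpow (1 + B * rho (x - node al N u)) (- g) * rpow (rho (x - node al N u) + / INR N) (- s))) 
   <= C * rpow B s.
Proof.
move=> hg hs hgs hs0.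
have [C [hC H]] := power_sum_bound g s hg hs hgs.
exists (3 * (rpow 2 g * C)); split; first pos.
move=> N B x al hN hB. have hN' : 0 < INR N by pos.
have hh : 0 < B / INR N <= 1.
  split; first by apply Rdiv_lt_0_compat; lra.
  apply Rmult_le_reg_r with (INR N) => //. field_simplify; lra.
rewrite rsum_scal.
have h1 := grid_sum_le (fun a => rpow (1 + B * a) (- g) * rpow (a + / INR N) (- s)) N x al hN.
have {}h1 := h1 ltac:(move=> a b hab; apply Rmult_le_compat; try apply rpow_ge0; apply rpow_le_neg; nra) ltac:(move=> a _; apply Rmult_le_pos; apply rpow_ge0).
apply: Rle_trans (_ : _ <= B / INR N * (3 * rsum N (fun v => rpow (1 + B * (INR v / INR N)) (- g) * rpow (INR v / INR N + / INR N) (- s)))) _.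
  apply Rmult_le_compat_l; [lra|exact h1].
replace (3 * (rpow 2 g * C) * rpow B s) with (3 * (rpow B s * (rpow 2 g * C))) by ring.
rewrite (Rmult_comm _ (3 * _)) !Rmult_assoc (Rmult_comm _ (B / INR N)). mul_l.
rewrite -rsum_scal. set h := B / INR N in hh *.
apply: Rle_trans (_ : _ <= rpow B s * (rpow 2 g * rsum N (fun v => h * (rpow (1 + h * INR (S v)) (- g) * rpow (h * INR (S v)) (- s))))) _; last first.
  mul_l. mul_l. apply H; lra.
rewrite -!rsum_scal; apply rsum_le => v _.
replace (B * (INR v / INR N)) with (h * INR v) by (rewrite /h; field; lra).
have e1 : rpow (INR v / INR N + / INR N) (- s) = rpow B s * rpow (h * INR (S v)) (- s).
  have -> : rpow B s = rpow (/ B) (- s) by rewrite rpow_inv ?Ropp_involutive; lra.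
  rewrite -rpow_mul; last pos.
    f_equal. rewrite S_INR /h; field; lra.
  pos.
rewrite e1.
have h2 := shift_weight h v g hh hg.
set P := rpow B s. set Q := rpow (h * INR (S v)) (- s). 
have hP : 0 <= P by apply rpow_ge0. have hQ : 0 <= Q by apply rpow_ge0.
replace (P * (rpow 2 g * (h * (rpow (1 + h * INR (S v)) (- g) * Q)))) with ((rpow 2 g * rpow (1 + h * INR (S v)) (- g)) * (h * (P * Q))) by ring.
replace (h * (rpow (1 + h * INR v) (- g) * (P * Q))) with (rpow (1 + h * INR v) (- g) * (h * (P * Q))) by ring.
apply Rmult_le_compat_r => //. apply Rmult_le_pos; first lra. by apply Rmult_le_pos.
Qed.

Lemma rpow_double_lt e : 0 < e -> 1 < rpow 2 e.
Proof. move=> he. rewrite -(rpow_base1 e). apply rpow_lt; lra. Qed.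

Lemma rpow2_INR_mul j s : rpow (2 ^ j) s = rpow 2 (INR j * s).
Proof. by rewrite -rpow_rpow rpow_nat //; lra. Qed.

(** Second half of the Schur test, where the sum runs over levels at a fixed distance [a]. The part
    with [a] grows geometrically up to [2^j a = 1] and decays afterwards, as [s < g]; the part with
    [/ N] grows geometrically and stops at [2^j = N]. *)
Lemma level_sum_bound s g : 0 < s -> s < g -> exists C, 0 < C /\ forall (J : nat) N a,
  0 <= a -> 0 < N -> (forall j, (j < J)%nat -> 2 ^ j <= N) ->
  rsum J (fun j => rpow (2 ^ j * (a + / N)) s * rpow (1 + 2 ^ j * a) (- g)) <= C.
Proof.
move=> hs hsg.
set e := Rmin s (g - s).
have he : 0 < e by apply Rmin_glb_lt; lra.
have he1 : e <= s by apply Rmin_l.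
have he2 : e <= g - s by apply Rmin_r.
have k1 := rpow_double_lt e he. have k2 := rpow_double_lt s hs.
set c1 := 4 * (rpow 2 e / (rpow 2 e - 1)). set c2 := rpow 2 s / (rpow 2 s - 1).
have hc1 : 0 < c1 by apply Rmult_lt_0_compat; [lra|apply Rdiv_lt_0_compat; lra].
have hc2 : 0 < c2 by apply Rdiv_lt_0_compat; lra.
exists (rpow 2 s * (c1 + c2)); split; first nra.
move=> J N a ha hN hJ. have hiN : 0 < / N by pos.
apply: Rle_trans (_ : _ <= rsum J (fun j => rpow 2 s * (rpow (2 ^ j * a) s * rpow (1 + 2 ^ j * a) (- g) + rpow (2 ^ j * / N) s))) _.
  apply rsum_le => j _. have h2 : 0 < 2 ^ j by pos.
  have b0 : 0 <= 2 ^ j * a by nra.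
  have g0 := rpow_ge0 (1 + 2 ^ j * a) (- g).
  have g1 : rpow (1 + 2 ^ j * a) (- g) <= 1.
    have := rpow_le_neg 1 (1 + 2 ^ j * a) (- g) ltac:(lra) ltac:(lra). by rewrite rpow_base1.
  have hm : rpow (2 ^ j * (a + / N)) s <= rpow 2 s * (rpow (2 ^ j * a) s + rpow (2 ^ j * / N) s).
    have r1 := rpow_ge0 (2 ^ j * a) s. have r2 := rpow_ge0 (2 ^ j * / N) s.
    case: (Rle_dec (2 ^ j * a) (2 ^ j * / N)) => h.
      apply: Rle_trans (_ : _ <= rpow (2 * (2 ^ j * / N)) s) _; first by apply rpow_le; lra.
      rewrite rpow_mul; try lra. apply Rmult_le_compat_l; [apply rpow_ge0|lra].
    apply: Rle_trans (_ : _ <= rpow (2 * (2 ^ j * a)) s) _; first by apply rpow_le; lra.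
    rewrite rpow_mul; try lra. apply Rmult_le_compat_l; [apply rpow_ge0|lra].
  apply: Rle_trans (Rmult_le_compat_r _ _ _ g0 hm) _.
  rewrite Rmult_assoc; mul_l.
  have := rpow_ge0 (2 ^ j * / N) s. nra.
rewrite rsum_scal rsum_plus. mul_l.
apply Rplus_le_compat.
  case: (Rle_dec a 0) => ha0.
    rewrite (rsum_ext _ _ (fun _ => 0)); first by rewrite rsum_lsum lsum_zero //; lra.
    move=> j _. replace a with 0 by lra. rewrite (rpow_0 (2 ^ j * 0)); lra.
  (* Discrete primitive in [j]: its increment is comparable with [z^e / (1 + z^e)^2], the majorant
     supplied by [weight_comparison]. *)
  pose chi j := - / (1 + rpow (2 ^ j * a) e).
  apply: Rle_trans (_ : _ <= c1 * (chi J - chi O)) _; last first.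
    have hb : forall j, -1 <= chi j <= 0.
      move=> j; rewrite /chi; have hp := rpow_ge0 (2 ^ j * a) e.
      have : / (1 + rpow (2 ^ j * a) e) <= 1 by rewrite -Rinv_1; apply Rinv_le_contravar; lra.
      have : 0 < / (1 + rpow (2 ^ j * a) e) by pos. lra.
    have := hb J; have := hb O; nra.
  rewrite -rsum_telescope -rsum_scal. apply rsum_le => j _.
  have hz : 0 < 2 ^ j * a by pos.
  rewrite /chi. replace (2 ^ S j * a) with (2 * (2 ^ j * a)) by (rewrite /=; ring).
  set z := 2 ^ j * a in hz *. rewrite rpow_mul; try lra.
  have hp := rpow_gt0 z e hz.
  have h1 := weight_comparison g (1 - s) e z ltac:(lra) he ltac:(lra) ltac:(lra) hz.
  have e1 : rpow z s * rpow (1 + z) (- g) = z * (rpow (1 + z) (- g) * rpow z (- (1 - s))).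
    replace s with (1 + (- (1 - s))) at 1 by ring. rewrite rpow_add rpow_1; [ring|lra].
  rewrite e1.
  apply: Rle_trans (Rmult_le_compat_l z _ _ ltac:(lra) h1) _.
  have e2 : rpow z e = z * rpow z (e - 1).
    replace e with (1 + (e - 1)) at 1 by ring. rewrite rpow_add rpow_1; lra.
  replace (z * (4 * (rpow z (e - 1) / (1 + rpow z e) ^ 2))) with (4 * ((z * rpow z (e - 1)) / (1 + rpow z e) ^ 2)) by (field; lra).
  rewrite -e2.
  set A := rpow 2 e in k1 c1 hc1 *. set w := rpow z e in hp *.
  have -> : c1 * (- / (1 + A * w) - - / (1 + w)) = 4 * (A * (w / ((1 + w) * (1 + A * w)))).
    rewrite /c1; field; split; nra.
  mul_l.
  apply Rmult_le_reg_r with ((1 + w) ^ 2 * (1 + A * w)); first by apply Rmult_lt_0_compat; nra.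
  replace (w / (1 + w) ^ 2 * ((1 + w) ^ 2 * (1 + A * w))) with (w * (1 + A * w)) by (field; lra).
  replace (A * (w / ((1 + w) * (1 + A * w))) * ((1 + w) ^ 2 * (1 + A * w))) with (A * w * (1 + w)) by (field; nra).
  nra.
case: J hJ => [|J] hJ; first by rewrite /rsum /=; lra.
(* Primitive of the geometric progression; the last level satisfies [2^J <= N], so the next one is
   at most [2 N], which produces [c2]. *)
pose ch j := / (rpow 2 s - 1) * rpow (2 ^ j * / N) s.
rewrite (rsum_ext _ _ (fun j => ch (S j) - ch j)).
  rewrite (rsum_telescope (S J) ch).
  have p0 : 0 <= ch O by apply Rmult_le_pos; [apply Rlt_le, Rinv_0_lt_compat; lra|apply rpow_ge0].
  have p1 : ch (S J) <= c2.
    rewrite /ch /c2 /Rdiv Rmult_comm. mul_r.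
    apply rpow_le; first lra. have := hJ J ltac:(lia) => h.
    apply Rmult_le_reg_r with N => //. rewrite /= Rmult_assoc Rinv_l; lra.
  lra.
move=> j _. rewrite /ch. replace (2 ^ S j * / N) with (2 * (2 ^ j * / N)) by (rewrite /=; ring).
have h2 : 0 < 2 ^ j * / N by pos.
rewrite (rpow_mul 2); try lra. field. lra.
Qed.

(** * Trigonometric polynomials and the sampling kernels *)

(** A window rather than a degree, since the frequency sets of the sampling kernels are not
    symmetric. The list may repeat frequencies, so products and sums need no regrouping. *)
Definition tpoly1 (lo hi : Z) (P : R -> Cx) : Prop :=
  exists l : list (Z * Cx), (forall q, In q l -> (lo <= fst q <= hi)%Z) /\
    forall t, P t = lsumC l (fun q => Cmul (snd q) (Cexpi (IZR (fst q) * t))).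

Lemma tpoly1_ext lo hi P Q : (forall t, P t = Q t) -> tpoly1 lo hi P -> tpoly1 lo hi Q.
Proof. by move=> h [l [h1 h2]]; exists l; split=> // t; rewrite -h. Qed.

Lemma tpoly1_exp k : tpoly1 k k (fun t => Cexpi (IZR k * t)).
Proof.
exists [(k, C1)]; split; first by move=> q [<-|[]] /=; lia.
move=> t; rewrite lsumC_cons lsumC_nil /fst /snd; ring.
Qed.

Lemma tpoly1_const c : tpoly1 0 0 (fun _ => c).
Proof.
exists [(0%Z, c)]; split; first by move=> q [<-|[]] /=; lia.
move=> t; rewrite lsumC_cons lsumC_nil /fst /snd Rmult_0_l Cexpi_0; ring.
Qed.

Lemma tpoly1_weaken lo hi lo' hi' P : (lo' <= lo)%Z -> (hi <= hi')%Z -> tpoly1 lo hi P -> tpoly1 lo' hi' P.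
Proof. by move=> h1 h2 [l [h3 h4]]; exists l; split=> // q /h3; lia. Qed.

Lemma tpoly1_mul lo hi lo' hi' P Q : tpoly1 lo hi P -> tpoly1 lo' hi' Q ->
  tpoly1 (lo + lo') (hi + hi') (fun t => Cmul (P t) (Q t)).
Proof.
move=> [l [h1 h2]] [l' [h3 h4]].
exists (flat_map (fun q => map (fun q' => ((fst q + fst q')%Z, Cmul (snd q) (snd q'))) l') l); split.
  move=> q /in_flat_map [q1 [/h1 ? /in_map_iff [q2 [<- /h3 ?]]]] /=; lia.
move=> t; rewrite h2 h4 lsumC_flat_map -lsumC_scalr. apply lsumC_ext => q _.
rewrite lsumC_map -lsumC_scal. apply lsumC_ext => q' _ /=.
rewrite plus_IZR Rmult_plus_distr_r Cexpi_add; ring.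
Qed.

Lemma tpoly1_scale lo hi c P : tpoly1 lo hi P -> tpoly1 lo hi (fun t => Cmul c (P t)).
Proof.
move=> h; have := tpoly1_mul _ _ _ _ _ _ (tpoly1_const c) h.
by apply tpoly1_weaken; lia.
Qed.

Lemma tpoly1_add lo hi P Q : tpoly1 lo hi P -> tpoly1 lo hi Q -> tpoly1 lo hi (fun t => Cadd (P t) (Q t)).
Proof.
move=> [l [h1 h2]] [l' [h3 h4]]; exists (l ++ l'); split.
  by move=> q /in_app_iff [/h1|/h3].
by move=> t; rewrite h2 h4 lsumC_app.
Qed.

Lemma tpoly1_csum lo hi n (P : nat -> R -> Cx) : (forall a, (a < n)%nat -> tpoly1 lo hi (P a)) ->
  tpoly1 lo hi (fun t => csum n (fun a => P a t)).
Proof.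
elim: n => [|n IH] h; first by exists []; split.
apply (tpoly1_ext _ _ (fun t => Cadd (csum n (fun a => P a t)) (P n t))).
  by move=> t; rewrite csum_S.
apply tpoly1_add; last by apply h; lia. apply IH => a ha; apply h; lia.
Qed.

Lemma tpoly1_reflect lo hi P y : tpoly1 lo hi P -> tpoly1 (- hi) (- lo) (fun t => P (y - t)).
Proof.
move=> [l [h1 h2]].
exists (map (fun q => ((- fst q)%Z, Cmul (snd q) (Cexpi (IZR (fst q) * y)))) l); split.
  by move=> q /in_map_iff [q' [<- /h1]] /=; lia.
move=> t; rewrite h2 lsumC_map. apply lsumC_ext => q _ /=.
replace (IZR (fst q) * (y - t)) with (IZR (fst q) * y + IZR (- fst q) * t) by (rewrite opp_IZR; ring).
rewrite Cexpi_add; ring.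
Qed.

Definition dir (W : Z) (m : nat) (t : R) : Cx := csum m (fun a => Cexpi (IZR (Z.of_nat a + W) * t)).

Lemma dir_factor W m t : dir W m t = Cmul (Cexpi (IZR W * t)) (csum m (fun a => Cexpi (INR a * t))).
Proof.
rewrite /dir !csum_lsumC -lsumC_scal; apply lsumC_ext => a _.
rewrite -Cexpi_add; f_equal. rewrite plus_IZR -INR_IZR_INZ; ring.
Qed.

Lemma dir_bound W m t : Cmod (dir W m t) <= INR m.
Proof. rewrite dir_factor Cmod_mul Cmod_Cexpi Rmult_1_l; apply dirichlet_bound'. Qed.

Lemma dir_decay W m t : Cmod (dir W m t) * rho t <= 1.
Proof. rewrite dir_factor Cmod_mul Cmod_Cexpi Rmult_1_l; apply dirichlet_bound. Qed.

Lemma tpoly1_dir W m : tpoly1 W (W + Z.of_nat m - 1) (dir W m).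
Proof.
apply tpoly1_csum => a ha. have := tpoly1_exp (Z.of_nat a + W).
apply tpoly1_weaken; lia.
Qed.

(** The frequencies of the window differ from [k] by less than [m <= M], so no aliasing occurs on
    [M] nodes and [orthogonality] retains the single term of frequency [k]. The base point [A] of
    the grid only contributes phases. *)
Lemma dir_reproduces_exp (M m : nat) (W k : Z) A y : (m <= M)%nat -> (W <= k < W + Z.of_nat m)%Z ->
  csum M (fun c => Cmul (Cexpi (IZR k * node A M c)) (Cscale (/ INR M) (dir W m (y - node A M c))))
  = Cexpi (IZR k * y).
Proof.
move=> hm hk. have hM : 0 < INR M by apply lt_0_INR; lia.
have e1 : forall c, Cmul (Cexpi (IZR k * node A M c)) (Cscale (/ INR M) (dir W m (y - node A M c)))
  = lsumC (seq 0 m) (fun a => Cmul (Cmul (Cof (/ INR M)) (Cmul (Cexpi (IZR (Z.of_nat a + W) * y)) (Cexpi (IZR (k - (Z.of_nat a + W)) * A))))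
       (Cexpi (INR c * (2 * PI * IZR (k - (Z.of_nat a + W)) / INR M)))).
  move=> c. rewrite Cscale_mul /dir csum_lsumC -!lsumC_scal. apply lsumC_ext => a _.
  rewrite (_ : Cexpi (IZR k * node A M c) = Cmul (Cmul (Cexpi (IZR (k - (Z.of_nat a + W)) * A)) (Cexpi (INR c * (2 * PI * IZR (k - (Z.of_nat a + W)) / INR M)))) (Cexpi (IZR (Z.of_nat a + W) * node A M c))); last first.
    rewrite -!Cexpi_add; f_equal. rewrite minus_IZR /node; field; lra.
  rewrite (_ : Cexpi (IZR (Z.of_nat a + W) * y) = Cmul (Cexpi (IZR (Z.of_nat a + W) * node A M c)) (Cexpi (IZR (Z.of_nat a + W) * (y - node A M c)))); last first.
    rewrite -!Cexpi_add; f_equal. ring.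
  ring.
rewrite csum_lsumC (lsumC_ext _ _ _ (fun c _ => e1 c)) lsumC_exch.
rewrite (lsumC_ext _ _ (fun a => if (Z.of_nat a + W =? k)%Z then Cexpi (IZR k * y) else C0)).
  have : exists a0, (a0 < m)%nat /\ (Z.of_nat a0 + W)%Z = k.
    exists (Z.to_nat (k - W)); lia.
  move=> [a0 [ha0 hk0]].
  have -> : seq 0 m = seq 0 a0 ++ a0 :: seq (S a0) (m - S a0).
    have {1}-> : m = (a0 + S (m - S a0))%nat by lia. by rewrite seq_app.
  rewrite lsumC_app lsumC_cons hk0 Z.eqb_refl !lsumC_zero; first ring.
  - move=> a /in_seq ha. case: Z.eqb_spec => //; lia.
  - move=> a /in_seq ha. case: Z.eqb_spec => //; lia.
move=> a /in_seq ha. rewrite lsumC_scal -csum_lsumC orthogonality; last lia.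
case: Z.eqb_spec => h; case: Z.eqb_spec => h'; try lia; last ring.
rewrite h h' Rmult_0_l Cexpi_0.
rewrite (_ : Cmul (Cmul (Cof (/ INR M)) (Cmul (Cexpi (IZR k * y)) C1)) (Cof (INR M)) = Cmul (Cof (/ INR M * INR M)) (Cexpi (IZR k * y))); last by rewrite Cof_mul; ring.
rewrite Rinv_l; last lra. rewrite -/C1; ring.
Qed.

Lemma dir_reproduces (M m : nat) (W : Z) A y P : (m <= M)%nat -> tpoly1 W (W + Z.of_nat m - 1) P ->
  csum M (fun c => Cmul (P (node A M c)) (Cscale (/ INR M) (dir W m (y - node A M c)))) = P y.
Proof.
move=> hm [l [h1 h2]].
rewrite csum_lsumC (lsumC_ext _ _ (fun c => lsumC l (fun q => Cmul (snd q)
   (Cmul (Cexpi (IZR (fst q) * node A M c)) (Cscale (/ INR M) (dir W m (y - node A M c))))))).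
  rewrite lsumC_exch h2. apply lsumC_ext => q /h1 hq.
  rewrite lsumC_scal -csum_lsumC dir_reproduces_exp //; lia.
move=> c _; rewrite h2 -lsumC_scalr; apply lsumC_ext => q _; ring.
Qed.

(** * Sampling operators and the decay of their kernels *)

Lemma pow2_INR j : INR (2 ^ j) = 2 ^ j.
Proof. by rewrite pow_INR. Qed.

Lemma Ulist_S j : Ulist (S j) = map (fun a => (Z.of_nat a - Z.of_nat (2 ^ j))%Z) (seq 0 (2 ^ S j)).
Proof. rewrite /Ulist. do 2 f_equal; last by rewrite Nat.sub_succ Nat.sub_0_r. Qed.

(** Restricted to positive levels: there [Ulist] starts at the node [- PI], while the one node of
    level 0 is the origin. *)
Lemma Iop_S L j g x : Iop L (S j) g x =
  csum (2 ^ S j) (fun c => Cmul (g (node (- PI) (2 ^ S j) c)) (Kpi L (S j) (x - node (- PI) (2 ^ S j) c))).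
Proof.
rewrite /Iop Ulist_S /csum_list -/(lsumC _ _) lsumC_map. apply lsumC_ext => a _.
have -> : 2 * PI * IZR (Z.of_nat a - Z.of_nat (2 ^ j)) / 2 ^ S j = node (- PI) (2 ^ S j) a.
  rewrite /node minus_IZR -!INR_IZR_INZ !pow2_INR /=. have := pow2_pos j => h. field; lra.
by [].
Qed.

Lemma Iop1_reproduces j k x : (1 <= j)%nat -> (Z.abs k < 2 ^ (Z.of_nat j - 1))%Z ->
  Iop 1 j (fun t => Cexpi (IZR k * t)) x = Cexpi (IZR k * x).
Proof.
case: j => [|j] hj hk; first lia.
have e2 : (2 ^ (Z.of_nat (S j) - 1))%Z = Z.of_nat (2 ^ j).
  rewrite Nat2Z.inj_pow; f_equal; lia.
rewrite e2 in hk.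
rewrite Iop_S -(dir_reproduces_exp (2 ^ S j) (2 ^ S j) (- Z.of_nat (2 ^ j)) k (- PI)) //; last by rewrite /=; lia.
apply lsumC_ext => c _. rewrite /Kpi [Nat.eqb _ _]/= pow2_INR. do 2 f_equal.
rewrite /dir. apply lsumC_ext => a _. do 2 f_equal.
rewrite plus_IZR opp_IZR -!INR_IZR_INZ pow2_INR Nat.sub_succ Nat.sub_0_r. ring.
Qed.

Lemma Kpi1_bound j t : Cmod (Kpi 1 j t) * (1 + 2 ^ j * rho t) <= 2.
Proof.
have r1 := rho_le1 t.
case: j => [|j].
  rewrite /Kpi [Nat.eqb _ _]/= Cmod_Cof Rabs_R1 /=; lra.
have -> : Kpi 1 (S j) t = Cscale (/ 2 ^ S j) (dir (- Z.of_nat (2 ^ j)) (2 ^ S j) t).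
  change (Kpi 1 (S j) t) with (Cscale (/ 2 ^ S j) (csum (2 ^ S j) (fun a => Cexpi ((INR a - 2 ^ (S j - 1)) * t)))).
  f_equal. apply lsumC_ext => a _. do 2 f_equal.
  rewrite plus_IZR opp_IZR -!INR_IZR_INZ pow2_INR Nat.sub_succ Nat.sub_0_r. ring.
have h2 := pow2_pos (S j). set B := 2 ^ S j in h2 *.
rewrite Cmod_scale; last by apply Rlt_le, Rinv_0_lt_compat.
have := dir_bound (- Z.of_nat (2 ^ j)) (2 ^ S j) t. rewrite pow2_INR -/B.
have := dir_decay (- Z.of_nat (2 ^ j)) (2 ^ S j) t.
set D := Cmod _ => h3 h4.
apply Rmult_le_reg_l with B => //.
replace (B * (/ B * D * (1 + B * rho t))) with (D + B * (D * rho t)) by (field; lra). nra.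
Qed.

Lemma sinc_le1 x : Rabs (sinc x) <= 1.
Proof.
rewrite /sinc; case: Req_dec_T => h; first by rewrite Rabs_R1; lra.
rewrite /Rdiv Rabs_mult Rabs_inv. have hx : 0 < Rabs x by apply Rabs_pos_lt.
apply Rmult_le_reg_r with (Rabs x) => //. rewrite Rmult_assoc Rinv_l; last lra.
rewrite Rmult_1_r Rmult_1_l.
have H : forall u, 0 <= u -> Rabs (sin u) <= u.
  move=> u hu. have := rho_le_abs (2 * u). rewrite /rho. replace (2 * u / 2) with u by field.
  rewrite (Rabs_pos_eq (2 * u)); lra.
case: (Rle_dec 0 x) => hx0; first by rewrite (Rabs_pos_eq x) //; apply H.
rewrite (Rabs_left x); last lra. rewrite -(Rabs_Ropp (sin x)) -sin_neg. apply H; lra.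
Qed.

Lemma sinc_mul x : sinc x * x = sin x.
Proof. rewrite /sinc; case: Req_dec_T => h; [rewrite h sin_0; ring|field => //]. Qed.

Lemma sinc_decay x : Rabs (sinc x) * Rabs x <= 1.
Proof. rewrite -Rabs_mult sinc_mul. apply Rabs_le; have := SIN_bound x; lra. Qed.

(** Only the first two factors are used, which already gives order 2. Their decay yields [1 + 2] and
    [1 + 4], whence [15 = 3 * 5]; the other factors are at most 1. *)
Lemma KL_bound L y : (2 <= L)%nat -> Rabs (KL L y) <= 15 / (1 + Rabs y) ^ 2.
Proof.
move=> hL.
have H : forall n, Rabs (KL (S (S n)) y) <= Rabs (sinc (y / 2)) * Rabs (sinc (y / 4)).
  elim => [|n IH].
    rewrite /KL !rprod_S /rprod /= !Rabs_mult Rabs_R1 !Rmult_1_l !Rmult_1_r.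
    replace (2 * 2) with 4 by ring. lra.
  rewrite /KL rprod_S -/(KL _ _) Rabs_mult.
  have := sinc_le1 (y / 2 ^ S (S (S n))). have := Rabs_pos (KL (S (S n)) y). nra.
case: L hL => [|[|L]] hL; try lia.
apply: Rle_trans (H L) _.
have hy := Rabs_pos y.
have a1 := sinc_le1 (y / 2). have a2 := sinc_decay (y / 2).
have b1 := sinc_le1 (y / 4). have b2 := sinc_decay (y / 4).
rewrite /Rdiv !Rabs_mult !Rabs_inv in a2 b2.
rewrite (Rabs_pos_eq 2) in a2; last lra. rewrite (Rabs_pos_eq 4) in b2; last lra.
rewrite -/(y / 2) -/(y / 4) in a2 b2.
have pa := Rabs_pos (sinc (y / 2)). have pb := Rabs_pos (sinc (y / 4)).
set u := Rabs (sinc (y / 2)) in a1 a2 pa *. set v := Rabs (sinc (y / 4)) in b1 b2 pb *.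
apply Rmult_le_reg_r with ((1 + Rabs y) ^ 2); first nra.
replace (15 / (1 + Rabs y) ^ 2 * (1 + Rabs y) ^ 2) with (3 * 5) by (field; lra).
replace (u * v * (1 + Rabs y) ^ 2) with ((u * (1 + Rabs y)) * (v * (1 + Rabs y))) by ring.
apply Rmult_le_compat; nra.
Qed.

(** [z / (1 + |z|)] is a bounded primitive of [(1 + |z|)^(-2)], so the sum telescopes, uniformly in
    the shift [y]. *)
Lemma inv_square_sum c : 0 < c -> forall y n,
  rsum n (fun a => / (1 + Rabs (y + c * INR a)) ^ 2) <= 2 * (1 + c) / c.
Proof.
move=> hc y n.
pose psi z := z / (1 + Rabs z).
have hb : forall z, -1 <= psi z <= 1.
  move=> z; rewrite /psi.
  have := Rle_abs z. have := Rle_abs (- z). rewrite Rabs_Ropp => h1 h2.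
  split; apply Rmult_le_reg_r with (1 + Rabs z); try lra; unfold Rdiv; rewrite Rmult_assoc Rinv_l; lra.
have hd : forall z, / (1 + Rabs z) ^ 2 <= (1 + c) / c * (psi (z + c) - psi z).
  move=> z.
  apply Rmult_le_reg_l with (c / (1 + c)); first by apply Rdiv_lt_0_compat; lra.
  replace (c / (1 + c) * ((1 + c) / c * (psi (z + c) - psi z))) with (psi (z + c) - psi z) by (field; lra).
  rewrite /psi. case: (Rle_dec 0 z) => h1.
    rewrite !Rabs_pos_eq; try lra.
    replace ((z + c) / (1 + (z + c)) - z / (1 + z)) with (c * / ((1 + (z + c)) * (1 + z))) by (field; lra).
    replace (c / (1 + c) * / (1 + z) ^ 2) with (c * / ((1 + c) * (1 + z) ^ 2)) by (field; lra).
    apply Rmult_le_compat_l; first lra. apply Rinv_le_contravar; nra.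
  rewrite (Rabs_left z); last lra.
  case: (Rle_dec (z + c) 0) => h2.
    rewrite (Rabs_left1 (z + c)) //.
    replace ((z + c) / (1 + - (z + c)) - z / (1 + - z)) with (c * / ((1 - z - c) * (1 - z))) by (field; lra).
    replace (c / (1 + c) * / (1 + - z) ^ 2) with (c * / ((1 + c) * (1 - z) ^ 2)) by (field; lra).
    apply Rmult_le_compat_l; first lra. apply Rinv_le_contravar; nra.
  rewrite Rabs_pos_eq; last lra.
  apply: Rle_trans (_ : _ <= c / (1 + c)) _.
    rewrite -[X in _ <= X]Rmult_1_r. apply Rmult_le_compat_l; first by apply Rdiv_ge0; lra.
    rewrite -Rinv_1; apply Rinv_le_contravar; nra.
  have g1 : (z + c) / (1 + c) <= (z + c) / (1 + (z + c)).
    apply Rmult_le_compat_l; first lra. apply Rinv_le_contravar; lra.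
  have g2 : (- z) / (1 + c) <= (- z) / (1 + - z).
    apply Rmult_le_compat_l; first lra. apply Rinv_le_contravar; lra.
  lra.
apply: Rle_trans (_ : _ <= (1 + c) / c * (psi (y + c * INR n) - psi (y + c * INR 0))) _; last first.
  have h1 := hb (y + c * INR n). have h2 := hb (y + c * INR 0).
  replace (2 * (1 + c) / c) with ((1 + c) / c * 2) by (field; lra).
  apply Rmult_le_compat_l; last lra. apply Rdiv_ge0; lra.
rewrite -(rsum_telescope n (fun a => psi (y + c * INR a))) -rsum_scal. apply rsum_le => a _.
have := hd (y + c * INR a). by replace (y + c * INR a + c) with (y + c * INR (S a)) by (rewrite S_INR; ring).
Qed.

(** [u] is a constant plus the difference of two increasing bounded sequences, [w] and [v]. *)
Lemma cv_of_bounded_variation u B : (forall n, rsum n (fun k => Rabs (u (S k) - u k)) <= B) ->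
  exists l, Un_cv u l.
Proof.
move=> h.
pose v n := rsum n (fun k => Rabs (u (S k) - u k)).
pose w n := rsum n (fun k => Rabs (u (S k) - u k) + (u (S k) - u k)).
have hv : forall n, v n <= B by [].
have cvg : forall s, (forall n, s n <= s (S n)) -> (forall n, s n <= 2 * B) -> exists l, Un_cv s l.
  move=> s hg hs. have hub : has_ub s by exists (2 * B) => x [n ->].
  have [l hl] := growing_cv s hg hub. by exists l.
have v0 : forall n, 0 <= v n by move=> n; apply rsum_ge0 => i _; apply Rabs_pos.
have [lv hlv] : exists l, Un_cv v l.
  apply cvg => n; last by have := hv n; have := v0 n; lra.
  rewrite /v rsum_S; have := Rabs_pos (u (S n) - u n); lra.
have [lw hlw] : exists l, Un_cv w l.
  apply cvg => n.
    rewrite /w rsum_S; have := Rle_abs (- (u (S n) - u n)). rewrite Rabs_Ropp; lra.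
  apply: Rle_trans (_ : _ <= rsum n (fun k => 2 * Rabs (u (S k) - u k))) _.
    apply rsum_le => i _; have := Rle_abs (u (S i) - u i); lra.
  rewrite rsum_scal; have := hv n; rewrite /v; lra.
exists (u O + (lw - lv)).
apply (Un_cv_ext (fun n => (fun _ => u O) n + (w n - v n))).
  move=> n. have e : w n - v n = u n - u O; last lra.
  rewrite -(rsum_telescope n u) /w rsum_plus /v; lra.
apply CV_plus; first by apply Un_cv_const. by apply CV_minus.
Qed.

Definition Ksum (L j N : nat) (x : R) : R :=
  rsum (2 * N + 1) (fun a => KL L (2 ^ j * (x + 2 * PI * (INR a - INR N)))).

Lemma Ksum_S L j N x : Ksum L j (S N) x = Ksum L j N x +
  (KL L (2 ^ j * (x - 2 * PI * INR (S N))) + KL L (2 ^ j * (x + 2 * PI * INR (S N)))).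
Proof.
rewrite /Ksum. replace (2 * S N + 1)%nat with (S (S (2 * N + 1))) by lia.
rewrite rsum_S_l rsum_S.
have -> : rsum (2 * N + 1) (fun i => KL L (2 ^ j * (x + 2 * PI * (INR (S i) - INR (S N)))))
  = rsum (2 * N + 1) (fun a => KL L (2 ^ j * (x + 2 * PI * (INR a - INR N)))).
  apply rsum_ext => i _. f_equal. rewrite !S_INR; ring.
replace (x + 2 * PI * (INR 0 - INR (S N))) with (x - 2 * PI * INR (S N)) by (rewrite [INR 0]/=; ring).
replace (x + 2 * PI * (INR (S (2 * N + 1)) - INR (S N))) with (x + 2 * PI * INR (S N)); first ring.
rewrite !S_INR plus_INR mult_INR /=; ring.
Qed.

Lemma KL_scaled_bound L B x : (2 <= L)%nat -> 1 <= B -> Rabs (KL L (B * x)) <= 15 / (1 + Rabs x) ^ 2.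
Proof.
move=> hL hB. apply: Rle_trans (KL_bound L _ hL) _.
have hx := Rabs_pos x. rewrite Rabs_mult (Rabs_pos_eq B); last lra.
apply Rmult_le_compat_l; first lra. apply Rinv_le_contravar; first nra.
apply pow_incr; nra.
Qed.

Lemma Ksum_cv L j x : (2 <= L)%nat -> exists l, Un_cv (fun N => Ksum L j N x) l.
Proof.
move=> hL. have hpi := PI_RGT_0. have h2 := pow2_ge1 j.
have hsum := inv_square_sum (2 * PI) ltac:(lra).
apply (cv_of_bounded_variation _ (30 * (2 * (1 + 2 * PI) / (2 * PI)))) => n.
apply: Rle_trans (_ : _ <= rsum n (fun a => 15 * / (1 + Rabs ((2 * PI - x) + 2 * PI * INR a)) ^ 2 + 15 * / (1 + Rabs ((x + 2 * PI) + 2 * PI * INR a)) ^ 2)) _.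
  apply rsum_le => a _. rewrite Ksum_S.
  replace (Ksum L j a x + _ - Ksum L j a x) with (KL L (2 ^ j * (x - 2 * PI * INR (S a))) + KL L (2 ^ j * (x + 2 * PI * INR (S a)))) by ring.
  apply: Rle_trans (Rabs_triang _ _) _.
  have b1 := KL_scaled_bound L (2 ^ j) (x - 2 * PI * INR (S a)) hL h2.
  have b2 := KL_scaled_bound L (2 ^ j) (x + 2 * PI * INR (S a)) hL h2.
  rewrite -(Rabs_Ropp (x - _)) in b1.
  replace (- (x - 2 * PI * INR (S a))) with (2 * PI - x + 2 * PI * INR a) in b1 by (rewrite S_INR; ring).
  replace (x + 2 * PI * INR (S a)) with (x + 2 * PI + 2 * PI * INR a) in b2 |- * by (rewrite S_INR; ring).
  unfold Rdiv in b1, b2. lra.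
rewrite rsum_plus !rsum_scal.
have := hsum (2 * PI - x) n. have := hsum (x + 2 * PI) n. lra.
Qed.

Lemma Ksum_bound L : (2 <= L)%nat -> exists C, 0 < C /\ forall j N x, Rabs (Ksum L j N x) * (1 + 2 ^ j * rho x) <= C.
Proof.
move=> hL. have hpi := PI_RGT_0.
set S0 := 2 * (1 + 2 * PI) / (2 * PI).
have hS0 : 0 < S0 by apply Rdiv_lt_0_compat; lra.
exists (120 * S0); split; first lra. move=> j N x.
have h2 := pow2_ge1 j. set B := 2 ^ j in h2 *. have r0 := rho_ge0 x.
rewrite Rmult_comm.
apply: Rle_trans (_ : _ <= (1 + B * rho x) * rsum (2 * N + 1) (fun a => Rabs (KL L (B * (x + 2 * PI * (INR a - INR N)))))) _.
  apply Rmult_le_compat_l; first nra.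
  have H : forall n f, Rabs (rsum n f) <= rsum n (fun a => Rabs (f a)).
    move=> n f; elim: n => [|n IH]; first by rewrite /rsum /= Rabs_R0; lra.
    rewrite !rsum_S. apply: Rle_trans (Rabs_triang _ _) _; lra.
  apply H.
rewrite -rsum_scal.
apply: Rle_trans (_ : _ <= rsum (2 * N + 1) (fun a => 120 * / (1 + Rabs ((x - 2 * PI * INR N) + 2 * PI * INR a)) ^ 2)) _; last first.
  rewrite rsum_scal. apply Rmult_le_compat_l; first lra. apply inv_square_sum; lra.
apply rsum_le => a _.
replace (x + 2 * PI * (INR a - INR N)) with (x - 2 * PI * INR N + 2 * PI * INR a) by ring.
set z := x - 2 * PI * INR N + 2 * PI * INR a.
have hz : rho x <= Rabs z.
  have := rho_le_abs z. have -> : rho z = rho x.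
    rewrite -(rho_2PI x (Z.of_nat a - Z.of_nat N)). f_equal. rewrite minus_IZR -!INR_IZR_INZ /z; ring.
  have := Rabs_pos z; lra.
have hb := KL_bound L (B * z) hL. rewrite Rabs_mult (Rabs_pos_eq B) in hb; last lra.
have hx := rho_le1 x.
set w := Rabs z in hz hb *. set K := Rabs _ in hb *.
have hK : 0 <= K by apply Rabs_pos.
(* Decay in [B w], where [w] is the distance to the translate, is shared out: one order becomes
   decay in [B rho x], common to all translates, and the rest keeps [(1 + w)^(-2)] summable over
   them. With the 15 of [KL_bound] this explains [120 = 15 * 8]. *)
have key : (1 + B * rho x) * (1 + w) ^ 2 <= 8 * (1 + B * w) ^ 2.
  case: (Rle_dec 1 w) => h.
    have h6 : B * w ^ 2 <= (B * w) ^ 2 by replace ((B * w) ^ 2) with (B * (B * w ^ 2)) by ring; nra.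
    have h7 : 0 <= B * w by nra.
    nra.
  have h3 : (1 + w) ^ 2 <= 4 by nra.
  have h4 : 1 + B * rho x <= 1 + B * w by nra.
  have h5 : 1 + B * w <= (1 + B * w) ^ 2 by nra.
  have h6 : (1 + B * rho x) * (1 + w) ^ 2 <= (1 + B * w) * 4 by apply Rmult_le_compat; nra.
  nra.
have hBw : 0 < (1 + B * w) ^ 2 by apply pow_lt; nra.
have hw2 : 0 < (1 + w) ^ 2 by apply pow_lt; nra.
apply Rmult_le_reg_r with ((1 + w) ^ 2) => //.
replace (120 * / (1 + w) ^ 2 * (1 + w) ^ 2) with 120 by (field; lra).
apply: Rle_trans (_ : _ <= (8 * (1 + B * w) ^ 2) * K) _.
  replace ((1 + B * rho x) * K * (1 + w) ^ 2) with ((1 + B * rho x) * (1 + w) ^ 2 * K) by ring.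
  by apply Rmult_le_compat_r.
apply: Rle_trans (Rmult_le_compat_l (8 * (1 + B * w) ^ 2) _ _ ltac:(lra) hb) _.
apply Req_le. field. have : 0 <= B * w by nra. lra.
Qed.

Lemma Kpi_lim L j x : (2 <= L)%nat -> exists l, Un_cv (fun N => Ksum L j N x) l /\ Kpi L j x = Cof l.
Proof.
move=> hL. have [l hl] := Ksum_cv L j x hL. exists l; split=> //.
rewrite /Kpi. have -> : Nat.eqb L 1 = false by apply Nat.eqb_neq; lia.
by rewrite (lim_cv _ _ hl).
Qed.

(** One order of decay for every [L]: the case [L = 1] gives it directly, and for [L >= 2] it is
    inherited from the uniform bound on the symmetric partial sums. *)
Lemma Kpi_bound L : (1 <= L)%nat -> exists C, 0 < C /\ forall j x, Cmod (Kpi L j x) * (1 + 2 ^ j * rho x) <= C.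
Proof.
move=> hL. case: (Nat.eq_dec L 1) => [->|hL1].
  exists 2; split; [lra|exact Kpi1_bound].
have hL2 : (2 <= L)%nat by lia.
have [C [hC H]] := Ksum_bound L hL2. exists C; split=> // j x.
have [l [hl ->]] := Kpi_lim L j x hL2.
rewrite Cmod_Cof. have h0 : 0 < 1 + 2 ^ j * rho x by have := pow2_pos j; have := rho_ge0 x; nra.
apply Rmult_le_reg_r with (/ (1 + 2 ^ j * rho x)); first by apply Rinv_0_lt_compat.
rewrite Rmult_assoc Rinv_r; last lra. rewrite Rmult_1_r.
have hb : forall N, Rabs (Ksum L j N x) <= C * / (1 + 2 ^ j * rho x).
  move=> N. apply Rmult_le_reg_r with (1 + 2 ^ j * rho x) => //.
  rewrite Rmult_assoc Rinv_l; last lra. rewrite Rmult_1_r; apply H.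
apply Rabs_le; split.
  apply (Un_cv_ge _ _ _ hl); exists O => n _. have := hb n; have := Rle_abs (- Ksum L j n x). rewrite Rabs_Ropp; lra.
apply (Un_cv_le _ _ _ hl); exists O => n _. have := hb n; have := Rle_abs (Ksum L j n x); lra.
Qed.

(** * Reproduction of band-limited functions *)

(* Periodic analogue of [sinc]; centring the frequencies at [-1/2] keeps them integral. *)
Definition dsinc (h : nat) (s : R) : Cx := Cscale (/ INR (2 * h)) (dir (- Z.of_nat h) (2 * h) s).

(** The geometric sum, with [Cexpi s - 1 = 2 i sin (s / 2) Cexpi (s / 2)]; the phase compensates for
    the centring at [-1/2]. Multiplying by [2 i] instead of dividing by [sin (s / 2)] leaves [s = 0]
    as the only separate case. *)
Lemma dsinc_sinc h s : (0 < h)%nat ->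
  Cmul (dsinc h s) (Cmul (Cof (sinc (s / 2))) (Cexpi (s / 2))) = Cof (sinc (INR h * s)).
Proof.
move=> hh. have hR : 0 < INR h by pos.
case: (Req_dec s 0) => hs.
  rewrite hs Rmult_0_r /Rdiv Rmult_0_l Cexpi_0 /sinc. case: Req_dec_T => // _.
  rewrite /dsinc dir_factor Rmult_0_r Cexpi_0 Cscale_mul csum_lsumC (lsumC_ext _ _ (fun _ => C1)).
    rewrite lsumC_const length_seq.
    transitivity (Cmul (Cof (/ INR (2 * h) * INR (2 * h))) C1); first by rewrite Cof_mul -/C1; ring.
    rewrite Rinv_l; first by rewrite -/C1; ring.
    rewrite mult_INR [INR 2]/=; lra.
  move=> a _; by rewrite Rmult_0_r Cexpi_0.
have e1 : Cmul (Cmul (0, 2) (Cmul (Cof (sin (s / 2))) (Cexpi (s / 2)))) (dir (- Z.of_nat h) (2 * h) s) = Cmul (0, 2) (Cof (sin (INR h * s))).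
  rewrite dir_factor.
  have -> : Cmul (0, 2) (Cmul (Cof (sin (s / 2))) (Cexpi (s / 2))) = Csub (Cexpi s) C1.
    replace s with (2 * (s / 2)) at 3 by field. set u := s / 2.
    apply Cx_eq; rewrite /Cexpi /= ?cos_2a_sin ?sin_2a; ring.
  replace (Cmul (Csub (Cexpi s) C1) (Cmul (Cexpi (IZR (- Z.of_nat h) * s)) (csum (2 * h) (fun a => Cexpi (INR a * s)))))
   with (Cmul (Cexpi (IZR (- Z.of_nat h) * s)) (Cmul (Csub (Cexpi s) C1) (csum (2 * h) (fun a => Cexpi (INR a * s))))) by ring.
  rewrite geom_expi opp_IZR -INR_IZR_INZ mult_INR [INR 2]/=.
  replace (- INR h * s) with (- (INR h * s)) by ring. replace ((1 + 1) * INR h * s) with (2 * (INR h * s)) by ring.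
  set v := INR h * s. have := sin2_cos2 v; rewrite /Rsqr => hsc.
  apply Cx_eq; rewrite /Cexpi /= cos_neg sin_neg cos_2a_sin sin_2a; try nra.
  transitivity (sin v * 2 * (sin v * sin v + cos v * cos v)); [ring|rewrite hsc; ring].
have e2 : Cof (sinc (s / 2)) = Cmul (Cof (/ (s / 2))) (Cof (sin (s / 2))).
  rewrite -Cof_mul -sinc_mul; f_equal; field; lra.
have e3 : Cof (sinc (INR h * s)) = Cmul (Cof (/ (INR h * s))) (Cof (sin (INR h * s))).
  rewrite -Cof_mul -sinc_mul; f_equal; field; lra.
have e4 : Cmul (Cmul (Cof (sin (s / 2))) (Cexpi (s / 2))) (dir (- Z.of_nat h) (2 * h) s) = Cof (sin (INR h * s)).
  have hI : Cmul (0, - / 2) (0, 2) = C1 by apply Cx_eq; rewrite /=; field.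
  transitivity (Cmul (Cmul (0, - / 2) (0, 2)) (Cmul (Cmul (Cof (sin (s / 2))) (Cexpi (s / 2))) (dir (- Z.of_nat h) (2 * h) s))).
    rewrite hI; ring.
  transitivity (Cmul (0, - / 2) (Cmul (Cmul (0, 2) (Cmul (Cof (sin (s / 2))) (Cexpi (s / 2)))) (dir (- Z.of_nat h) (2 * h) s))); first ring.
  rewrite e1.
  transitivity (Cmul (Cmul (0, - / 2) (0, 2)) (Cof (sin (INR h * s)))); first ring.
  rewrite hI; ring.
rewrite e2 e3 /dsinc Cscale_mul -e4.
transitivity (Cmul (Cmul (Cof (/ INR (2 * h))) (Cof (/ (s / 2)))) (Cmul (Cmul (Cof (sin (s / 2))) (Cexpi (s / 2))) (dir (- Z.of_nat h) (2 * h) s))); first ring.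
f_equal. rewrite -Cof_mul. f_equal. rewrite mult_INR [INR 2]/=. field; lra.
Qed.

Lemma dsinc_le1 h s : (0 < h)%nat -> Cmod (dsinc h s) <= 1.
Proof.
move=> hh. have hR : 0 < INR (2 * h) by apply lt_0_INR; lia.
rewrite /dsinc Cmod_scale; last pos.
apply Rmult_le_reg_l with (INR (2 * h)) => //. rewrite -Rmult_assoc Rinv_r; last lra.
have := dir_bound (- Z.of_nat h) (2 * h) s; lra.
Qed.

Lemma dsinc_decay h s : (0 < h)%nat -> Cmod (dsinc h s) * (INR h * rho s) <= 1.
Proof.
move=> hh. have hR : 0 < INR h by pos.
have hR2 : INR (2 * h) = 2 * INR h by rewrite mult_INR [INR 2]/=; lra.
rewrite /dsinc Cmod_scale hR2; last pos.
have := dir_decay (- Z.of_nat h) (2 * h) s. set D := Cmod _ => h1.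
replace (/ (2 * INR h) * D * (INR h * rho s)) with (D * rho s / 2) by (field; lra).
lra.
Qed.

Lemma cprod_S_l n g : cprod (S n) g = Cmul (g O) (cprod n (fun i => g (S i))).
Proof. elim: n => [|n IH]; first by rewrite /cprod /=; ring. rewrite cprod_S IH cprod_S; ring. Qed.

Lemma tpoly1_dsinc h y : tpoly1 (1 - Z.of_nat h) (Z.of_nat h) (fun t => dsinc h (y - t)).
Proof.
apply (tpoly1_ext _ _ (fun t => Cmul (Cof (/ INR (2 * h))) (dir (- Z.of_nat h) (2 * h) (y - t)))).
  by move=> t; rewrite /dsinc Cscale_mul.
apply tpoly1_scale.
have := tpoly1_reflect _ _ _ y (tpoly1_dir (- Z.of_nat h) (2 * h)).
apply tpoly1_weaken; lia.
Qed.

(* The window of frequencies of [e^{ikt}] times all factors but the widest one stays inside the window of that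
   factor, which therefore reproduces the product. *)
Lemma dsinc_product_reproduces (j L m : nat) (k : Z) y : (0 < m)%nat -> (1 <= L)%nat -> (L <= j)%nat ->
  (Z.abs k < Z.of_nat (2 ^ (j - L) * m))%Z ->
  csum (2 ^ j * m) (fun c => let t := node (- PI) (2 ^ j * m) c in
    Cmul (Cexpi (IZR k * t)) (cprod L (fun l => dsinc (2 ^ (j - 1 - l) * m) (y - t)))) = Cexpi (IZR k * y).
Proof.
move=> hm hL hLj hk.
case: L hL hLj hk => [|L] hL hLj hk; first lia.
pose h l := (2 ^ (j - 1 - l) * m)%nat.
have hh : forall l, (l < j)%nat -> (0 < h l)%nat.
  move=> l hl; rewrite /h. have : (2 ^ (j - 1 - l) <> 0)%nat by apply Nat.pow_nonzero. nia.
(* As [h n = 2 h (S n)], the widths [h 1, ..., h n] add up to [h 0 - h n]; a frequency [k] below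
   [h n] therefore still fits into the window of the widest factor. *)
have hdeg : forall n, (n < j)%nat -> tpoly1 (Z.of_nat n - (Z.of_nat (h O) - Z.of_nat (h n))) (Z.of_nat (h O) - Z.of_nat (h n))
   (fun t => cprod n (fun l => dsinc (h (S l)) (y - t))).
  elim => [|n IH] hn.
    have := tpoly1_const C1. apply tpoly1_weaken; lia.
  apply (tpoly1_ext _ _ (fun t => Cmul (cprod n (fun l => dsinc (h (S l)) (y - t))) (dsinc (h (S n)) (y - t)))).
    by move=> t; rewrite cprod_S.
  have := tpoly1_mul _ _ _ _ _ _ (IH ltac:(lia)) (tpoly1_dsinc (h (S n)) y).
  have e : h n = (2 * h (S n))%nat.
    rewrite /h. replace (j - 1 - n)%nat with (S (j - 1 - S n)) by lia. rewrite Nat.pow_succ_r'. lia.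
  apply tpoly1_weaken; lia.
pose P t := Cmul (Cexpi (IZR k * t)) (cprod L (fun l => dsinc (h (S l)) (y - t))).
have eM : (2 ^ j * m = 2 * h O)%nat.
  rewrite /h Nat.sub_0_r. have {1}-> : j = S (j - 1) by lia. rewrite Nat.pow_succ_r'. lia.
have hP : tpoly1 (- Z.of_nat (h O)) (- Z.of_nat (h O) + Z.of_nat (2 * h O) - 1) P.
  have := tpoly1_mul _ _ _ _ _ _ (tpoly1_exp k) (hdeg L ltac:(lia)).
  have e : (2 ^ (j - S L) * m = h L)%nat by rewrite /h; do 2 f_equal; lia.
  rewrite e in hk. apply tpoly1_weaken; lia.
have := dir_reproduces (2 * h O) (2 * h O) (- Z.of_nat (h O)) (- PI) y P (Nat.le_refl _) hP.
have -> : P y = Cexpi (IZR k * y).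
  rewrite /P cprod_one; first ring. move=> l hl.
  have hp : (0 < h (S l))%nat by apply hh; lia.
  have := dsinc_sinc (h (S l)) 0 hp. rewrite Rminus_diag Rmult_0_r /Rdiv Rmult_0_l Cexpi_0 /sinc.
  case: Req_dec_T => // _ e. etransitivity; last exact e. change (Cof 1) with C1; ring.
move=> <-. rewrite eM. apply lsumC_ext => c _.
cbv zeta. rewrite cprod_S_l /P /dsinc /h; ring.
Qed.

Lemma one_sub_sinc u : Rabs (1 - sinc u) <= Rabs u.
Proof.
have H : forall u, 0 < u -> Rabs (1 - sinc u) <= u.
  move=> {}u hu. have hs := sinc_le1 u. have hs1 := Rle_abs (sinc u). have hs2 := Rle_abs (- sinc u). rewrite Rabs_Ropp in hs2.
  rewrite Rabs_pos_eq; last lra.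
  case: (Rle_dec u 2) => h; last lra.
  have hpi : 2 <= PI by have := PI2_3_2; lra.
  have [h1 _] := sin_bound u O ltac:(lra) ltac:(lra).
  rewrite /sin_approx /sin_term /= in h1. rewrite -sinc_mul in h1.
  have h3 : 1 - u * u / 6 <= sinc u.
    apply Rmult_le_reg_r with u => //. nra.
  nra.
case: (Rtotal_order u 0) => [h|[->|h]].
- have <- : sinc (- u) = sinc u.
    rewrite /sinc; case: Req_dec_T => h1; case: Req_dec_T => h2; try lra. rewrite sin_neg; field; lra.
  rewrite -(Rabs_Ropp u) (Rabs_pos_eq (- u)); last lra. apply H; lra.
- rewrite /sinc; case: Req_dec_T => // _. rewrite Rminus_diag; lra.
- rewrite (Rabs_pos_eq u); last lra. by apply H.
Qed.

Lemma sinc_phase_near_one s : Cmod (Csub C1 (Cmul (Cof (sinc (s / 2))) (Cexpi (s / 2)))) <= Rabs s.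
Proof.
have -> : Csub C1 (Cmul (Cof (sinc (s / 2))) (Cexpi (s / 2)))
  = Csub (Cmul (Cof (1 - sinc (s / 2))) (Cexpi (s / 2))) (Csub (Cexpi (s / 2)) C1).
  apply Cx_eq; rewrite /=; ring.
apply: Rle_trans (Cmod_sub_tri _ _) _.
rewrite Cmod_mul Cmod_Cexpi Cmod_Cof Cexpi_sub1.
have h1 := one_sub_sinc (s / 2). have h2 := rho_le_abs (s / 2).
have e : Rabs (s / 2) = Rabs s / 2 by rewrite /Rdiv Rabs_mult (Rabs_pos_eq (/ 2)); lra.
lra.
Qed.

Lemma one_sub_pow_le w n : Cmod w <= 1 -> Cmod (Csub C1 (cprod n (fun _ => w))) <= INR n * Cmod (Csub C1 w).
Proof.
move=> hw. elim: n => [|n IH].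
  rewrite /cprod /= Rmult_0_l. replace (Csub C1 C1) with C0 by ring. rewrite Cmod_C0; lra.
rewrite cprod_S S_INR.
have -> : Csub C1 (Cmul (cprod n (fun _ => w)) w) = Cadd (Csub C1 w) (Cmul w (Csub C1 (cprod n (fun _ => w)))) by ring.
apply: Rle_trans (Cmod_tri _ _) _. rewrite Cmod_mul.
have := Cmod_ge0 (Csub C1 (cprod n (fun _ => w))). have := Cmod_ge0 w. nra.
Qed.

(** A longer range than in [sin_ge_third]: points [y] with [|y| <= 2/5] lie up to [PI + 2/5 <= 22/5]
    away from the nodes, and half of this is [11/5]. *)
Lemma sin_ge_sixth u : 0 <= u <= 11 / 5 -> u / 6 <= sin u.
Proof.
move=> hu.
have hpi : 11 / 5 <= PI by have := PI2_3_2; lra.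
have [h _] := sin_bound u O ltac:(lra) ltac:(lra).
rewrite /sin_approx /sin_term /= in h.
have h1 : 0 <= (11 / 5 - u) * (11 / 5 + u) by pos.
have : 0 <= u * (5 - u * u) by pos.
lra.
Qed.

Lemma rho_ge_abs s : Rabs s <= 22 / 5 -> Rabs s / 12 <= rho s.
Proof.
move=> hs.
have -> : rho s = rho (Rabs s) by rewrite /Rabs; case: Rcase_abs => _; rewrite ?rho_opp.
have h0 := Rabs_pos s.
rewrite /rho (Rabs_pos_eq (sin _)); first by have := sin_ge_sixth (Rabs s / 2) ltac:(lra); lra.
have := sin_ge_sixth (Rabs s / 2) ltac:(lra); lra.
Qed.

Lemma cprod_const_mul n w g : cprod n (fun i => Cmul (g i) w) = Cmul (cprod n g) (cprod n (fun _ => w)).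
Proof. exact: (cprod_mul n g (fun _ => w)). Qed.

(** Dividing [2^j m s] by [2^(l+1)] gives an integer multiple of [s], so [dsinc_sinc] applies factor
    by factor; all factors leave the same phase [w], which is close to 1 for small [s]. *)
Lemma KL_dsinc j L m s : (0 < m)%nat -> (L <= j)%nat ->
  Cof (KL L (INR (2 ^ j * m) * s)) =
  Cmul (cprod L (fun l => dsinc (2 ^ (j - 1 - l) * m) s))
       (cprod L (fun _ => Cmul (Cof (sinc (s / 2))) (Cexpi (s / 2)))).
Proof.
move=> hm hLj. rewrite -cprod_const_mul /KL -cprod_Cof. apply cprod_ext => l hl.
have hp : (0 < 2 ^ (j - 1 - l) * m)%nat.
  have : (2 ^ (j - 1 - l) <> 0)%nat by apply Nat.pow_nonzero. nia.
rewrite dsinc_sinc //. do 2 f_equal.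
rewrite !mult_INR !pow2_INR.
have -> : 2 ^ j = 2 ^ (j - 1 - l) * 2 ^ S l by rewrite -pow_add; f_equal; lia.
have := pow2_pos (S l) => h. field; lra.
Qed.

(* Replacing the discrete kernels by [KL] costs a factor [1 - w^L] with [|1 - w| <= |s|]; AM-GM turns the
   harmonic-type sum of the resulting terms into one summable square and a small constant. *)
Lemma KL_discrete_error L : (2 <= L)%nat -> exists C, 0 < C /\ forall (j m : nat) (k : Z) y,
  (0 < m)%nat -> (L <= j)%nat -> (Z.abs k < Z.of_nat (2 ^ (j - L) * m))%Z -> Rabs y <= 2 / 5 ->
  forall eps, 0 < eps ->
  Cmod (Csub (Cexpi (IZR k * y))
    (csum (2 ^ j * m) (fun c => let t := node (- PI) (2 ^ j * m) c in
      Cmul (Cexpi (IZR k * t)) (Cof (KL L (INR (2 ^ j * m) * (y - t)))))))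
  <= C * (eps + / (eps * INR (2 ^ j * m))).
Proof.
move=> hL. have hpi := PI_RGT_0.
set S0 := 2 * (1 + 2 * PI) / (2 * PI).
have hS0 : 0 < S0 by apply Rdiv_lt_0_compat; lra.
exists (INR L * 10000 * (1 + S0)); split.
  have : 0 < INR L by apply lt_0_INR; lia. nra.
move=> j m k y hm hLj hk hy eps he.
set M := (2 ^ j * m)%nat.
have h2j : (2 ^ j <> 0)%nat by apply Nat.pow_nonzero.
have hM : 0 < INR M by apply lt_0_INR; rewrite /M; nia.
rewrite -(dsinc_product_reproduces j L m k y hm ltac:(lia) hLj hk) -/M.
rewrite /csum -!/(lsumC _ _) -lsumC_sub.
apply: Rle_trans (Cmod_lsumC _ _) _.
have hnode : forall c, (c < M)%nat -> Rabs (y - node (- PI) M c) <= 22 / 5.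
  move=> c hc. have hc' : INR c < INR M by apply lt_INR.
  have h0 : 0 <= INR c / INR M <= 1.
    split; first by apply Rdiv_ge0 => //; apply pos_INR.
    apply Rmult_le_reg_r with (INR M) => //. field_simplify; lra.
  have := PI_4. rewrite /node => hp4. apply Rabs_le.
  have := Rle_abs y. have := Rle_abs (- y). rewrite Rabs_Ropp.
  replace (2 * PI * INR c / INR M) with (2 * PI * (INR c / INR M)) by (field; lra).
  nra.
apply: Rle_trans (_ : _ <= rsum M (fun c => INR L * 10000 * (eps / INR M + / (eps * INR M) * / (1 + Rabs (INR M * (y - node (- PI) M c))) ^ 2))) _.
  apply rsum_le => c hc. cbv zeta.
  have {}hnode := hnode c hc.
  set t := node (- PI) M c in hnode *. set s := y - t in hnode *.
  have hrho := rho_ge_abs s hnode.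
  rewrite (KL_dsinc j L m s hm hLj) .
  set D := cprod L (fun l => _). set w := Cmul (Cof (sinc (s / 2))) (Cexpi (s / 2)).
  have -> : Csub (Cmul (Cexpi (IZR k * t)) D) (Cmul (Cexpi (IZR k * t)) (Cmul D (cprod L (fun _ => w))))
    = Cmul (Cexpi (IZR k * t)) (Cmul D (Csub C1 (cprod L (fun _ => w)))) by ring.
  rewrite !Cmod_mul Cmod_Cexpi Rmult_1_l.
  have hw : Cmod w <= 1 by rewrite /w Cmod_mul Cmod_Cexpi Cmod_Cof Rmult_1_r; apply sinc_le1.
  have h1 := one_sub_pow_le w L hw. have h2 := sinc_phase_near_one s. rewrite -/w in h2.
  have hLp : 0 < INR L by apply lt_0_INR; lia.
  have h3 : Cmod (Csub C1 (cprod L (fun _ => w))) <= INR L * Rabs s.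
    apply: Rle_trans h1 _; apply Rmult_le_compat_l; lra.
  set T := INR M * s. have hT : Rabs T = INR M * Rabs s by rewrite /T Rabs_mult (Rabs_pos_eq (INR M)); lra.
  have hT0 := Rabs_pos T.
  (* Two factors give order 2, as in [KL_bound]. [rho_ge_abs] costs 12 in each, and the resulting
     [1 + 24] and [1 + 48] are both rounded up to 100. *)
  have hD : Cmod D * (1 + Rabs T) ^ 2 <= 10000.
    pose h l := (2 ^ (j - 1 - l) * m)%nat.
    have hh : forall l, (0 < h l)%nat.
      move=> l; rewrite /h. have : (2 ^ (j - 1 - l) <> 0)%nat by apply Nat.pow_nonzero. nia.
    have hDb : Cmod D <= Cmod (dsinc (h 0%nat) s) * Cmod (dsinc (h 1%nat) s).
      have H : forall n, Cmod (cprod (S (S n)) (fun l => dsinc (h l) s)) <= Cmod (dsinc (h 0%nat) s) * Cmod (dsinc (h 1%nat) s).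
        elim => [|n IH].
          rewrite !cprod_S !Cmod_mul /cprod /= Cmod_Cof Rabs_R1; lra.
        rewrite cprod_S Cmod_mul.
        have := dsinc_le1 (h (S (S n))) s (hh _). have := Cmod_ge0 (cprod (S (S n)) (fun l => dsinc (h l) s)).
        have := Cmod_ge0 (dsinc (h (S (S n))) s). nra.
      have := H (L - 2)%nat. have -> : S (S (L - 2)) = L by lia. by [].
    have eh0 : INR (h 0%nat) = INR M / 2.
      rewrite /h /M !mult_INR !pow2_INR Nat.sub_0_r. have {2}-> : j = S (j - 1) by lia. rewrite /=. field.
    have eh1 : INR (h 1%nat) = INR M / 4.
      rewrite /h /M !mult_INR !pow2_INR. have {2}-> : j = S (S (j - 1 - 1)) by lia. rewrite /=. field.
    have b1 := dsinc_le1 (h 0%nat) s (hh _). have b2 := dsinc_decay (h 0%nat) s (hh _).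
    have b3 := dsinc_le1 (h 1%nat) s (hh _). have b4 := dsinc_decay (h 1%nat) s (hh _).
    rewrite eh0 in b2. rewrite eh1 in b4.
    have p1 := Cmod_ge0 (dsinc (h 0%nat) s). have p2 := Cmod_ge0 (dsinc (h 1%nat) s).
    set u := Cmod (dsinc (h 0%nat) s) in b1 b2 p1 hDb. set v := Cmod (dsinc (h 1%nat) s) in b3 b4 p2 hDb.
    have hr : Rabs T <= 12 * (INR M * rho s).
      rewrite hT. have : INR M * (Rabs s / 12) <= INR M * rho s by apply Rmult_le_compat_l; lra. lra.
    have q1 : u * (1 + Rabs T) <= 100.
      have : u * Rabs T <= u * (12 * (INR M * rho s)) by apply Rmult_le_compat_l. 
      lra.
    have q2 : v * (1 + Rabs T) <= 100.
      have : v * Rabs T <= v * (12 * (INR M * rho s)) by apply Rmult_le_compat_l. 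
      lra.
    apply: Rle_trans (_ : _ <= (u * (1 + Rabs T)) * (v * (1 + Rabs T))) _.
      replace (u * (1 + Rabs T) * (v * (1 + Rabs T))) with (u * v * (1 + Rabs T) ^ 2) by ring.
      apply Rmult_le_compat_r => //. nra.
    replace 10000 with (100 * 100) by ring. apply Rmult_le_compat; nra.
  have hq : 0 < (1 + Rabs T) ^ 2 by nra.
  have hD' : Cmod D <= 10000 * / (1 + Rabs T) ^ 2.
    apply Rmult_le_reg_r with ((1 + Rabs T) ^ 2) => //. rewrite Rmult_assoc Rinv_l; lra.
  apply: Rle_trans (_ : _ <= (10000 * / (1 + Rabs T) ^ 2) * (INR L * Rabs s)) _.
    by apply Rmult_le_compat => //; apply Cmod_ge0.
  replace (10000 * / (1 + Rabs T) ^ 2 * (INR L * Rabs s)) with (INR L * 10000 * (Rabs s * / (1 + Rabs T) ^ 2)) by ring.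
  apply Rmult_le_compat_l; first nra.
  have -> : Rabs s = Rabs T / INR M by rewrite hT; field; lra.
  set a := Rabs T in hT0 hq *.
  apply Rmult_le_reg_r with (eps * INR M * (1 + a) ^ 2); first pos.
  replace (a / INR M * / (1 + a) ^ 2 * (eps * INR M * (1 + a) ^ 2)) with (a * eps) by (field; lra).
  replace ((eps / INR M + / (eps * INR M) * / (1 + a) ^ 2) * (eps * INR M * (1 + a) ^ 2)) with ((eps * (1 + a)) ^ 2 + 1) by (field; lra).
  have : 0 <= (eps * (1 + a) - 1) ^ 2 by pos. have : 0 <= eps * a by nra. lra.
have e0 : rsum M (fun _ : nat => eps / INR M) = eps.
  rewrite rsum_lsum lsum_const length_seq; field; lra.
rewrite rsum_scal rsum_plus e0 rsum_scal.
have -> : rsum M (fun c => / (1 + Rabs (INR M * (y - node (- PI) M c))) ^ 2)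
  = rsum M (fun a => / (1 + Rabs ((- (INR M * (y + PI))) + 2 * PI * INR a)) ^ 2).
  apply rsum_ext => c _. do 3 f_equal. rewrite -Rabs_Ropp. f_equal. rewrite /node; field; lra.
have hS := inv_square_sum (2 * PI) ltac:(lra) (- (INR M * (y + PI))) M. rewrite -/S0 in hS.
have hi : 0 < / (eps * INR M) by pos.
rewrite !Rmult_assoc. mul_l. mul_l.
nra.
Qed.

Lemma csum_split B m F : csum (B * m) F = csum m (fun b => csum B (fun a => F (b * B + a)%nat)).
Proof.
elim: m => [|m IH]; first by rewrite Nat.mul_0_r.
rewrite csum_S -IH. replace (B * S m)%nat with (B * m + B)%nat by lia.
rewrite !csum_lsumC seq_app lsumC_app. f_equal.
have -> : seq (0 + B * m) B = map (fun a => (m * B + a)%nat) (seq 0 B).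
  replace (0 + B * m)%nat with (m * B)%nat by lia.
  have H : forall n s, seq s n = map (fun a => (s + a)%nat) (seq 0 n).
    elim => [//|n IHn] s. rewrite !seq_S map_app -IHn /=. do 3 f_equal; lia.
  apply H.
by rewrite lsumC_map.
Qed.

Lemma Kpi_real_cv L j x : (2 <= L)%nat ->
  Un_cv (fun N => Ksum L j N x) (fst (Kpi L j x)) /\ Kpi L j x = Cof (fst (Kpi L j x)).
Proof. by move=> hL; have [l [h ->]] := Kpi_lim L j x hL. Qed.

Definition Cx_cv (u : nat -> Cx) (z : Cx) : Prop :=
  Un_cv (fun n => fst (u n)) (fst z) /\ Un_cv (fun n => snd (u n)) (snd z).

Lemma Cx_cv_unique u z w : Cx_cv u z -> Cx_cv u w -> z = w.
Proof. move=> [h1 h2] [h3 h4]; apply Cx_eq; [exact: UL_sequence h1 h3|exact: UL_sequence h2 h4]. Qed.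

Lemma Cx_cv_Cmod u z : (forall eps, 0 < eps -> exists N, forall n, (N <= n)%nat -> Cmod (Csub (u n) z) < eps) ->
  Cx_cv u z.
Proof.
move=> h; split=> eps he; have [N HN] := h eps he; exists N => n hn; have h1 := HN n ltac:(lia).
  exact: Rle_lt_trans (fst_le_Cmod (Csub (u n) z)) h1.
exact: Rle_lt_trans (snd_le_Cmod (Csub (u n) z)) h1.
Qed.

Lemma Cx_cv_Cmod_inv u z eps : Cx_cv u z -> 0 < eps -> exists N, forall n, (N <= n)%nat -> Cmod (Csub (u n) z) < eps.
Proof.
move=> [h1 h2] he. have [N1 H1] := h1 (eps / 2) ltac:(lra). have [N2 H2] := h2 (eps / 2) ltac:(lra).
exists (N1 + N2)%nat => n hn. have := H1 n ltac:(lia). have := H2 n ltac:(lia). rewrite /Rdist => a b.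
have := Cmod_le_sum (Csub (u n) z). rewrite {2 3}/Csub [fst (_, _)]/= [snd (_, _)]/=. lra.
Qed.

Lemma Cx_cv_lsumC {A} (l : list A) u v : (forall a, In a l -> Cx_cv (u a) (v a)) ->
  Cx_cv (fun n => lsumC l (fun a => u a n)) (lsumC l v).
Proof.
move=> h; split.
  apply (Un_cv_ext (fun n => lsum l (fun a => fst (u a n)))); first by move=> n; rewrite lsumC_pair.
  rewrite lsumC_pair. apply (Un_cv_lsum l (fun a n => fst (u a n)) (fun a => fst (v a))) => a /h; by case.
apply (Un_cv_ext (fun n => lsum l (fun a => snd (u a n)))); first by move=> n; rewrite lsumC_pair.
rewrite lsumC_pair. apply (Un_cv_lsum l (fun a n => snd (u a n)) (fun a => snd (v a))) => a /h; by case.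
Qed.

Lemma Cx_cv_mul_l c u z : Cx_cv u z -> Cx_cv (fun n => Cmul c (u n)) (Cmul c z).
Proof.
move=> h; apply Cx_cv_Cmod => eps he. have h0 := Cmod_ge0 c.
have [N HN] := Cx_cv_Cmod_inv u z (eps / (1 + Cmod c)) h ltac:(apply Rdiv_lt_0_compat; lra).
exists N => n /HN h1. have -> : Csub (Cmul c (u n)) (Cmul c z) = Cmul c (Csub (u n) z) by ring.
rewrite Cmod_mul. have h2 := Cmod_ge0 (Csub (u n) z).
apply: Rle_lt_trans (_ : _ <= (1 + Cmod c) * Cmod (Csub (u n) z)) _; first nra.
apply Rmult_lt_reg_l with (/ (1 + Cmod c)); first by apply Rinv_0_lt_compat; lra.
rewrite -Rmult_assoc Rinv_l; last lra. unfold Rdiv in h1; lra.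
Qed.

(** Truncating the periodisation to [2 N + 1] periods and shrinking by that factor gives a sum of
    [KL] over one grid of [2^j (2 N + 1)] nodes, at the frequency [k (2 N + 1)]. [KL_discrete_error]
    then shows that the truncations tend to the exponential, and limits are unique. *)
Lemma Iop_reproduces_sinc L j k x : (2 <= L)%nat -> (L <= j)%nat -> (Z.abs k < Z.of_nat (2 ^ (j - L)))%Z ->
  Iop L j (fun t => Cexpi (IZR k * t)) x = Cexpi (IZR k * x).
Proof.
move=> hL hLj hk.
have hj : j = S (j - 1) by lia.
rewrite {1}hj Iop_S -hj.
set B := (2 ^ j)%nat.
have hB1 : 1 <= INR B by rewrite /B pow2_INR; apply pow2_ge1.
apply (Cx_cv_unique (fun N => csum B (fun c => Cmul (Cexpi (IZR k * node (- PI) B c)) (Cof (Ksum L j N (x - node (- PI) B c)))))).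
  apply Cx_cv_lsumC => c _. apply Cx_cv_mul_l.
  have [h1 ->] := Kpi_real_cv L j (x - node (- PI) B c) hL.
  split => //=. exact (Un_cv_const 0).
have [C [hC H]] := KL_discrete_error L hL.
have flat : forall N, csum B (fun c => Cmul (Cexpi (IZR k * node (- PI) B c)) (Cof (Ksum L j N (x - node (- PI) B c))))
  = csum (B * (2 * N + 1)) (fun c => let t := node (- PI) (B * (2 * N + 1)) c in
      Cmul (Cexpi (IZR (k * Z.of_nat (2 * N + 1)) * t)) (Cof (KL L (INR (B * (2 * N + 1)) * (x / INR (2 * N + 1) - t))))).
  move=> N. rewrite csum_split !csum_lsumC lsumC_exch. apply lsumC_ext => a _.
  (* Moving a node by one period to the right moves the argument of the kernel to the left, so the
     periods are counted in reverse. *)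
  rewrite /Ksum rsum_rev rsum_lsum -lsumC_Cof -lsumC_scal. apply lsumC_ext => b hb.
  have hb' : (b < 2 * N + 1)%nat by move: hb => /in_seq; lia.
  have hm : INR (2 * N + 1) = 2 * INR N + 1 by rewrite plus_INR mult_INR /=; ring.
  have hN := pos_INR N.
  cbv zeta. congr (Cmul _ (Cof (KL L _))).

    have -> : IZR (k * Z.of_nat (2 * N + 1)) * node (- PI) (B * (2 * N + 1)) (b * B + a)
      = IZR k * node (- PI) B a + 2 * PI * IZR (k * (Z.of_nat b - Z.of_nat N)).
      rewrite /node !mult_IZR minus_IZR -!INR_IZR_INZ (plus_INR (b * B)) (mult_INR B) (mult_INR b) hm. field; lra.
    by rewrite Cexpi_2PI.
  rewrite minus_INR; last lia. rewrite minus_INR; last lia.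
  rewrite /node (plus_INR (b * B)) (mult_INR B) (mult_INR b) hm -pow2_INR -/B [INR 1]/=. field; lra.
apply Cx_cv_Cmod => eps he.
(* The error is at most [C (e + / (e M))], where [M] grows with the number of periods. [N2] makes
   the second term at most [e], and [N1] brings the shrunken point into [[-2/5, 2/5]]. *)
set e := eps / (3 * C). have hepos : 0 < e by apply Rdiv_lt_0_compat; lra.
have [N1 hN1] : exists N, Rabs x * 3 < INR N by apply INR_unbounded.
have [N2 hN2] : exists N, / (e * e) < INR N by apply INR_unbounded.
exists (N1 + N2)%nat => n hn.
rewrite flat Cmod_sub_sym.
have hm : INR (2 * n + 1) = 2 * INR n + 1 by rewrite plus_INR mult_INR /=; ring.
have hn1 : INR N1 <= INR n by apply le_INR; lia.
have hn2 : INR N2 <= INR n by apply le_INR; lia.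
have hx := Rabs_pos x.
have -> : Cexpi (IZR k * x) = Cexpi (IZR (k * Z.of_nat (2 * n + 1)) * (x / INR (2 * n + 1))).
  f_equal. rewrite mult_IZR -INR_IZR_INZ hm. field; lra.
have hy : Rabs (x / INR (2 * n + 1)) <= 2 / 5.
  rewrite /Rdiv Rabs_mult (Rabs_pos_eq (/ _)); last by apply Rlt_le, Rinv_0_lt_compat; lra.
  apply Rmult_le_reg_r with (INR (2 * n + 1)); first lra. rewrite Rmult_assoc Rinv_l; lra.
have hk' : (Z.abs (k * Z.of_nat (2 * n + 1)) < Z.of_nat (2 ^ (j - L) * (2 * n + 1)))%Z.
  rewrite Z.abs_mul (Z.abs_eq (Z.of_nat (2 * n + 1))); last lia. rewrite Nat2Z.inj_mul. apply Z.mul_lt_mono_pos_r; lia.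
have := H j (2 * n + 1)%nat (k * Z.of_nat (2 * n + 1))%Z (x / INR (2 * n + 1)) ltac:(lia) hLj hk' hy e hepos.
rewrite -/B => hh. apply: Rle_lt_trans hh _.
have hM : / (e * INR (B * (2 * n + 1))) <= e.
  have hm2 : / (e * e) <= INR (B * (2 * n + 1)) by rewrite mult_INR hm; nra.
  have hi : 0 < / (e * e) by apply Rinv_0_lt_compat; nra.
  apply Rmult_le_reg_l with (INR (B * (2 * n + 1))); first lra.
  replace (INR (B * (2 * n + 1)) * / (e * INR (B * (2 * n + 1)))) with (/ (e * e) * e) by (field; lra).
  apply Rmult_le_compat_r; lra.
apply: Rle_lt_trans (_ : _ <= C * (2 * e)) _; first by apply Rmult_le_compat_l; lra.
rewrite /e. replace (C * (2 * (eps / (3 * C)))) with (2 / 3 * eps) by (field; lra). lra.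
Qed.

Lemma Iop_reproduces L j k x : (1 <= L)%nat -> (L <= j)%nat -> (Z.abs k < Z.of_nat (2 ^ (j - L)))%Z ->
  Iop L j (fun t => Cexpi (IZR k * t)) x = Cexpi (IZR k * x).
Proof.
move=> hL hLj hk. case: (Nat.eq_dec L 1) => [e|hne]; last by apply Iop_reproduces_sinc => //; lia.
rewrite e in hk hLj *. apply Iop1_reproduces => //.
move: hk; rewrite Nat2Z.inj_pow. by replace (Z.of_nat j - 1)%Z with (Z.of_nat (j - 1)) by lia.
Qed.

(** * Tensor products and Plancherel-Polya inequalities *)

(** At a fixed [x] the operator is a finite combination of point evaluations; the pairs record node
    and coefficient. This form makes linearity, tensor products and pointwise limits immediate. *)
Definition inodes (L j : nat) (x : R) : list (R * Cx) :=
  map (fun u => (2 * PI * IZR u / 2 ^ j, Kpi L j (x - 2 * PI * IZR u / 2 ^ j))) (Ulist j).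

Definition enodes (L j : nat) (x : R) : list (R * Cx) :=
  match j with
  | O => inodes L O x
  | S j' => inodes L (S j') x ++ map (fun e => (fst e, Copp (snd e))) (inodes L j' x)
  end.

Lemma Iop_inodes L j g x : Iop L j g x = lsumC (inodes L j x) (fun e => Cmul (g (fst e)) (snd e)).
Proof. by rewrite /inodes lsumC_map. Qed.

Lemma etaop_enodes L j g x : etaop L j g x = lsumC (enodes L j x) (fun e => Cmul (g (fst e)) (snd e)).
Proof.
case: j => [|j]; first exact: Iop_inodes.
rewrite /enodes lsumC_app lsumC_map [LHS]/etaop !Iop_inodes Csub_add. f_equal.
rewrite (_ : Copp _ = Cmul (Copp C1) (lsumC (inodes L j x) (fun e => Cmul (g (fst e)) (snd e)))); last ring.
rewrite -lsumC_scal; apply lsumC_ext => e _ /=; ring.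
Qed.

Lemma qop_expand d L j f x :
  qop d L j f x = lsumC (mlist (0, C0) d (fun i => enodes L (j i) (x i)))
    (fun e => Cmul (cprod d (fun i => snd (e i))) (f (fun i => if (i <? d)%nat then fst (e i) else x i))).
Proof.
elim: d x => [|d IH] x.
  rewrite /= lsumC_cons lsumC_nil /cprod /=.
  rewrite (_ : (fun i : nat => x i) = x) //. ring.
rewrite lsumC_mlist_S [LHS]/= /applyc etaop_enodes. apply lsumC_ext => -[t c] _.
rewrite IH -lsumC_scalr.
rewrite (mlist_ext (0, C0) d _ (fun i => enodes L (j i) (x i))); last first.
  move=> i hi; rewrite /updR. have -> // : Nat.eqb i d = false. by apply Nat.eqb_neq; lia.
apply lsumC_ext => e _.
rewrite cprod_S upd_eq.
rewrite (cprod_ext d (fun i => snd (upd e d (t, c) i)) (fun i => snd (e i))); last first.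
  move=> i hi; rewrite upd_neq //; lia.
rewrite (_ : (fun i => if (i <? d)%nat then fst (e i) else updR x d t i)
           = (fun i => if (i <? S d)%nat then fst (upd e d (t, c) i) else x i)); last first.
  apply functional_extensionality => i. rewrite /updR /upd.
  case: (Nat.eqb_spec i d) => h; case: (Nat.ltb_spec i d) => h1; case: (Nat.ltb_spec i (S d)) => h2 //; lia.
rewrite /=. ring.
Qed.

Lemma qop_lsumC {A} (l : list A) d L j (F : A -> (nat -> R) -> Cx) x :
  qop d L j (fun y => lsumC l (fun a => F a y)) x = lsumC l (fun a => qop d L j (F a) x).
Proof.
rewrite (lsumC_ext l _ _ (fun a _ => qop_expand d L j (F a) x)) lsumC_exch qop_expand.
apply lsumC_ext => e _. by rewrite lsumC_scal.
Qed.

Lemma qop_scal d L j c f x : qop d L j (fun y => Cmul c (f y)) x = Cmul c (qop d L j f x).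
Proof. rewrite !qop_expand -lsumC_scal; apply lsumC_ext => e _; ring. Qed.

Lemma qop_cprod d L j (P : nat -> R -> Cx) x :
  qop d L j (fun y => cprod d (fun i => P i (y i))) x = cprod d (fun i => etaop L (j i) (P i) (x i)).
Proof.
rewrite qop_expand (cprod_ext d _ (fun i => lsumC (enodes L (j i) (x i)) (fun e => Cmul (P i (fst e)) (snd e)))); last first.
  move=> i _; exact: etaop_enodes.
rewrite -(lsumC_mlist_prod (0, C0)). apply lsumC_ext => e _.
rewrite -cprod_mul. apply cprod_ext => i hi. have -> : (i <? d)%nat = true by apply Nat.ltb_lt. ring.
Qed.

(** Both levels of the difference reproduce such a frequency; the coarser level [j - 1] sets the
    limit. *)
Lemma etaop_low L j k x : (1 <= L)%nat -> (L < j)%nat -> (Z.abs k < Z.of_nat (2 ^ (j - 1 - L)))%Z ->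
  etaop L j (fun t => Cexpi (IZR k * t)) x = C0.
Proof.
move=> hL hj hk. case: j hj hk => [|j] hj hk; first lia.
rewrite /etaop !Iop_reproduces //; try lia; first ring.
- move: hk. by replace (S j - 1 - L)%nat with (j - L)%nat by lia.
- apply: Z.lt_le_trans hk _. apply inj_le, Nat.pow_le_mono_r; lia.
Qed.

Lemma etaop_sum L n g x : csum (S n) (fun j => etaop L j g x) = Iop L n g x.
Proof.
elim: n => [|n IH]; first by rewrite csum_S /csum /=; ring.
rewrite csum_S IH /=; ring.
Qed.

Definition tpoly (d : nat) (D : nat -> nat) (g : (nat -> R) -> Cx) : Prop :=
  exists l : list ((nat -> Z) * Cx),
    (forall q, In q l -> forall i, (i < d)%nat -> (Z.abs (fst q i) <= Z.of_nat (D i))%Z) /\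
    forall y, g y = lsumC l (fun q => Cmul (snd q) (cprod d (fun i => Cexpi (IZR (fst q i) * y i)))).

Lemma qop_low d L j D g x i : (1 <= L)%nat -> tpoly d D g -> (i < d)%nat -> (L < j i)%nat ->
  (D i < 2 ^ (j i - 1 - L))%nat -> qop d L j g x = C0.
Proof.
move=> hL [l [h1 h2]] hi hj hD.
rewrite (functional_extensionality g _ h2) qop_lsumC. apply lsumC_zero => q hq.
rewrite qop_scal (qop_cprod d L j (fun i t => Cexpi (IZR (fst q i) * t))) (cprod_zero d _ i hi); first ring.
apply etaop_low => //. have := h1 q hq i hi. lia.
Qed.

(** On an exponential the sum over a cube factorises and telescopes in each variable to [Iop L n],
    which reproduces. *)
Lemma qop_sum_reproduces d L D g x n : (1 <= L)%nat -> tpoly d D g -> (L <= n)%nat ->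
  (forall i, (i < d)%nat -> (D i < 2 ^ (n - L))%nat) ->
  lsumC (mlist O d (fun _ => seq 0 (S n))) (fun j => qop d L j g x) = g x.
Proof.
move=> hL [l [h1 h2]] hn hD.
rewrite (functional_extensionality g _ h2).
rewrite (lsumC_ext _ _ (fun j => lsumC l (fun q => Cmul (snd q) (cprod d (fun i => etaop L (j i) (fun t => Cexpi (IZR (fst q i) * t)) (x i)))))).
  rewrite lsumC_exch. apply lsumC_ext => q hq. rewrite lsumC_scal. f_equal.
  rewrite (lsumC_mlist_prod O d (fun _ => seq 0 (S n)) (fun i a => etaop L a (fun t => Cexpi (IZR (fst q i) * t)) (x i))).
  apply cprod_ext => i hi. rewrite -csum_lsumC etaop_sum Iop_reproduces //.
  have := h1 q hq i hi. have := hD i hi. lia.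
move=> j _. rewrite qop_lsumC. apply lsumC_ext => q _.
by rewrite qop_scal (qop_cprod d L j (fun i t => Cexpi (IZR (fst q i) * t))).
Qed.

Lemma decay_double B r q : 0 < B -> 0 <= r -> 0 <= q ->
  rpow (1 + B / 2 * r) (- q) <= rpow 2 q * rpow (1 + B * r) (- q).
Proof.
move=> hB hr hq.
have -> : rpow 2 q = rpow (/ 2) (- q) by rewrite rpow_inv ?Ropp_involutive; lra.
rewrite -rpow_mul; [|lra|nra]. apply rpow_le_neg; nra.
Qed.

Lemma inodes_sum L q : 1 < q -> exists C, 0 < C /\ forall j x y,
  lsum (inodes L j x) (fun e => rpow (1 + 2 ^ j * rho (y - fst e)) (- q)) <= C.
Proof.
move=> hq. have [C [hC H]] := grid_avg_decay q hq.
exists (C + 1); split; first lra. move=> j x y. rewrite /inodes lsum_map.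
case: j => [|j].
  rewrite /Ulist lsum_cons lsum_nil Rplus_0_r.
  have h : rpow (1 + 2 ^ 0 * rho (y - fst (2 * PI * IZR 0 / 2 ^ 0, Kpi L 0 (x - 2 * PI * IZR 0 / 2 ^ 0)))) (- q) <= rpow 1 (- q).
    apply rpow_le_neg; first lra. have := rho_ge0 (y - fst (2 * PI * IZR 0 / 2 ^ 0, Kpi L 0 (x - 2 * PI * IZR 0 / 2 ^ 0))).
    rewrite [2 ^ 0]/=; lra.
  rewrite rpow_base1 in h. lra.
have hB : 0 < INR (2 ^ S j) by rewrite pow2_INR; apply pow2_pos.
have := H (2 ^ S j)%nat (2 ^ S j) y (- PI) ltac:(by apply INR_lt; rewrite [INR 0]/=) ltac:(rewrite pow2_INR; have := pow2_pos (S j); lra).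
rewrite Ulist_S lsum_map => h.
apply: Rle_trans (_ : _ <= C) _; last lra.
apply: Rle_trans h. apply Req_le, lsum_ext => a _. cbn [fst].
rewrite pow2_INR. have h2 := pow2_pos j. have h3 := pow2_pos (S j).
replace (2 ^ S j / 2 ^ S j) with 1 by (field; lra). rewrite Rmult_1_l. do 5 f_equal.
rewrite /node minus_IZR -!INR_IZR_INZ !pow2_INR.
change (2 ^ S j) with (2 * 2 ^ j). field; lra.
Qed.

Lemma enodes_sum L q : 1 < q -> exists C, 0 < C /\ forall j x y,
  lsum (enodes L j x) (fun e => rpow (1 + 2 ^ j * rho (y - fst e)) (- q)) <= C.
Proof.
move=> hq. have [C [hC H]] := inodes_sum L q hq.
exists (C + C); split; first lra. move=> j x y.
case: j => [|j]; first by have := H O x y; rewrite /enodes; lra.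
rewrite /enodes lsum_app lsum_map. apply Rplus_le_compat; first exact: H.
apply: Rle_trans (H j x y). apply lsum_le => e _.
have r0 := rho_ge0 (y - fst e). have h2 := pow2_pos j.
rewrite [fst (_, _)]/=. apply rpow_le_neg; first lra. rewrite /=; nra.
Qed.

(** The level [j - 1] half is measured at scale [2^j] as well, which costs the factor 2 of
    [decay_double]. *)
Lemma enodes_weight L : (1 <= L)%nat -> exists C, 0 < C /\ forall j x e, In e (enodes L j x) ->
  Cmod (snd e) <= C * rpow (1 + 2 ^ j * rho (x - fst e)) (- 1).
Proof.
move=> hL. have [C [hC H]] := Kpi_bound L hL.
have H1 : forall j x e, In e (inodes L j x) -> Cmod (snd e) <= C * rpow (1 + 2 ^ j * rho (x - fst e)) (- 1).
  move=> j x e /in_map_iff [u [<- _]] /=.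
  set t := 2 * PI * IZR u / 2 ^ j. have h := H j (x - t).
  have hp : 0 < 1 + 2 ^ j * rho (x - t) by have := pow2_pos j; have := rho_ge0 (x - t); nra.
  rewrite rpow_opp // rpow_1; last lra.
  apply Rmult_le_reg_r with (1 + 2 ^ j * rho (x - t)) => //. rewrite Rmult_assoc Rinv_l; lra.
exists (2 * C); split; first lra. move=> j x e.
have w0 := rpow_ge0 (1 + 2 ^ j * rho (x - fst e)) (-1).
case: j w0 => [|j] w0; first by move=> /H1; nra.
move=> /in_app_iff [/H1|/in_map_iff [e' [<- /H1]]]; first nra.
rewrite [snd (_, _)]/= [fst (_, _)]/= Cmod_opp.
move=> h1. have h2 := pow2_pos (S j). have h3 := decay_double (2 ^ S j) (rho (x - fst e')) 1 h2 (rho_ge0 _) ltac:(lra).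
rewrite (rpow_1 2) in h3; last lra. replace (2 ^ S j / 2) with (2 ^ j) in h3 by (rewrite /=; field).
replace (- (1)) with (-1) in h3 by lra.
have := Rmult_le_compat_l C _ _ ltac:(lra) h3. lra.
Qed.

(** * Plancherel-Polya inequalities on grids *)

Definition pt (N : nat) (u : nat -> nat) : nat -> R := fun i => node (- PI) N (u i).
Definition ubox (d N : nat) : list (nat -> nat) := mlist O d (fun _ => seq 0 N).

(* A Dirichlet kernel times the [n]-th power of a normalized one: the power equals 1 at 0, so that the product
   still reproduces low frequencies, now with decay of order [n]. *)
Lemma kernel_exists c0 n : exists C (Phi : nat -> R -> Cx), 0 < C /\ forall l,
  (forall t, Cmod (Phi l t) <= C * (2 ^ l * rpow (1 + 2 ^ l * rho t) (- INR n))) /\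
  forall N, (2 * ((c0 + n) * 2 ^ l) + 1 <= N)%nat -> forall k, (Z.abs k <= Z.of_nat (c0 * 2 ^ l))%Z -> forall z,
    csum N (fun u => Cmul (Cexpi (IZR k * node (- PI) N u)) (Cscale (/ INR N) (Phi l (z - node (- PI) N u)))) = Cexpi (IZR k * z).
Proof.
(* Half-width of the window: [c0 2^l] for the function and [n 2^l] for the power [Psi]. *)
pose A l := ((c0 + n) * 2 ^ l)%nat.
pose m1 l t := Cscale (/ INR (2 ^ l)) (dir 0 (2 ^ l) t).
pose Psi l t := cprod n (fun _ => m1 l t).
exists ((2 * INR (c0 + n) + 1) * 2 ^ n), (fun l t => Cmul (Psi l t) (dir (- Z.of_nat (A l)) (2 * A l + 1) t)).
split.
  have := pos_INR (c0 + n). have := pow2_pos n. nra.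
move=> l. have hb : 0 < INR (2 ^ l) by rewrite pow2_INR; apply pow2_pos.
have hb1 := pow2_ge1 l.
split.
  move=> t. have r0 := rho_ge0 t. have w1 : 1 <= 1 + 2 ^ l * rho t by nra.
  rewrite Cmod_mul.
  have h1 : Cmod (dir (- Z.of_nat (A l)) (2 * A l + 1) t) <= (2 * INR (c0 + n) + 1) * 2 ^ l.
    apply: Rle_trans (dir_bound _ _ _) _. rewrite plus_INR mult_INR /A mult_INR pow2_INR /=. nra.
  have h2 : Cmod (Psi l t) <= 2 ^ n * rpow (1 + 2 ^ l * rho t) (- INR n).
    rewrite /Psi Cmod_cprod. 
    have hm : Cmod (m1 l t) <= 2 * rpow (1 + 2 ^ l * rho t) (- 1).
      rewrite rpow_opp ?rpow_1; try lra.
      apply Rmult_le_reg_r with (1 + 2 ^ l * rho t); first lra. rewrite Rmult_assoc Rinv_l; last lra.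
      rewrite /m1 Cmod_scale; last pos.
      have := dir_bound 0 (2 ^ l) t. have := dir_decay 0 (2 ^ l) t. rewrite pow2_INR. set D := Cmod _ => d1 d2.
      apply Rmult_le_reg_l with (2 ^ l); first lra.
      replace (2 ^ l * (/ 2 ^ l * D * (1 + 2 ^ l * rho t))) with (D + 2 ^ l * (D * rho t)) by (field; lra). nra.
    apply: Rle_trans (_ : _ <= rprod n (fun _ => 2 * rpow (1 + 2 ^ l * rho t) (- 1))) _.
      apply rprod_le => i _; split; [apply Cmod_ge0|exact hm].
    rewrite rprod_const Rpow_mult_distr. apply Req_le. f_equal.
    rewrite -rpow_nat; last pos. rewrite rpow_rpow; f_equal; ring.
  replace ((2 * INR (c0 + n) + 1) * 2 ^ n * (2 ^ l * rpow (1 + 2 ^ l * rho t) (- INR n)))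
    with ((2 ^ n * rpow (1 + 2 ^ l * rho t) (- INR n)) * ((2 * INR (c0 + n) + 1) * 2 ^ l)) by ring.
  apply Rmult_le_compat => //; apply Cmod_ge0.
move=> N hN k hk z.
have hPsi : forall n', tpoly1 0 (Z.of_nat (n' * 2 ^ l)) (fun t => cprod n' (fun _ => m1 l t)).
  elim => [|n' IH]; first exact: tpoly1_const.
  apply (tpoly1_ext _ _ (fun t => Cmul (cprod n' (fun _ => m1 l t)) (m1 l t))); first by move=> t; rewrite cprod_S.
  have hm : tpoly1 0 (Z.of_nat (2 ^ l)) (m1 l).
    apply (tpoly1_ext _ _ (fun t => Cmul (Cof (/ INR (2 ^ l))) (dir 0 (2 ^ l) t))); first by move=> t; rewrite /m1 Cscale_mul.
    apply tpoly1_scale. have := tpoly1_dir 0 (2 ^ l). apply tpoly1_weaken; lia.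
  have := tpoly1_mul _ _ _ _ _ _ IH hm. apply tpoly1_weaken; lia.
pose P t := Cmul (Cexpi (IZR k * t)) (Psi l (z - t)).
have hP : tpoly1 (- Z.of_nat (A l)) (- Z.of_nat (A l) + Z.of_nat (2 * A l + 1) - 1) P.
  have := tpoly1_mul _ _ _ _ _ _ (tpoly1_exp k) (tpoly1_reflect _ _ _ z (hPsi n)).
  apply tpoly1_weaken; rewrite /A; lia.
have := dir_reproduces N (2 * A l + 1) _ (- PI) z P ltac:(rewrite /A; lia) hP.
have hP0 : Psi l 0 = C1.
  apply cprod_one => i _. rewrite /m1 dir_factor Rmult_0_r Cexpi_0 Cscale_mul csum_lsumC (lsumC_ext _ _ (fun _ => C1)).
    rewrite lsumC_const length_seq.
    transitivity (Cmul (Cof (/ INR (2 ^ l) * INR (2 ^ l))) C1); first by rewrite Cof_mul; ring.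
    rewrite Rinv_l; [rewrite -/C1; ring|lra].
  move=> a _; by rewrite Rmult_0_r Cexpi_0.
rewrite /P Rminus_diag hP0 => h.
transitivity (Cmul (Cexpi (IZR k * z)) C1); last ring. rewrite -h.
apply lsumC_ext => u _. rewrite !Cscale_mul; ring.
Qed.

Lemma kernel_reproduces d c0 n C Phi l N g z :
  (0 < C /\ forall l,
  (forall t, Cmod (Phi l t) <= C * (2 ^ l * rpow (1 + 2 ^ l * rho t) (- INR n))) /\
  forall N, (2 * ((c0 + n) * 2 ^ l) + 1 <= N)%nat -> forall k, (Z.abs k <= Z.of_nat (c0 * 2 ^ l))%Z -> forall z,
    csum N (fun u => Cmul (Cexpi (IZR k * node (- PI) N u)) (Cscale (/ INR N) (Phi l (z - node (- PI) N u)))) = Cexpi (IZR k * z)) ->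
  tpoly d (fun i => c0 * 2 ^ l i)%nat g -> (forall i, (i < d)%nat -> (2 * ((c0 + n) * 2 ^ l i) + 1 <= N)%nat) ->
  lsumC (ubox d N) (fun u => Cmul (g (pt N u)) (cprod d (fun i => Cscale (/ INR N) (Phi (l i) (z i - pt N u i))))) = g z.
Proof.
move=> [hC H] [L [h1 h2]] hN.
rewrite (lsumC_ext _ _ (fun u => lsumC L (fun q => Cmul (snd q) (cprod d (fun i => Cmul (Cexpi (IZR (fst q i) * node (- PI) N (u i))) (Cscale (/ INR N) (Phi (l i) (z i - node (- PI) N (u i))))))))).
  rewrite lsumC_exch h2. apply lsumC_ext => q hq. rewrite lsumC_scal. f_equal.
  rewrite (lsumC_mlist_prod O d (fun _ => seq 0 N) (fun i a => Cmul (Cexpi (IZR (fst q i) * node (- PI) N a)) (Cscale (/ INR N) (Phi (l i) (z i - node (- PI) N a))))).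
  apply cprod_ext => i hi. have [_ hr] := H (l i). apply hr; [by apply hN|by apply h1].
move=> u _. rewrite h2 -lsumC_scalr. apply lsumC_ext => q _. rewrite cprod_mul /pt; ring.
Qed.

Definition wgt (d : nat) (l : nat -> nat) (x y : nat -> R) : R :=
  rprod d (fun i => 1 + 2 ^ l i * rho (x i - y i)).

Lemma wgt_ge1 d l x y : 1 <= wgt d l x y.
Proof.
rewrite /wgt -{1}(pow1 d) -(rprod_const d 1). apply rprod_le => i _.
have := pow2_pos (l i). have := rho_ge0 (x i - y i). nra.
Qed.

Lemma wgt_tri d l x y z : wgt d l x z <= wgt d l x y * wgt d l y z.
Proof.
rewrite /wgt -rprod_mul. apply rprod_le => i _.
have h := pow2_pos (l i). have h3 := rho_ge0 (x i - z i).
have := rho_add (x i - y i) (y i - z i). replace (x i - y i + (y i - z i)) with (x i - z i) by ring.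
move=> h4.
have h6 : 0 <= (2 ^ l i * rho (x i - y i)) * (2 ^ l i * rho (y i - z i)) by pos.
split; nra.
Qed.

Lemma list_argmax {A} (l : list A) (v : A -> R) : l <> [] -> exists a, In a l /\ forall b, In b l -> v b <= v a.
Proof.
elim: l => [//|a l IH] _.
case: l IH => [|b l] IH; first by exists a; split; [left|move=> b [<-|[]]; lra].
have [c [hc H]] := IH ltac:(done).
case: (Rle_dec (v a) (v c)) => h.
  exists c; split; first by right. by move=> e [<-|/H].
exists a; split; first by left. move=> e [<-|/H]; lra.
Qed.

Lemma nodes_weight_eq d N l x u b : 
  rprod d (fun i => 2 ^ l i / INR N * rpow (1 + 2 ^ l i * rho (x i - pt N u i)) (- b))
  = rprod d (fun i => 2 ^ l i / INR N) * rpow (wgt d l x (pt N u)) (- b).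
Proof.
rewrite rprod_mul /wgt rprod_rpow // => i _.
have := pow2_pos (l i). have := rho_ge0 (x i - pt N u i). nra.
Qed.

(* With [W] the polynomial weight, [a = b / s] and [G] the maximum of [|g| W^{-a}] over the grid, both [G] and
   [|g x|] are bounded by [G^{1-s}] times the right-hand side. *)
Lemma peetre_le1 d c0 s b : 0 < s <= 1 -> 0 < b -> exists C K0, 0 < C /\ forall l g N,
  tpoly d (fun i => c0 * 2 ^ l i)%nat g -> (0 < N)%nat -> (forall i, (i < d)%nat -> (K0 * 2 ^ l i <= N)%nat) -> forall x,
  rpow (Cmod (g x)) s <= C * lsum (ubox d N) (fun u =>
    rprod d (fun i => 2 ^ l i / INR N * rpow (1 + 2 ^ l i * rho (x i - pt N u i)) (- b)) * rpow (Cmod (g (pt N u))) s).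
Proof.
move=> hs hb. set a := b / s. have ha : 0 < a by apply Rdiv_lt_0_compat; lra.
have [n hn] : exists n, a < INR n by apply INR_unbounded.
have [C [Phi hker]] := kernel_exists c0 n. have [hC hPhi] := hker.
exists (C ^ d), (2 * (c0 + n) + 1)%nat; split; first pos.
move=> l g N hg hN hK x.
have hN' : 0 < INR N by pos.
have hN2 : forall i, (i < d)%nat -> (2 * ((c0 + n) * 2 ^ l i) + 1 <= N)%nat.
  move=> i /hK. nia.
set V := rprod d (fun i => 2 ^ l i / INR N).
have hV : 0 < V by apply rprod_gt0 => i _; apply Rdiv_lt_0_compat => //; apply pow2_pos.
have base : forall z, Cmod (g z) <= C ^ d * lsum (ubox d N) (fun u => V * (Cmod (g (pt N u)) * rpow (wgt d l z (pt N u)) (- a))).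
  move=> z. rewrite -{1}(kernel_reproduces d c0 n C Phi l N g z hker hg hN2).
  apply: Rle_trans (Cmod_lsumC _ _) _. rewrite -lsum_scal. apply lsum_le => u _.
  rewrite Cmod_mul Cmod_cprod.
  have h1 : rprod d (fun i => Cmod (Cscale (/ INR N) (Phi (l i) (z i - pt N u i))))
     <= C ^ d * (V * rpow (wgt d l z (pt N u)) (- a)).
    rewrite -(nodes_weight_eq d N l z u a) -(rprod_const d C) -rprod_mul. apply rprod_le => i _.
    split; first pos.
    have [hb' _] := hPhi (l i). have {}hb' := hb' (z i - pt N u i).
    rewrite Cmod_scale; last pos.
    have h2 := pow2_pos (l i). have r0 := rho_ge0 (z i - pt N u i).
    have h3 : rpow (1 + 2 ^ l i * rho (z i - pt N u i)) (- INR n) <= rpow (1 + 2 ^ l i * rho (z i - pt N u i)) (- a).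
      apply rpow_exp_le; [nra|lra].
    apply: Rle_trans (_ : _ <= / INR N * (C * (2 ^ l i * rpow (1 + 2 ^ l i * rho (z i - pt N u i)) (- a)))) _.
      mul_l.
      apply: Rle_trans hb' _. mul_l. apply Rmult_le_compat_l; lra.
    apply Req_le; field; lra.
  have h2 := Rmult_le_compat_l _ _ _ (Cmod_ge0 (g (pt N u))) h1. lra.
pose val u := Cmod (g (pt N u)) * rpow (wgt d l x (pt N u)) (- a).
have hval : forall u, 0 <= val u by move=> u; apply Rmult_le_pos; [apply Cmod_ge0|apply rpow_ge0].
have hne : ubox d N <> [].
  have : In (fun _ => O) (ubox d 0) \/ exists u, In u (ubox d N).
    right. rewrite /ubox. elim: d {hg hK hN2 V hV base val hval} => [|d' [u IH]]; first by exists (fun _ => O); left.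
    exists (upd u d' O). rewrite /=. apply in_flat_map. exists O; split; first by apply in_seq; lia.
    by apply in_map_iff; exists u.
  case=> [h0|[u hu] e]; last by rewrite e in hu.
  case: d {hg hK hN2 V hV base val hval} h0 => [|d'] h0; by [].
have [u0 [hu0 hmax]] := list_argmax (ubox d N) val hne.
set G := val u0 in hmax. have hG : 0 <= G by apply hval.
set Sg := lsum (ubox d N) (fun u => V * val u).
have hSg : Cmod (g x) <= C ^ d * Sg by apply base.
(* [base] at the maximiser [u0]: by [wgt_tri] the weight centred at [pt N u0], times the one already
   present in [val u0], is dominated by the weight centred at [x]. *)
have hGS : G <= C ^ d * Sg.
  rewrite /G /val.
  have p := rpow_ge0 (wgt d l x (pt N u0)) (- a).
  apply: Rle_trans (Rmult_le_compat_r _ _ _ p (base (pt N u0))) _.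
  rewrite Rmult_assoc. mul_l.
  rewrite -lsum_scalr. apply lsum_le => u _. rewrite Rmult_assoc. mul_l.
  rewrite /val Rmult_assoc. mul_l.
  have w1 := wgt_ge1 d l (pt N u0) (pt N u). have w2 := wgt_ge1 d l x (pt N u0). have w3 := wgt_ge1 d l x (pt N u).
  rewrite -rpow_mul; try lra. apply rpow_le_neg; first lra. split; first lra.
  rewrite Rmult_comm; apply wgt_tri.
set A := lsum _ _.
have hA : A = lsum (ubox d N) (fun u => V * rpow (val u) s).
  apply lsum_ext => u _. rewrite nodes_weight_eq /val rpow_mul; [|apply Cmod_ge0|apply rpow_ge0].
  rewrite rpow_rpow -/V. replace (- a * s) with (- b) by (rewrite /a; field; lra). ring.
have hA0 : 0 <= A by rewrite hA; apply lsum_ge0 => u _; apply Rmult_le_pos; [lra|apply rpow_ge0].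
have hCd : 0 < C ^ d by pos.
case: (Rle_dec G 0) => hG0.
  have : Sg = 0.
    apply lsum_zero => u hu. have := hmax u hu. have := hval u. move=> h1 h2. replace (val u) with 0 by lra. ring.
  move=> e. rewrite e in hSg. rewrite rpow_0; last pos. nra.
(* Giving up [1 - s] powers of [val u] to the maximum brings the exponent from 1 down to [s]; [G]
   comes from a finite grid, hence is finite and can be divided out. *)
have key : Sg <= rpow G (1 - s) * A.
  rewrite /Sg hA -lsum_scal. apply lsum_le => u hu.
  have h1 : val u <= rpow G (1 - s) * rpow (val u) s.
    case: (Rle_dec (val u) 0) => h.
      have := rpow_ge0 G (1 - s). have := rpow_ge0 (val u) s. nra.
    rewrite -{1}(rpow_1 (val u)); last lra. replace 1 with ((1 - s) + s) at 1 by ring. rewrite rpow_add.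
    mul_r. apply rpow_le; first lra. by apply hmax.
  replace (rpow G (1 - s) * (V * rpow (val u) s)) with (V * (rpow G (1 - s) * rpow (val u) s)) by ring.
  apply Rmult_le_compat_l; lra.
have hGs : rpow G s <= C ^ d * A.
  have pG := rpow_gt0 G (1 - s) ltac:(lra).
  apply Rmult_le_reg_l with (rpow G (1 - s)) => //.
  rewrite -rpow_add. replace (1 - s + s) with 1 by ring. rewrite rpow_1 //.
  apply: Rle_trans hGS _. have := Rmult_le_compat_l _ _ _ (Rlt_le _ _ hCd) key. lra.
have hx : Cmod (g x) <= rpow G (1 - s) * (C ^ d * A).
  apply: Rle_trans hSg _. have := Rmult_le_compat_l _ _ _ (Rlt_le _ _ hCd) key. lra.
have hG1 := rpow_root_le G (C ^ d * A) s ltac:(lra) ltac:(nra) hGs.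
(* Insert [G <= (C^d A)^(1/s)]: the exponents [(1 - s)/s + 1], multiplied by [s], give 1. *)
apply: Rle_trans (_ : _ <= rpow (rpow (rpow (C ^ d * A) (/ s)) (1 - s) * (C ^ d * A)) s) _.
  apply rpow_le; first lra. apply: Rle_trans hx _. apply Rmult_le_compat_r; first nra.
  apply rpow_le; lra.
have hCA : 0 <= C ^ d * A by pos.
case: (Rle_dec (C ^ d * A) 0) => h0.
  have e : C ^ d * A = 0 by lra.
  rewrite e Rmult_0_r rpow_0; lra.
rewrite rpow_rpow -{2}(rpow_1 (C ^ d * A)); last lra.
rewrite -rpow_add rpow_rpow. replace ((/ s * (1 - s) + 1) * s) with 1 by (field; lra).
rewrite rpow_1; lra.
Qed.

Lemma Rmult_left_comm a b c : a * (b * c) = b * (a * c).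
Proof. ring. Qed.

Lemma lsum_ubox_prod d N (f : nat -> R -> R) :
  lsum (ubox d N) (fun u => rprod d (fun i => f i (pt N u i))) = rprod d (fun i => rsum N (fun a => f i (node (- PI) N a))).
Proof. exact: (lsum_mlist_prod O d (fun _ => seq 0 N) (fun i a => f i (node (- PI) N a))). Qed.

Lemma rprod_const_le d g C : (forall i, (i < d)%nat -> 0 <= g i <= C) -> rprod d g <= C ^ d.
Proof. move=> h; rewrite -(rprod_const d C); by apply rprod_le. Qed.

(** For [s > 1] it follows from the case [s = 1] by [jensen], where [1 < b] bounds the total weight.
    [K0 + 1] ensures [2^(l_i) <= N], as [grid_avg_decay] requires. *)
Lemma peetre d c0 s b : 0 < s -> 1 < b -> exists C K0, 0 < C /\ forall l g N,
  tpoly d (fun i => c0 * 2 ^ l i)%nat g -> (0 < N)%nat -> (forall i, (i < d)%nat -> (K0 * 2 ^ l i <= N)%nat) -> forall x,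
  rpow (Cmod (g x)) s <= C * lsum (ubox d N) (fun u =>
    rprod d (fun i => 2 ^ l i / INR N * rpow (1 + 2 ^ l i * rho (x i - pt N u i)) (- b)) * rpow (Cmod (g (pt N u))) s).
Proof.
move=> hs hb. case: (Rle_dec s 1) => hs1; first by apply peetre_le1; lra.
have [C [K0 [hC H]]] := peetre_le1 d c0 1 b ltac:(lra) ltac:(lra).
have [C2 [hC2 H2]] := grid_avg_decay b hb.
exists (rpow C s * rpow (C2 ^ d) (s - 1)), (K0 + 1)%nat; split.
  pos.
move=> l g N hg hN hK x.
have hN' : 0 < INR N by pos.
have {}H := H l g N hg hN ltac:(move=> i /hK; nia) x.
rewrite rpow_1 in H; last pos.
set w := fun u => rprod d (fun i => 2 ^ l i / INR N * rpow (1 + 2 ^ l i * rho (x i - pt N u i)) (- b)).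
have hw : forall u, 0 <= w u.
  move=> u; apply rprod_ge0 => i _; apply Rmult_le_pos; last by apply rpow_ge0.
  apply Rdiv_ge0 => //; have := pow2_pos (l i); lra.
have {}H : Cmod (g x) <= C * lsum (ubox d N) (fun u => w u * Cmod (g (pt N u))).
  apply: Rle_trans H _. apply Req_le. f_equal. apply lsum_ext => u _. by rewrite rpow_1 //; apply Cmod_ge0.
have hsum0 : 0 <= lsum (ubox d N) (fun u => w u * Cmod (g (pt N u))) by pos.
apply: Rle_trans (_ : _ <= rpow (C * lsum (ubox d N) (fun u => w u * Cmod (g (pt N u)))) s) _.
  apply rpow_le; lra.
rewrite rpow_mul; try lra. rewrite Rmult_assoc. mul_l.
have hj := jensen (ubox d N) w (fun u => Cmod (g (pt N u))) s ltac:(lra) (fun u _ => hw u) (fun u _ => Cmod_ge0 _).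
apply: Rle_trans hj _. apply Rmult_le_compat_r.
  pos.
apply rpow_le; first lra.
rewrite /w (lsum_ubox_prod d N (fun i t => 2 ^ l i / INR N * rpow (1 + 2 ^ l i * rho (x i - t)) (- b))).
apply rprod_const_le => i hi. split.
  apply rsum_ge0 => a _; apply Rmult_le_pos; last by apply rpow_ge0.
  apply Rdiv_ge0 => //; have := pow2_pos (l i); lra.
apply H2 => //. split; first pos. rewrite -pow2_INR. apply le_INR. have := hK i hi; nia.
Qed.

(** * Pointwise bounds for the sampled blocks *)

Definition ebox (d L : nat) (j : nat -> nat) (x : nat -> R) := mlist (0, C0) d (fun i => enodes L (j i) (x i)).

(* For [s > 1] the factor [w^{-1}] is split as [w^{-beta} w^{beta - 1}] with [beta > 1] so that [w^{-beta}] is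
   summable over the nodes. *)
Lemma holder_nodes d L s g : (1 <= L)%nat -> 0 < s -> 0 < g < 1 -> g < s -> exists C, 0 < C /\ forall j x (h : (nat -> R * Cx) -> R),
  (forall e, 0 <= h e) ->
  rpow (lsum (ebox d L j x) (fun e => rprod d (fun i => Cmod (snd (e i))) * h e)) s
  <= C * lsum (ebox d L j x) (fun e => rprod d (fun i => rpow (1 + 2 ^ j i * rho (x i - fst (e i))) (- g)) * rpow (h e) s).
Proof.
move=> hL hs hg hgs.
have [C1 [hC1 H1]] := enodes_weight L hL.
have w1 : forall (j : nat -> nat) (x : nat -> R) (e : nat -> R * Cx) i, 1 <= 1 + 2 ^ j i * rho (x i - fst (e i)).
  move=> j x e i. have := pow2_pos (j i). have := rho_ge0 (x i - fst (e i)). nra.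
have hcoef : forall j x e, In e (ebox d L j x) ->
   rprod d (fun i => Cmod (snd (e i))) <= C1 ^ d * rprod d (fun i => rpow (1 + 2 ^ j i * rho (x i - fst (e i))) (- 1)).
  move=> j x e he. rewrite -(rprod_const d C1) -rprod_mul. apply rprod_le => i hi. split; first pos.
  apply H1. exact: (mlist_in _ _ _ _ he i hi).
have hC1d : 0 < C1 ^ d by pos.
have red : forall j x (h : (nat -> R * Cx) -> R), (forall e, 0 <= h e) ->
  rpow (lsum (ebox d L j x) (fun e => rprod d (fun i => Cmod (snd (e i))) * h e)) s
  <= rpow (C1 ^ d) s * rpow (lsum (ebox d L j x) (fun e => rprod d (fun i => rpow (1 + 2 ^ j i * rho (x i - fst (e i))) (- 1)) * h e)) s.
  move=> j x h hh. rewrite -rpow_mul; [|lra|].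
    apply rpow_le; first lra. rewrite -lsum_scal. apply lsum_le => e he. rewrite -Rmult_assoc.
    apply Rmult_le_compat_r => //. by apply hcoef.
  pos.
case: (Rle_dec s 1) => hs1.
  exists (rpow (C1 ^ d) s); split; first pos.
  move=> j x h hh. apply: Rle_trans (red j x h hh) _. mul_l.
  apply: Rle_trans (lsum_rpow_sub _ _ s ltac:(lra) _) _.
    move=> e _; apply Rmult_le_pos => //; apply rprod_ge0 => i _; apply rpow_ge0.
  apply lsum_le => e _. rewrite rpow_mul //; last pos.
  mul_r.
  rewrite rprod_rpow; last pos.
  apply rprod_le => i _. split; first pos. rewrite rpow_rpow. apply rpow_exp_le; [by apply w1|lra].
(* With this choice [- bt + (bt - 1) s = 1 - g - bt], which is below [- g] because [1 < bt]. *)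
set bt := 1 + (1 - g) / s.
have hbt0 : 0 < (1 - g) / s by pos.
have hbt : 1 < bt by rewrite /bt; lra.
have [C2 [hC2 H2]] := enodes_sum L bt hbt.
exists (rpow (C1 ^ d) s * rpow (C2 ^ d) (s - 1)); split.
  pos.
move=> j x h hh. apply: Rle_trans (red j x h hh) _. rewrite Rmult_assoc.
mul_l.
pose v q (e : nat -> R * Cx) := rprod d (fun i => rpow (1 + 2 ^ j i * rho (x i - fst (e i))) q).
have hv : forall q e, 0 <= v q e by move=> q e; apply rprod_ge0 => i _; apply rpow_ge0.
have vadd : forall q q' e, v (q + q') e = v q e * v q' e.
  move=> q q' e; rewrite /v -rprod_mul; apply rprod_ext => i _; by rewrite rpow_add.
have vpow : forall q t e, rpow (v q e) t = v (q * t) e.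
  move=> q t e; rewrite /v rprod_rpow; last pos.
  apply rprod_ext => i _; by rewrite rpow_rpow.
rewrite (lsum_ext _ _ (fun e => v (- bt) e * (v (bt - 1) e * h e))); last first.
  move=> e _. rewrite -Rmult_assoc -vadd. do 2 f_equal. apply rprod_ext => i _; f_equal; lra.
apply: Rle_trans (jensen _ _ _ s ltac:(lra) (fun e _ => hv _ e) (fun e _ => Rmult_le_pos _ _ (hv _ e) (hh e))) _.
apply Rmult_le_compat; try apply rpow_ge0.
- apply lsum_ge0 => e _; apply Rmult_le_pos => //; apply rpow_ge0.
- apply rpow_le; first lra.
  rewrite /v /ebox (lsum_mlist_prod (0, C0) d (fun i => enodes L (j i) (x i)) (fun i e => rpow (1 + 2 ^ j i * rho (x i - fst e)) (- bt))).
  apply rprod_const_le => i hi. split; last pos. apply lsum_ge0 => e _; apply rpow_ge0.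
- apply lsum_le => e _. rewrite rpow_mul // vpow -Rmult_assoc -vadd.
  mul_r.
  apply rprod_le => i _. split; first pos. apply rpow_exp_le; first pos.
  have e1 : bt * s = s + (1 - g) by rewrite /bt; field; lra.
rewrite /bt in e1 *. lra.
Qed.

(** Replacing the node by [y] in the slow factor costs [T^g], where [T] measures their distance at
    scale [2^j]. Up to [(2^c)^3], the cubic factor is at most [T^(-3)], as [j <= l + c]; since
    [g < 1], at least [T^(-2)] is left, which is summable over the nodes. *)
Lemma node_conv L g c : 0 < g < 1 -> exists C, 0 < C /\ forall j l x y, (j <= l + c)%nat ->
  lsum (enodes L j x) (fun e => rpow (1 + 2 ^ j * rho (x - fst e)) (- g) * rpow (1 + 2 ^ l * rho (fst e - y)) (- (3)))
  <= C * rpow (1 + 2 ^ j * rho (x - y)) (- g).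
Proof.
move=> hg. have [C2 [hC2 H2]] := enodes_sum L 2 ltac:(lra).
have hc := pow2_pos c.
exists (rpow (2 ^ c) 3 * C2); split; first pos.
move=> j l x y hjl.
have hj := pow2_pos j.
have hjl' : 2 ^ j <= 2 ^ c * 2 ^ l by rewrite -pow_add; apply Rle_pow; [lra|lia].
set Z := 1 + 2 ^ j * rho (x - y).
have hZ : 1 <= Z by rewrite /Z; have := rho_ge0 (x - y); nra.
apply: Rle_trans (_ : _ <= lsum (enodes L j x) (fun e => (rpow (2 ^ c) 3 * rpow Z (- g)) * rpow (1 + 2 ^ j * rho (y - fst e)) (- 2))) _; last first.
  rewrite lsum_scal. have h := H2 j x y. have p1 := rpow_ge0 (2 ^ c) 3. have p2 := rpow_ge0 Z (- g).
  replace (rpow (2 ^ c) 3 * C2 * rpow Z (- g)) with (rpow (2 ^ c) 3 * rpow Z (- g) * C2) by ring.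
  apply Rmult_le_compat_l; last exact h. by apply Rmult_le_pos.
apply lsum_le => e _.
have r1 := rho_ge0 (x - fst e). have r2 := rho_ge0 (fst e - y). have r3 : rho (fst e - y) = rho (y - fst e).
  rewrite -rho_opp; f_equal; ring.
have r4 : rho (x - y) <= rho (x - fst e) + rho (fst e - y).
  have := rho_add (x - fst e) (fst e - y). by replace (x - fst e + (fst e - y)) with (x - y) by ring.
set X := 1 + 2 ^ j * rho (x - fst e). set Y := 1 + 2 ^ l * rho (fst e - y).
set T := 1 + 2 ^ j * rho (y - fst e).
rewrite -r3 in T *.
have hX : 1 <= X by rewrite /X; nra.
have hY : 1 <= Y by rewrite /Y; nra.
have hT : 1 <= T by rewrite /T; nra.
have hZX : Z <= X * T.
  rewrite /Z /X /T. have := Rmult_le_compat_l _ _ _ (Rlt_le _ _ hj) r4.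
  have : 0 <= (2 ^ j * rho (x - fst e)) * (2 ^ j * rho (fst e - y)) by pos. lra.
have hTY : T <= 2 ^ c * Y.
  rewrite /T /Y. have := Rmult_le_compat_r _ _ _ r2 hjl'. have := pow2_ge1 c. lra.
have a1 : rpow X (- g) <= rpow Z (- g) * rpow T g.
  have h1 : rpow (X * T) (- g) <= rpow Z (- g) by apply rpow_le_neg; lra.
  rewrite rpow_mul in h1; try lra.
  have pT := rpow_ge0 T g. have h2 := Rmult_le_compat_r _ _ _ pT h1.
  rewrite Rmult_assoc -rpow_add in h2. replace (- g + g) with 0 in h2 by ring. rewrite rpow_exp0 in h2; lra.
have a2 : rpow Y (- (3)) <= rpow (2 ^ c) 3 * rpow T (- (3)).
  have h1 : rpow (2 ^ c * Y) (- (3)) <= rpow T (- (3)) by apply rpow_le_neg; lra.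
  rewrite rpow_mul in h1; try lra.
  have pT := rpow_ge0 (2 ^ c) 3. have h2 := Rmult_le_compat_l _ _ _ pT h1.
  rewrite -Rmult_assoc -rpow_add in h2. replace (3 + - (3)) with 0 in h2 by ring. rewrite rpow_exp0 in h2; lra.
apply: Rle_trans (Rmult_le_compat _ _ _ _ (rpow_ge0 _ _) (rpow_ge0 _ _) a1 a2) _.
replace (rpow Z (- g) * rpow T g * (rpow (2 ^ c) 3 * rpow T (- (3)))) with ((rpow (2 ^ c) 3 * rpow Z (- g)) * (rpow T g * rpow T (- (3)))) by ring.
mul_l.
rewrite -rpow_add. apply rpow_exp_le; lra.
Qed.

(** [holder_nodes] moves the power [s] inside the sum over sampling nodes, [peetre] of order 3
    replaces the values at these nodes by grid values, and [node_conv] carries out the sum over the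
    nodes. The kernel obtained has the width of level [j] but the normalisation of level [l]. *)
Lemma qop_point_bound d L c0 c s g : (1 <= L)%nat -> 0 < s -> 0 < g < 1 -> g < s -> exists C K0, 0 < C /\
  forall l j f N x, tpoly d (fun i => c0 * 2 ^ l i)%nat f -> (forall i, (i < d)%nat -> (j i <= l i + c)%nat) ->
  (0 < N)%nat -> (forall i, (i < d)%nat -> (K0 * 2 ^ l i <= N)%nat) ->
  rpow (Cmod (qop d L j f x)) s <= C * lsum (ubox d N) (fun u =>
    rprod d (fun i => 2 ^ l i / INR N * rpow (1 + 2 ^ j i * rho (x i - pt N u i)) (- g)) * rpow (Cmod (f (pt N u))) s).
Proof.
move=> hL hs hg hgs.
have [C1 [hC1 H1]] := holder_nodes d L s g hL hs hg hgs.
have [C2 [K0 [hC2 H2]]] := peetre d c0 s 3 hs ltac:(lra).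
have [C3 [hC3 H3]] := node_conv L g c hg.
exists (C1 * (C2 * C3 ^ d)), K0; split.
  pos.
move=> l j f N x hf hj hN hK.
rewrite Rmult_assoc qop_expand.
pose q (e : nat -> R * Cx) : nat -> R := fun i => if (i <? d)%nat then fst (e i) else x i.
apply: Rle_trans (_ : _ <= rpow (lsum (ebox d L j x) (fun e => rprod d (fun i => Cmod (snd (e i))) * Cmod (f (q e)))) s) _.
  apply rpow_le; first lra. apply: Rle_trans (Cmod_lsumC _ _) _. apply Req_le, lsum_ext => e _.
  by rewrite Cmod_mul Cmod_cprod.
apply: Rle_trans (H1 j x (fun e => Cmod (f (q e))) (fun e => Cmod_ge0 _)) _.
mul_l.
rewrite Rmult_assoc -lsum_scal.
apply: Rle_trans (_ : _ <= lsum (ebox d L j x) (fun e => lsum (ubox d N) (fun u => C2 * (rpow (Cmod (f (pt N u))) s *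
   rprod d (fun i => 2 ^ l i / INR N * (rpow (1 + 2 ^ j i * rho (x i - fst (e i))) (- g) * rpow (1 + 2 ^ l i * rho (fst (e i) - pt N u i)) (- (3)))))))) _.
  apply lsum_le => e _. have pw : 0 <= rprod d (fun i => rpow (1 + 2 ^ j i * rho (x i - fst (e i))) (- g)).
    pos.
  apply: Rle_trans (Rmult_le_compat_l _ _ _ pw (H2 l f N hf hN hK (q e))) _.
  rewrite lsum_scal.
  rewrite Rmult_left_comm.
  mul_l. rewrite -lsum_scal. apply Req_le, lsum_ext => u _.
  rewrite -Rmult_assoc -rprod_mul Rmult_comm. f_equal. apply rprod_ext => i hi.
  rewrite /q. have -> : (i <? d)%nat = true by apply Nat.ltb_lt. ring.
rewrite lsum_exch -[X in _ <= X]lsum_scal. apply lsum_le => u _.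
rewrite lsum_scal. mul_l.
rewrite lsum_scal.
rewrite -(Rmult_assoc (C3 ^ d)) (Rmult_comm (C3 ^ d * _)). mul_l.
rewrite /ebox (lsum_mlist_prod (0, C0) d (fun i => enodes L (j i) (x i)) (fun i e => 2 ^ l i / INR N * (rpow (1 + 2 ^ j i * rho (x i - fst e)) (- g) * rpow (1 + 2 ^ l i * rho (fst e - pt N u i)) (- (3))))).
rewrite -(rprod_const d C3) -rprod_mul. apply rprod_le => i hi.
have hl : 0 <= 2 ^ l i / INR N by pos.
split.
  pos.
rewrite lsum_scal.
have := Rmult_le_compat_l _ _ _ hl (H3 (j i) (l i) (x i) (pt N u i) (hj i hi)). lra.
Qed.

(** The operator [A_j]. As [g < 1] it is an average only in name: each factor has mass of order
    [2^((1 - g) j)]. *)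
Definition kavg (d N : nat) (g : R) (j : nat -> nat) (x : nat -> R) (H : (nat -> nat) -> R) : R :=
  lsum (ubox d N) (fun u => rprod d (fun i => 2 ^ j i / INR N * rpow (1 + 2 ^ j i * rho (x i - pt N u i)) (- g)) * H u).

Lemma kavg_ge0 d N g j x H : (forall u, 0 <= H u) -> (0 < N)%nat -> 0 <= kavg d N g j x H.
Proof.
move=> hH hN. apply lsum_ge0 => u _. apply Rmult_le_pos => //. apply rprod_ge0 => i _.
pos.
Qed.

(* Schur test with the weight [prod (rho + 1/N)^sg]. *)
Lemma kavg_schur d g P : 1 < P -> g < 1 -> 1 - 1 / P < g -> exists C, 0 < C /\ forall N J x H,
  (0 < N)%nat -> (forall j, (j < J)%nat -> 2 ^ j <= INR N) -> (forall u, 0 <= H u) ->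
  lsum (ubox d J) (fun j => rprod d (fun i => / 2 ^ j i) * rpow (kavg d N g j x H) P)
  <= C * lsum (ubox d N) (fun u => (/ INR N) ^ d * rpow (H u) P).
Proof.
move=> hP hg1 hg.
have hg0 : 0 < g.
  have : 0 < 1 - 1 / P; last lra.
  have : 1 / P < 1; last lra. apply Rmult_lt_reg_r with P; first lra. field_simplify; lra.
have hPg : (1 - g) * P < 1.
  have : (1 - g) * P < (1 / P) * P by apply Rmult_lt_compat_r; lra.
  have -> : 1 / P * P = 1 by field; lra. by [].
(* The exponent [sg] of the Schur weight, with [s' = sg / (P - 1)], has to satisfy [sg > lo] for
   [1 < g + s'], [sg < P - 1] for [s' < 1], and [sg < g] for [level_sum_bound]. The interval is
   nonempty because [(1 - g) P < 1]. *)
set lo := (1 - g) * (P - 1). set hi := Rmin g (P - 1).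
have hlo0 : 0 < lo by apply Rmult_lt_0_compat; lra.
have hlohi : lo < hi.
  rewrite /lo; apply Rmin_glb_lt; nra.
set sg := (lo + hi) / 2.
have hsg1 : sg < g by have := Rmin_l g (P - 1); rewrite -/hi /sg; lra.
have hsg2 : sg < P - 1 by have := Rmin_r g (P - 1); rewrite -/hi /sg; lra.
have hsg0 : lo < sg by rewrite /sg; lra.
set s' := sg / (P - 1).
have hs'1 : s' < 1 by apply Rmult_lt_reg_r with (P - 1); [lra|rewrite /s' /Rdiv Rmult_assoc Rinv_l; lra].
have hs'2 : 1 < g + s'.
  have : 1 - g < s'; last lra. apply Rmult_lt_reg_r with (P - 1); first lra. rewrite /s' /Rdiv Rmult_assoc Rinv_l; last lra.
  rewrite -/lo; lra.
have hs'0 : 0 <= s' by pos.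
have [C1 [hC1 H1]] := grid_avg_singular g s' ltac:(lra) hs'1 hs'2 hs'0.
have [C2 [hC2 H2]] := level_sum_bound sg g ltac:(lra) hsg1.
exists (rpow (C1 ^ d) (P - 1) * C2 ^ d); split.
  pos.
move=> N J x H hN hJ hH.
have hN' : 0 < INR N by pos. have hiN : 0 < / INR N by pos.
pose k (j : nat) (t : R) := 2 ^ j / INR N * rpow (1 + 2 ^ j * rho t) (- g).
pose v (t : R) q := rpow (rho t + / INR N) q.
have hk : forall j t, 0 <= k j t.
  move=> j t; apply Rmult_le_pos; last by apply rpow_ge0. apply Rdiv_ge0 => //; have := pow2_pos j; lra.
have hvp : forall t, 0 < rho t + / INR N by move=> t; have := rho_ge0 t; lra.
have hv : forall t q, 0 <= v t q by move=> t q; apply rpow_ge0.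
(* [jensen] with weights [k v^(-s')] and function [v^(s') H]. The weights have sum of order
   [(2^j)^(s')], whose power [P - 1] is [(2^j)^sg]; what remains of [v] is [- s' + s' P = sg]. *)
have step : forall j, (forall i, (i < d)%nat -> 2 ^ j i <= INR N) -> rpow (kavg d N g j x H) P <=
  rpow (C1 ^ d) (P - 1) * lsum (ubox d N) (fun u => rprod d (fun i => rpow (2 ^ j i) sg * (k (j i) (x i - pt N u i) * v (x i - pt N u i) sg)) * rpow (H u) P).
  move=> j hj.
  have -> : kavg d N g j x H = lsum (ubox d N) (fun u => rprod d (fun i => k (j i) (x i - pt N u i) * v (x i - pt N u i) (- s')) * (rprod d (fun i => v (x i - pt N u i) s') * H u)).
    apply lsum_ext => u _. rewrite -Rmult_assoc -rprod_mul. f_equal. apply rprod_ext => i _.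
    rewrite /v Rmult_assoc -rpow_add. replace (- s' + s') with 0 by ring. rewrite rpow_exp0 // Rmult_1_r //.
  have hw : forall u, 0 <= rprod d (fun i => k (j i) (x i - pt N u i) * v (x i - pt N u i) (- s')) by pos.
  have hf : forall u, 0 <= rprod d (fun i => v (x i - pt N u i) s') * H u by pos.
  apply: Rle_trans (jensen _ _ _ P ltac:(lra) (fun u _ => hw u) (fun u _ => hf u)) _.
  have hA : rpow (lsum (ubox d N) (fun u => rprod d (fun i => k (j i) (x i - pt N u i) * v (x i - pt N u i) (- s')))) (P - 1)
     <= rpow (C1 ^ d) (P - 1) * rprod d (fun i => rpow (2 ^ j i) sg).
    rewrite (lsum_ubox_prod d N (fun i t => k (j i) (x i - t) * v (x i - t) (- s'))).
    apply: Rle_trans (_ : _ <= rpow (C1 ^ d * rprod d (fun i => rpow (2 ^ j i) s')) (P - 1)) _.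
      apply rpow_le; first lra. rewrite -(rprod_const d C1) -rprod_mul. apply rprod_le => i hi'. split.
        pos.
      apply: Rle_trans (H1 N (2 ^ j i) (x i) (- PI) hN ltac:(split; [apply pow2_pos|by apply hj])).
      apply Req_le. apply rsum_ext => a _. rewrite /k /v; ring.
    rewrite rpow_mul; [|apply pow_le; lra|apply rprod_ge0 => i _; apply rpow_ge0].
    mul_l. rewrite rprod_rpow; last pos.
    apply Req_le, rprod_ext => i _. rewrite rpow_rpow. f_equal. rewrite /s'; field; lra.
  apply: Rle_trans (Rmult_le_compat_r _ _ _ _ hA) _.
    pos.
  rewrite Rmult_assoc. mul_l.
  rewrite -lsum_scal. apply Req_le, lsum_ext => u _.
  rewrite rpow_mul //; last pos.
  rewrite -!Rmult_assoc. f_equal. rewrite rprod_rpow; last pos.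
  rewrite -!rprod_mul. apply rprod_ext => i _. rewrite /v rpow_rpow.
  have eA : forall A, rpow A sg = rpow A (- s') * rpow A (s' * P).
    move=> A; rewrite -rpow_add; f_equal; rewrite /s'; field; lra.
  rewrite (eA (rho (x i - pt N u i) + / INR N)). ring.
apply: Rle_trans (_ : _ <= lsum (ubox d J) (fun j => lsum (ubox d N) (fun u => rpow (C1 ^ d) (P - 1) * ((/ INR N) ^ d * rpow (H u) P *
   rprod d (fun i => rpow (2 ^ j i * (rho (x i - pt N u i) + / INR N)) sg * rpow (1 + 2 ^ j i * rho (x i - pt N u i)) (- g)))))) _.
  apply lsum_le => j hj.
  have hj' : forall i, (i < d)%nat -> 2 ^ j i <= INR N.
    move=> i hi'. have := mlist_in _ _ _ _ hj i hi' => /in_seq h. apply hJ; lia.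
  have p0 : 0 <= rprod d (fun i => / 2 ^ j i) by pos.
  apply: Rle_trans (Rmult_le_compat_l _ _ _ p0 (step j hj')) _.
  rewrite !lsum_scal.
  rewrite Rmult_left_comm.
  mul_l.
  rewrite -lsum_scal. apply Req_le, lsum_ext => u _.
  rewrite -Rmult_assoc -rprod_mul -(rprod_const d (/ INR N)) (Rmult_comm (rprod d (fun _ => / INR N))) Rmult_assoc.
  rewrite -rprod_mul (Rmult_comm (rpow (H u) P)). f_equal.
  apply rprod_ext => i _. have h2 := pow2_pos (j i).
  rewrite (rpow_mul (2 ^ j i)); [|lra|have := hvp (x i - pt N u i); lra]. rewrite /k /v. field; lra.
rewrite lsum_exch -lsum_scal. apply lsum_le => u _. rewrite lsum_scal Rmult_assoc.
mul_l.
rewrite lsum_scal Rmult_comm. apply Rmult_le_compat_r.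
  pos.
rewrite (lsum_mlist_prod O d (fun _ => seq 0 J) (fun i a => rpow (2 ^ a * (rho (x i - pt N u i) + / INR N)) sg * rpow (1 + 2 ^ a * rho (x i - pt N u i)) (- g))).
apply rprod_const_le => i _. split.
  pos.
apply H2 => //. apply rho_ge0.
Qed.

(** * Estimates of the building blocks *)

Lemma rpow2_dot_opp d r j : rpow 2 (- dotR d r j) = rprod d (fun i => rpow 2 (- (r i * INR (j i)))).
Proof.
rewrite /dotR; elim: d => [|d IH]; first by rewrite /rsum /rprod /= Ropp_0 rpow_exp0; lra.
by rewrite rsum_S Ropp_plus_distr rpow_add IH rprod_S.
Qed.

Definition tailC (c : nat) (a : R) : R := rpow 2 (INR c * a) / (1 - rpow 2 (- a)).

Lemma rpow2_neg_lt1 a : 0 < a -> 0 < rpow 2 (- a) < 1.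
Proof.
move=> ha; split; first pos.
rewrite rpow_opp; last lra. have := rpow_double_lt a ha => h. rewrite -Rinv_1. apply Rinv_lt_contravar; lra.
Qed.

Lemma tailC_gt0 c a : 0 < a -> 0 < tailC c a.
Proof. move=> /rpow2_neg_lt1 h. apply Rdiv_lt_0_compat; [apply rpow_gt0|]; lra. Qed.

Lemma geometric_tail c a n j : 0 < a ->
  rsum n (fun l => if (j <=? l + c)%nat then rpow 2 (- (a * INR l)) else 0) <= tailC c a * rpow 2 (- (a * INR j)).
Proof.
move=> ha. have hq := rpow2_neg_lt1 a ha. set q := rpow 2 (- a) in hq.
have hqn : forall m : nat, rpow 2 (- (a * INR m)) = q ^ m.
  move=> m. rewrite -rpow_nat; last lra. rewrite /q rpow_rpow. f_equal; ring.
(* Subtraction on [nat] is truncated, so [T] is constant while [l + c < j] and the telescoping sum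
   sees exactly the nonzero terms. *)
pose T l := - (q ^ (l + c - j) / (1 - q)).
have hT : forall l, - / (1 - q) <= T l <= 0.
  move=> l. have h1 : 0 <= q ^ (l + c - j) <= 1.
    split; first pos. rewrite -(pow1 (l + c - j)); apply pow_incr; lra.
  have h2 : 0 < / (1 - q) by pos. rewrite /T /Rdiv; nra.
apply: Rle_trans (_ : _ <= rpow 2 (INR c * a) * rpow 2 (- (a * INR j)) * (T n - T O)) _; last first.
  have h3 := hT n. have h4 := hT O. rewrite /tailC -/q.
  replace (rpow 2 (INR c * a) / (1 - q) * rpow 2 (- (a * INR j))) with (rpow 2 (INR c * a) * rpow 2 (- (a * INR j)) * / (1 - q)) by (field; lra).
  mul_l. lra.
rewrite -(rsum_telescope n T) -rsum_scal. apply rsum_le => l _.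
rewrite /T. case: (Nat.leb_spec j (l + c)) => h.
  apply Req_le. have -> : (S l + c - j)%nat = S (l + c - j) by lia.
  have -> : - (q ^ S (l + c - j) / (1 - q)) - - (q ^ (l + c - j) / (1 - q)) = q ^ (l + c - j).
    rewrite /=; field; lra.
  rewrite -hqn -!rpow_add. f_equal. rewrite minus_INR // plus_INR. ring.
have -> : (S l + c - j)%nat = O by lia. have -> : (l + c - j)%nat = O by lia. lra.
Qed.

Lemma forall_or_fail d (P : nat -> bool) : (forall i, (i < d)%nat -> P i = true) \/ exists i, (i < d)%nat /\ P i = false.
Proof.
elim: d => [|d [IH|[i [hi h]]]]; first by left=> i; lia.
  case h : (P d); last by right; exists d; split; [lia|].
  left=> i hi. case: (Nat.eq_dec i d) => [->//|hne]. apply IH; lia.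
right; exists i; split; [lia|done].
Qed.

(* Any [s] with [max (1/r0) (p/(p+1)) < s < p] works: [1/s < r0] makes the sum over [l] converge, and
   [p/(p+1) < s] leaves room for [1 - s/p < g < min (1, s)]. *)
Lemma block_estimate d L c0 p r0 r : (1 <= L)%nat -> 0 < p -> 1 / p < r0 -> (forall i, (i < d)%nat -> r0 <= r i) ->
  exists C K0 c, 0 < C /\ (L + c0 < c)%nat /\ forall n N g h x,
  (forall l, In l (ubox d n) -> tpoly d (fun i => c0 * 2 ^ l i)%nat (g l)) -> (0 < N)%nat -> (K0 * 2 ^ (n + c) <= N)%nat ->
  (forall u, 0 <= h u) ->
  (forall l u, In l (ubox d n) -> Cmod (g l (pt N u)) <= rpow 2 (- dotR d r l) * h u) ->
  exists a : (nat -> nat) -> R, (forall j, 0 <= a j) /\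
  (forall j, lsum (ubox d n) (fun l => Cmod (qop d L j (g l) x)) <= C * (rpow 2 (- dotR d (fun i => r i - 1 / p) j) * a j)) /\
  (forall J, (J <= n + c + 1)%nat -> lsum (ubox d J) (fun j => rpow (a j) p) <= C * lsum (ubox d N) (fun u => (/ INR N) ^ d * rpow (h u) p)).
Proof.
move=> hL hp hr0 hr.
have hip : 0 < 1 / p by pos.
have hir : / r0 < p.
  apply Rmult_lt_reg_r with (r0 / p); first pos.
  replace (/ r0 * (r0 / p)) with (1 / p) by (field; lra). replace (p * (r0 / p)) with r0 by (field; lra). lra.
have hpp : p / (p + 1) < p.
  apply Rmult_lt_reg_r with (p + 1); first lra. replace (p / (p + 1) * (p + 1)) with p by (field; lra). nra.
set lo := Rmax (/ r0) (p / (p + 1)).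
have hlo : lo < p by apply Rmax_lub_lt.
have hlo1 : / r0 <= lo by apply Rmax_l. have hlo2 : p / (p + 1) <= lo by apply Rmax_r.
have hir0 : 0 < / r0 by pos.
set s := (lo + p) / 2.
have hs1 : / r0 < s by rewrite /s; lra. have hs2 : p / (p + 1) < s by rewrite /s; lra.
have hs3 : s < p by rewrite /s; lra. have hs : 0 < s by lra.
have hs4 : 1 - s / p < s.
  have : p < s * (p + 1).
    have := Rmult_lt_compat_r (p + 1) _ _ ltac:(lra) hs2. by replace (p / (p + 1) * (p + 1)) with p by (field; lra).
  move=> h. apply Rmult_lt_reg_r with p => //. replace ((1 - s / p) * p) with (p - s) by (field; lra). lra.
have hs5 : 0 < s / p < 1.
  split; first by apply Rdiv_lt_0_compat. apply Rmult_lt_reg_r with p => //. unfold Rdiv; rewrite Rmult_assoc Rinv_l; lra.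
have hsr : / s < r0.
  rewrite -(Rinv_inv r0). apply Rinv_lt_contravar => //. by apply Rmult_lt_0_compat.
set g := ((1 - s / p) + Rmin 1 s) / 2.
have hm1 := Rmin_l 1 s. have hm2 := Rmin_r 1 s.
have hm3 : 1 - s / p < Rmin 1 s by apply Rmin_glb_lt; lra.
have hg : 0 < g < 1 by rewrite /g; lra.
have hgs : g < s by rewrite /g; lra.
set P := p / s.
have hP : 1 < P by apply Rmult_lt_reg_r with s => //; rewrite /P /Rdiv Rmult_assoc Rinv_l; lra.
have hgP : 1 - 1 / P < g.
  have -> : 1 / P = s / p by rewrite /P; field; lra. rewrite /g; lra.
pose c := (L + 1 + c0)%nat.
have [C1 [K1 [hC1 H1]]] := qop_point_bound d L c0 c s g hL hs hg hgs.
have [C2 [hC2 H2]] := kavg_schur d g P hP ltac:(lra) hgP.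
(* Decay in [l_i] that is left once the change of normalisation has cost [2^(l_i / s)]; positive by
   [/ s < r0]. *)
pose a_ i := r i - / s.
have ha : forall i, (i < d)%nat -> 0 < a_ i by move=> i /hr; rewrite /a_; lra.
set C3 := rpow C1 (/ s) * rprod d (fun i => tailC c (a_ i)).
have hC3 : 0 < C3.
  apply Rmult_lt_0_compat; first by apply rpow_gt0. apply rprod_gt0 => i hi. by apply tailC_gt0, ha.
exists (C3 + C2), (K1 + 1)%nat, c; split; first lra. split; first by rewrite /c; lia.
move=> n N f h x hf hN hK hh hfh.
have hN' : 0 < INR N by pos.
pose H u := rpow (h u) s.
have hH : forall u, 0 <= H u by move=> u; apply rpow_ge0.
pose A j := kavg d N g j x H.
have hA : forall j, 0 <= A j by move=> j; apply kavg_ge0.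
(* Its [p]-th power is [2^(-|j|) (A_j H)^(p/s)], the summand of [kavg_schur] for [P = p / s]. *)
exists (fun j => rpow (rprod d (fun i => / 2 ^ j i)) (/ p) * rpow (A j) (/ s)).
split; first pos.
split; last first.
  move=> J hJ.
  apply: Rle_trans (_ : _ <= C2 * lsum (ubox d N) (fun u => (/ INR N) ^ d * rpow (h u) p)) _; last first.
    apply Rmult_le_compat_r; last lra. apply lsum_ge0 => u _; apply Rmult_le_pos; last pos.
    pos.
  have hJN : forall j, (j < J)%nat -> 2 ^ j <= INR N.
    move=> j hj. rewrite -pow2_INR. apply le_INR.
    have : (2 ^ j <= 2 ^ (n + c))%nat by apply Nat.pow_le_mono_r; lia. nia.
  have := H2 N J x H hN hJN hH.
  have -> : lsum (ubox d N) (fun u => (/ INR N) ^ d * rpow (H u) P) = lsum (ubox d N) (fun u => (/ INR N) ^ d * rpow (h u) p).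
    apply lsum_ext => u _. rewrite /H rpow_rpow. do 2 f_equal. rewrite /P; field; lra.
  apply: Rle_trans. apply Req_le, lsum_ext => j _.
  rewrite rpow_mul ?rpow_rpow; try apply rpow_ge0.
  rewrite Rinv_l; last lra. rewrite rpow_1; last pos.
  do 2 f_equal. rewrite /P; field; lra.
move=> j.
pose t i l := if (j i <=? l + c)%nat then rpow 2 (- (a_ i * INR l)) else 0.
have ht : forall i l, 0 <= t i l by move=> i l; rewrite /t; case: (_ <=? _)%nat; [apply rpow_ge0|lra].
set Kj := rpow C1 (/ s) * rprod d (fun i => rpow 2 (- (INR (j i) * / s))) * rpow (A j) (/ s).
have hKj : 0 <= Kj.
  apply Rmult_le_pos; last by apply rpow_ge0. apply Rmult_le_pos; first by apply rpow_ge0.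
  apply rprod_ge0 => i _; apply rpow_ge0.
have hone : forall l, In l (ubox d n) -> Cmod (qop d L j (f l) x) <= Kj * rprod d (fun i => t i (l i)).
  move=> l hl.
  case: (forall_or_fail d (fun i => j i <=? l i + c)%nat) => [hall|[i [hi hfail]]]; last first.
    rewrite (qop_low d L j (fun i => c0 * 2 ^ l i)%nat (f l) x i hL (hf l hl) hi).
    - rewrite Cmod_C0. apply Rmult_le_pos => //. by apply rprod_ge0 => k _.
    - move: hfail => /Nat.leb_gt; rewrite /c; lia.
    - move: hfail => /Nat.leb_gt hfail.
      have e : (2 ^ (l i + (1 + c0)) <= 2 ^ (j i - 1 - L))%nat by apply Nat.pow_le_mono_r; rewrite /c in hfail; lia.
      rewrite Nat.pow_add_r in e. have h1 : (c0 < 2 ^ c0)%nat by apply Nat.pow_gt_lin_r; lia.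
      have h2 : (2 ^ l i <> 0)%nat by apply Nat.pow_nonzero. 
      have h3 : (2 ^ (1 + c0) = 2 * 2 ^ c0)%nat by [].
      nia.
  have hj : forall i, (i < d)%nat -> (j i <= l i + c)%nat by move=> i /hall /Nat.leb_le.
  have hK1 : forall i, (i < d)%nat -> (K1 * 2 ^ l i <= N)%nat.
    move=> i hi. have := mlist_in _ _ _ _ hl i hi => /in_seq h1.
    have : (2 ^ l i <= 2 ^ (n + c))%nat by apply Nat.pow_le_mono_r; lia. nia.
  have hb := H1 l j (f l) N x (hf l hl) hj hN hK1.
  (* The kernel of [qop_point_bound] is [2^(l - j)] times that of [A_j]. After the root of order
     [s], summation over [l_i >= j_i - c] turns [2^(-j_i / s) 2^(-a_i l_i)] into a multiple of
     [2^(-r_i j_i)]. *)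
  set V := rprod d (fun i => 2 ^ l i / 2 ^ j i) * rpow (rpow 2 (- dotR d r l)) s.
  have hV0 : 0 <= rprod d (fun i => 2 ^ l i / 2 ^ j i) by pos.
  have hV : 0 <= V by apply Rmult_le_pos => //; apply rpow_ge0.
  have hb2 : rpow (Cmod (qop d L j (f l) x)) s <= C1 * (V * A j).
    apply: Rle_trans hb _. mul_l.
    rewrite /A /kavg -lsum_scal. apply lsum_le => u _.
    have h1 : rpow (Cmod (f l (pt N u))) s <= rpow (rpow 2 (- dotR d r l)) s * H u.
      rewrite /H -rpow_mul; [|apply rpow_ge0|apply hh]. apply rpow_le; first lra. by apply hfh.
    have h2 : rprod d (fun i => 2 ^ l i / INR N * rpow (1 + 2 ^ j i * rho (x i - pt N u i)) (- g))
      = rprod d (fun i => 2 ^ l i / 2 ^ j i) * rprod d (fun i => 2 ^ j i / INR N * rpow (1 + 2 ^ j i * rho (x i - pt N u i)) (- g)).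
      rewrite -rprod_mul. apply rprod_ext => i _. have := pow2_pos (j i) => h3. field; lra.
    rewrite h2.
    have h3 : 0 <= rprod d (fun i => 2 ^ j i / INR N * rpow (1 + 2 ^ j i * rho (x i - pt N u i)) (- g)) by pos.
    have h4 := Rmult_le_compat_l _ _ _ (Rmult_le_pos _ _ hV0 h3) h1. rewrite /V. lra.
  have hnn : 0 <= C1 * (V * A j) by pos.
  have hroot := rpow_root_le _ _ s hs hnn hb2.
  apply: Rle_trans hroot _. apply Req_le.
  rewrite rpow_mul; [|lra|apply Rmult_le_pos; [exact hV|apply hA]].
  rewrite rpow_mul; [|exact hV|apply hA].
  rewrite /V rpow_mul //; last pos.
  rewrite !rpow_rpow Rinv_r ?Rmult_1_r; last lra.
  rewrite rpow2_dot_opp rprod_rpow; last pos.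
  rewrite /Kj -rprod_mul.
  have -> : rprod d (fun i => rpow (2 ^ l i / 2 ^ j i) (/ s) * rpow 2 (- (r i * INR (l i))))
    = rprod d (fun i => rpow 2 (- (INR (j i) * / s))) * rprod d (fun i => t i (l i)).
    rewrite -rprod_mul. apply rprod_ext => i hi. rewrite /t. have -> : (j i <=? l i + c)%nat = true by apply hall.
    have h2 := pow2_pos (l i). have h3 := pow2_pos (j i). have h4 := Rinv_0_lt_compat _ h3.
    rewrite /Rdiv rpow_mul; try lra. rewrite rpow_inv // !rpow2_INR_mul -!rpow_add. f_equal. rewrite /a_; ring.
  ring.
apply: Rle_trans (lsum_le _ _ _ hone) _.
rewrite lsum_scal (lsum_mlist_prod O d (fun _ => seq 0 n) t).
have hprod : rprod d (fun i => lsum (seq 0 n) (t i)) <= rprod d (fun i => tailC c (a_ i)) * rprod d (fun i => rpow 2 (- (a_ i * INR (j i)))).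
  rewrite -rprod_mul. apply rprod_le => i hi. split; first pos.
  apply (geometric_tail c (a_ i) n (j i) (ha i hi)).
apply: Rle_trans (Rmult_le_compat_l _ _ _ hKj hprod) _.
set Y := rprod d (fun i => rpow 2 (- (r i * INR (j i)))) * rpow (A j) (/ s).
have hY : 0 <= Y by apply Rmult_le_pos; [apply rprod_ge0 => i _|]; apply rpow_ge0.
have e1 : Kj * (rprod d (fun i => tailC c (a_ i)) * rprod d (fun i => rpow 2 (- (a_ i * INR (j i))))) = C3 * Y.
  rewrite /Kj /C3 /Y.
  have -> : rprod d (fun i => rpow 2 (- (r i * INR (j i)))) = rprod d (fun i => rpow 2 (- (INR (j i) * / s))) * rprod d (fun i => rpow 2 (- (a_ i * INR (j i)))).
    rewrite -rprod_mul; apply rprod_ext => i _. rewrite -rpow_add; f_equal; rewrite /a_; ring.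
  ring.
have e2 : rpow 2 (- dotR d (fun i => r i - 1 / p) j) * (rpow (rprod d (fun i => / 2 ^ j i)) (/ p) * rpow (A j) (/ s)) = Y.
  rewrite -Rmult_assoc /Y. f_equal. rewrite rpow2_dot_opp rprod_rpow; last pos.
  rewrite -rprod_mul. apply rprod_ext => i _. rewrite rpow_inv; last pos.
  rewrite rpow2_INR_mul -rpow_add. f_equal. field; lra.
rewrite e1 e2. apply Rmult_le_compat_r; lra.
Qed.

(** * The sum over the exceptional multi-indices *)

Definition above (t x : R) : R := match Rle_dec x t with left _ => 0 | right _ => 1 end.

Lemma above_01 t x : 0 <= above t x <= 1.
Proof. rewrite /above; case: Rle_dec => _; lra. Qed.

Lemma above_shift t x y : above t (x + y) = above (t - y) x.
Proof. rewrite /above; case: Rle_dec => h1; case: Rle_dec => h2 //; lra. Qed.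

Lemma dotR_S d w j a : dotR (S d) w (upd j d a) = dotR d w j + w d * INR a.
Proof.
rewrite /dotR rsum_S upd_eq. f_equal. apply rsum_ext => i hi. rewrite upd_neq //; lia.
Qed.

Definition tailsum (d J : nat) (al : R) (lam eta : nat -> R) (T : R) : R :=
  lsum (ubox d J) (fun j => above T (dotR d eta j) * rpow 2 (- (al * dotR d lam j))).

Lemma tailsum_S d J al lam eta T : tailsum (S d) J al lam eta T =
  rsum J (fun a => rpow 2 (- (al * lam d * INR a)) * tailsum d J al lam eta (T - eta d * INR a)).
Proof.
rewrite /tailsum /ubox lsum_mlist_S. apply lsum_ext => a _. rewrite -lsum_scal. apply lsum_ext => j _.
rewrite !dotR_S above_shift. rewrite Rmult_left_comm -rpow_add. do 2 f_equal. ring.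
Qed.

Lemma rsum_initial J m X : 0 <= X -> rsum J (fun a => if (a <=? m)%nat then X else 0) <= (INR m + 1) * X.
Proof.
move=> hX. rewrite -S_INR.
have H : forall J, rsum J (fun a => if (a <=? m)%nat then X else 0) <= INR (min J (S m)) * X.
  elim => [|n IH]; first pos.
  rewrite rsum_S. case: (Nat.leb_spec n m) => h.
    have -> : Nat.min (S n) (S m) = S n by lia. rewrite S_INR. move: IH. have -> : Nat.min n (S m) = n by lia. nra.
  move: IH. have -> : Nat.min n (S m) = S m by lia. have -> : Nat.min (S n) (S m) = S m by lia. lra.
apply: Rle_trans (H J) _. apply Rmult_le_compat_r => //. apply le_INR; lia.
Qed.

(** Induction on [d], adding the last variable. Each variable with [lam = eta], except the first,
    contributes a factor [m]; a variable with [eta < lam] contributes a convergent series. The bound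
    [B], valid for all [T], takes care of large values of the new index. *)
Lemma tailsum_bound d mu al l0 lam eta : (1 <= mu)%nat -> 0 < al -> 0 < l0 ->
  (forall i, (i < mu)%nat -> lam i = l0 /\ eta i = l0) ->
  (forall i, (mu <= i)%nat -> (i < d)%nat -> 0 < eta i < lam i) -> (1 <= d)%nat ->
  exists C B, 0 < C /\ 0 < B /\ forall J m, (1 <= m)%nat -> (forall T, tailsum d J al lam eta T <= B) /\
   forall T, T <= l0 * INR m ->
    tailsum d J al lam eta T <= C * INR m ^ (min d mu - 1) * rpow 2 (- (al * T)).
Proof.
move=> hmu hal hl0 hlow; elim: d => [|d IH] hhigh hd; first lia.
have hlam : 0 < lam d.
  case: (Nat.lt_ge_cases d mu) => h; first by have [-> _] := hlow d h.
  have := hhigh d h ltac:(lia); lra.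
have hald : 0 < al * lam d by pos.
case: (Nat.eq_dec d 0) => [e0|hd0].
  subst d. have [e1 e2] := hlow O hmu.
  have e : forall J T, tailsum 1 J al lam eta T = rsum J (fun a => rpow 2 (- (al * l0 * INR a)) * above T (l0 * INR a)).
    move=> J T. rewrite tailsum_S. apply rsum_ext => a _. rewrite e1 e2. f_equal.
    rewrite /tailsum /= lsum_cons lsum_nil /dotR /rsum /= Rmult_0_r Ropp_0 rpow_exp0; last lra.
    rewrite -above_shift Rplus_0_l; ring.
  rewrite e1 in hald.
  have ht := tailC_gt0 0 _ hald.
  have key : forall J T (j : nat), (forall a : nat, T < l0 * INR a -> (j <= a)%nat) ->
     tailsum 1 J al lam eta T <= tailC 0 (al * l0) * rpow 2 (- (al * l0 * INR j)).
    move=> J T j hj. rewrite e. apply: Rle_trans (geometric_tail 0 (al * l0) J j hald).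
    apply rsum_le => a _. have hp := rpow_ge0 2 (- (al * l0 * INR a)).
    rewrite /above; case: Rle_dec => h.
      case: (_ <=? _)%nat; lra.
    have -> : (j <=? a + 0)%nat = true by apply Nat.leb_le; rewrite Nat.add_0_r; apply hj; lra. lra.
  exists (tailC 0 (al * l0) * rpow 2 (al * l0)), (tailC 0 (al * l0)).
  split; first pos. split=> // J m hm. split=> T.
    have := key J T O (fun a _ => Nat.le_0_l a). rewrite [INR 0]/= Rmult_0_r Ropp_0 rpow_exp0; lra.
  move=> hT. have -> : (Nat.min 1 mu - 1 = 0)%nat by lia. rewrite pow_O Rmult_1_r.
  (* Rounding [T / l0] down loses at most one index, paid for by [2^(al l0)]; for negative [T] the
     conversion to [nat] gives 0, still a valid lower bound. *)
  have [b1 b2] := base_Int_part (T / l0).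
  have eT : T = T / l0 * l0 by field; lra.
  have hj : forall a : nat, T < l0 * INR a -> (Z.to_nat (Int_part (T / l0)) <= a)%nat.
    move=> a ha. have : IZR (Int_part (T / l0)) < INR a by nra.
    rewrite INR_IZR_INZ => /lt_IZR; lia.
  apply: Rle_trans (key J T _ hj) _. rewrite (Rmult_assoc (tailC 0 (al * l0))). mul_l.
  rewrite -rpow_add. apply rpow_exp_le; first lra.
  have h3 : T / l0 - 1 <= INR (Z.to_nat (Int_part (T / l0))).
    have : IZR (Int_part (T / l0)) <= INR (Z.to_nat (Int_part (T / l0))) by rewrite INR_IZR_INZ; apply IZR_le; lia.
    lra.
  have h4 : T - l0 <= l0 * INR (Z.to_nat (Int_part (T / l0))) by nra.
  have := Rmult_le_compat_l al _ _ ltac:(lra) h4. lra.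
have [C [B [hC [hB H]]]] := IH (fun i h1 h2 => hhigh i h1 ltac:(lia)) ltac:(lia).
have htd := tailC_gt0 0 _ hald.
have hBtot : forall J m, (1 <= m)%nat -> forall T, tailsum (S d) J al lam eta T <= B * tailC 0 (al * lam d).
  move=> J m hm T. rewrite tailsum_S.
  apply: Rle_trans (_ : _ <= rsum J (fun a => B * (if (0 <=? a + 0)%nat then rpow 2 (- (al * lam d * INR a)) else 0))) _.
    apply rsum_le => a _. have [h _] := H J m hm. have hp := rpow_ge0 2 (- (al * lam d * INR a)).
    have := Rmult_le_compat_l _ _ _ hp (h (T - eta d * INR a)). rewrite [(0 <=? _)%nat]/=; lra.
  rewrite rsum_scal. mul_l.
  have h0 := geometric_tail 0 (al * lam d) J 0 hald. rewrite [INR 0]/= Rmult_0_r Ropp_0 rpow_exp0 in h0; last lra.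
  apply: Rle_trans h0 _; lra.
have hBpos : 0 < B * tailC 0 (al * lam d) by pos.
case: (Nat.lt_ge_cases d mu) => hdmu.
  have [e1 e2] := hlow d hdmu.
  exists (2 * C + B * tailC 0 (al * lam d)), (B * tailC 0 (al * lam d)).
  split; first lra. split=> // J m hm. split; first exact: (hBtot J m hm).
  move=> T hT. rewrite tailsum_S.
  have hm1 : 1 <= INR m by rewrite -INR_1; apply le_INR.
  have [h1 h2] := H J m hm.
  have ee : (Nat.min (S d) mu - 1 = S (Nat.min d mu - 1))%nat by lia.
  set X := C * INR m ^ (Nat.min d mu - 1) * rpow 2 (- (al * T)).
  have hX : 0 <= X by apply Rmult_le_pos; [apply Rmult_le_pos; [lra|apply pow_le; lra]|apply rpow_ge0].
  (* For [lam_d = eta_d] the loss in [T] cancels the gain from the index, so each [a <= m]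
     contributes the same [X], which produces the new power of [m]. Beyond [m] the crude bound and
     the geometric tail suffice. *)
  apply: Rle_trans (_ : _ <= rsum J (fun a => (if (a <=? m)%nat then X else 0) + B * (if (m <=? a + 0)%nat then rpow 2 (- (al * lam d * INR a)) else 0))) _.
    apply rsum_le => a _. have hp := rpow_ge0 2 (- (al * lam d * INR a)). have ha := pos_INR a.
    case: (Nat.leb_spec a m) => h.
      have h3 := h2 (T - eta d * INR a) ltac:(rewrite e2; nra).
      have h4 : rpow 2 (- (al * lam d * INR a)) * tailsum d J al lam eta (T - eta d * INR a) <= X.
        apply: Rle_trans (Rmult_le_compat_l _ _ _ hp h3) _. rewrite /X Rmult_left_comm -rpow_add e1 e2.
        apply Req_le. do 2 f_equal. ring.
      have : 0 <= B * (if (m <=? a + 0)%nat then rpow 2 (- (al * lam d * INR a)) else 0).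
        apply Rmult_le_pos; first lra. case: (_ <=? _)%nat => //; lra.
      lra.
    have -> : (m <=? a + 0)%nat = true by apply Nat.leb_le; lia.
    have := Rmult_le_compat_l _ _ _ hp (h1 (T - eta d * INR a)). lra.
  rewrite rsum_plus rsum_scal.
  have g1 := rsum_initial J m X hX. have g2 := geometric_tail 0 (al * lam d) J m hald.
  have g3 : rpow 2 (- (al * lam d * INR m)) <= rpow 2 (- (al * T)).
    apply rpow_exp_le; first lra. rewrite e1. nra.
  have g4 : B * (tailC 0 (al * lam d) * rpow 2 (- (al * lam d * INR m))) <= B * tailC 0 (al * lam d) * (INR m ^ (Nat.min (S d) mu - 1) * rpow 2 (- (al * T))).
    rewrite -Rmult_assoc. mul_l.
    have : 1 <= INR m ^ (Nat.min (S d) mu - 1) by apply pow_R1_Rle.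
    have := rpow_ge0 2 (- (al * T)). nra.
  have g5 : (INR m + 1) * X <= 2 * C * (INR m ^ (Nat.min (S d) mu - 1) * rpow 2 (- (al * T))).
    rewrite ee [INR m ^ S _]/=.
    replace (2 * C * (INR m * INR m ^ (Nat.min d mu - 1) * rpow 2 (- (al * T)))) with (2 * INR m * X) by (rewrite /X; ring).
    apply Rmult_le_compat_r; lra.
  have := Rmult_le_compat_l B _ _ ltac:(lra) g2. lra.
have [he1 he2] := hhigh d hdmu ltac:(lia).
have hdif : 0 < al * (lam d - eta d) by pos.
have htd2 := tailC_gt0 0 _ hdif.
exists (C * tailC 0 (al * (lam d - eta d))), (B * tailC 0 (al * lam d)).
split; first pos. split=> // J m hm. split; first exact: (hBtot J m hm).
move=> T hT. rewrite tailsum_S.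
have [_ h2] := H J m hm.
have -> : (Nat.min (S d) mu = Nat.min d mu)%nat by lia.
(* The gap leaves [2^(- al (lam_d - eta_d) a)], summable over [a], so the power of [m] does not
   increase. *)
apply: Rle_trans (_ : _ <= rsum J (fun a => C * INR m ^ (Nat.min d mu - 1) * rpow 2 (- (al * T)) * (if (0 <=? a + 0)%nat then rpow 2 (- (al * (lam d - eta d) * INR a)) else 0))) _.
  apply rsum_le => a _. have hp := rpow_ge0 2 (- (al * lam d * INR a)). have ha := pos_INR a.
  have h3 := h2 (T - eta d * INR a) ltac:(nra).
  apply: Rle_trans (Rmult_le_compat_l _ _ _ hp h3) _. rewrite [(0 <=? _)%nat]/=.
  rewrite Rmult_left_comm -rpow_add (Rmult_assoc (C * _)) -rpow_add. apply Req_le. do 2 f_equal. ring.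
rewrite rsum_scal.
have g := geometric_tail 0 (al * (lam d - eta d)) J 0 hdif. rewrite [INR 0]/= Rmult_0_r Ropp_0 rpow_exp0 in g; last lra.
have hc : 0 <= C * INR m ^ (Nat.min d mu - 1) * rpow 2 (- (al * T)) by pos.
apply: Rle_trans (Rmult_le_compat_l _ _ _ hc g) _. lra.
Qed.

(** For [p <= 1] the embedding of [l^p] into [l^1] suffices and no power of [m] arises. For [p > 1]
    Hoelder's inequality meets [tailsum_bound] with the conjugate exponent [p'], and the power
    [1 - 1/p] of the tail sum gives the exponent of [m]. *)
Lemma outer_sum_bound d mu p l0 lam eta : (1 <= mu)%nat -> (mu <= d)%nat -> 0 < p -> 0 < l0 ->
  (forall i, (i < mu)%nat -> lam i = l0 /\ eta i = l0) ->
  (forall i, (mu <= i)%nat -> (i < d)%nat -> 0 < eta i < lam i) ->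
  exists C, 0 < C /\ forall J m a, (1 <= m)%nat -> (forall j, 0 <= a j) ->
  lsum (ubox d J) (fun j => above (l0 * INR m) (dotR d eta j) * (rpow 2 (- dotR d lam j) * a j))
  <= C * rpow (INR m) ((INR mu - 1) * Rmax (1 - 1 / p) 0) * rpow 2 (- INR m * l0) * rpow (lsum (ubox d J) (fun j => rpow (a j) p)) (/ p).
Proof.
move=> hmu hmud hp hl0 hlow hhigh.
case: (Rle_dec p 1) => hp1.
  exists 1; split; first lra. move=> J m a hm ha.
  have hm1 : 1 <= INR m by rewrite -INR_1; apply le_INR.
  have hip : 1 <= 1 / p by apply Rmult_le_reg_r with p => //; unfold Rdiv; rewrite Rmult_assoc Rinv_l; lra.
  rewrite Rmax_right ?Rmult_0_r; last lra. rewrite rpow_exp0 ?Rmult_1_l; last lra.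
  apply: Rle_trans (_ : _ <= rpow 2 (- INR m * l0) * lsum (ubox d J) a) _.
    rewrite -lsum_scal. apply lsum_le => j _. rewrite -Rmult_assoc. apply Rmult_le_compat_r => //.
    rewrite /above; case: Rle_dec => h; first by rewrite Rmult_0_l; apply rpow_ge0.
    rewrite Rmult_1_l. apply rpow_exp_le; first lra.
    have : dotR d eta j <= dotR d lam j; last nra.
    apply rsum_le => i hi. mul_r.
    case: (Nat.lt_ge_cases i mu) => hi'; first by have [-> ->] := hlow i hi'; lra.
    have := hhigh i hi' hi; lra.
  mul_l.
  apply rpow_root_le => //; first pos.
  apply lsum_rpow_sub => //; lra.
set p' := p / (p - 1).
have hp' : 0 < p' by apply Rdiv_lt_0_compat; lra.
have [C [B [hC [hB H]]]] := tailsum_bound d mu p' l0 lam eta hmu hp' hl0 hlow hhigh ltac:(lia).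
exists (rpow C (1 - 1 / p)); split; first pos.
move=> J m a hm ha.
have hm1 : 1 <= INR m by rewrite -INR_1; apply le_INR.
have [_ h2] := H J m hm. have {}h2 := h2 (l0 * INR m) (Rle_refl _).
have hip : 1 / p < 1 by apply Rmult_lt_reg_r with p => //; unfold Rdiv; rewrite Rmult_assoc Rinv_l; lra.
rewrite Rmax_left; last lra.
(* Split so that [w b] is the given summand while [w b^p] equals [a^p] on the exceptional set, by
   [(p' - 1) p = p']. *)
pose w j := above (l0 * INR m) (dotR d eta j) * rpow 2 (- (p' * dotR d lam j)).
pose b j := rpow 2 ((p' - 1) * dotR d lam j) * a j.
have hw : forall j, 0 <= w j.
  move=> j; apply Rmult_le_pos; [by have := above_01 (l0 * INR m) (dotR d eta j); lra|apply rpow_ge0].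
have hb : forall j, 0 <= b j by move=> j; apply Rmult_le_pos => //; apply rpow_ge0.
set S := lsum (ubox d J) (fun j => rpow (a j) p).
have hS : 0 <= S by apply lsum_ge0 => j _; apply rpow_ge0.
have -> : lsum (ubox d J) (fun j => above (l0 * INR m) (dotR d eta j) * (rpow 2 (- dotR d lam j) * a j)) = lsum (ubox d J) (fun j => w j * b j).
  apply lsum_ext => j _. rewrite /w /b. 
  have -> : rpow 2 (- dotR d lam j) = rpow 2 (- (p' * dotR d lam j)) * rpow 2 ((p' - 1) * dotR d lam j).
    rewrite -rpow_add; f_equal; ring.
  ring.
have hj := jensen (ubox d J) w b p ltac:(lra) (fun j _ => hw j) (fun j _ => hb j).
have hS2 : lsum (ubox d J) (fun j => w j * rpow (b j) p) <= S.
  apply lsum_le => j _. rewrite /w /b rpow_mul //; last pos.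
  rewrite rpow_rpow.
  have hab := above_01 (l0 * INR m) (dotR d eta j). have hap := rpow_ge0 (a j) p.
  replace (above (l0 * INR m) (dotR d eta j) * rpow 2 (- (p' * dotR d lam j)) * (rpow 2 ((p' - 1) * dotR d lam j * p) * rpow (a j) p))
    with (above (l0 * INR m) (dotR d eta j) * (rpow 2 (- (p' * dotR d lam j)) * rpow 2 ((p' - 1) * dotR d lam j * p)) * rpow (a j) p) by ring.
  rewrite -rpow_add.
  have -> : - (p' * dotR d lam j) + (p' - 1) * dotR d lam j * p = 0 by rewrite /p'; field; lra.
  rewrite rpow_exp0; last lra. nra.
have hW : lsum (ubox d J) w <= C * INR m ^ (mu - 1) * rpow 2 (- (p' * (l0 * INR m))).
  move: h2. have -> : (Nat.min d mu = mu)%nat by lia. by [].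
have hfin : rpow (lsum (ubox d J) (fun j => w j * b j)) p <= rpow (C * INR m ^ (mu - 1) * rpow 2 (- (p' * (l0 * INR m)))) (p - 1) * S.
  apply: Rle_trans hj _. apply Rmult_le_compat => //; first pos.
    pos.
  apply rpow_le; lra.
have hr := rpow_root_le _ _ p hp (Rmult_le_pos _ _ (rpow_ge0 _ _) hS) hfin.
apply: Rle_trans hr _. apply Req_le.
rewrite rpow_mul //; last pos. f_equal.
rewrite rpow_rpow.
have e1 : (p - 1) * / p = 1 - 1 / p by field; lra.
rewrite e1 rpow_mul; [|apply Rmult_le_pos; [lra|apply pow_le; lra]|apply rpow_ge0].
rewrite rpow_mul; [|lra|apply pow_le; lra].
rewrite rpow_rpow. f_equal; last first.
  f_equal. rewrite /p'; field; lra.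
f_equal. rewrite -rpow_nat; last lra. rewrite rpow_rpow minus_INR // INR_1.
Qed.

(** * Riemann sums of continuous functions *)

Definition depends (d : nat) {T : Type} (g : (nat -> R) -> T) : Prop :=
  forall x y, (forall i, (i < d)%nat -> x i = y i) -> g x = g y.

Definition tcont (d : nat) (g : (nat -> R) -> R) : Prop :=
  depends d g /\
  forall x eps, 0 < eps -> exists del, 0 < del /\
    forall y, (forall i, (i < d)%nat -> Rabs (y i - x i) < del) -> Rabs (g y - g x) < eps.

Lemma tcont_comp d g h : tcont d g ->
  (forall x eps, 0 < eps -> exists del, 0 < del /\ forall y, Rabs (g y - g x) < del -> Rabs (h (g y) - h (g x)) < eps) ->
  tcont d (fun x => h (g x)).
Proof.
move=> [h1 h2] h3; split; first by move=> x y /h1 ->.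
move=> x eps he. have [del [hd H]] := h3 x eps he. have [del' [hd' H']] := h2 x del hd.
exists del'; split=> // y /H'; exact: H.
Qed.

Lemma tcont_comp_cont d g h : tcont d g -> continuity h -> tcont d (fun x => h (g x)).
Proof.
move=> hg hh; apply tcont_comp => // x eps he.
have [al [hal H]] := hh (g x) eps he.
exists al; split=> // y hy.
case: (Req_dec (g y) (g x)) => e; first by rewrite e Rminus_diag Rabs_R0.
apply H; split=> //. by split=> //; apply not_eq_sym.
Qed.

Lemma tcont_const d c : tcont d (fun _ => c).
Proof. split=> // x eps he; exists 1; split; [lra|move=> y _]; by rewrite Rminus_diag Rabs_R0. Qed.

Lemma tcont_coord d i : (i < d)%nat -> tcont d (fun x => x i).
Proof. move=> hi; split; first by move=> x y; apply. move=> x eps he; exists eps; split=> // y; by apply. Qed.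

Lemma tcont_plus d g h : tcont d g -> tcont d h -> tcont d (fun x => g x + h x).
Proof.
move=> [g1 g2] [h1 h2]; split; first by move=> x y e; rewrite (g1 x y e) (h1 x y e).
move=> x eps he. have [d1 [p1 H1]] := g2 x (eps / 2) ltac:(lra). have [d2 [p2 H2]] := h2 x (eps / 2) ltac:(lra).
exists (Rmin d1 d2); split; first by apply Rmin_glb_lt.
move=> y hy. replace (g y + h y - (g x + h x)) with ((g y - g x) + (h y - h x)) by ring.
apply: Rle_lt_trans (Rabs_triang _ _) _.
have := H1 y (fun i hi => Rlt_le_trans _ _ _ (hy i hi) (Rmin_l _ _)).
have := H2 y (fun i hi => Rlt_le_trans _ _ _ (hy i hi) (Rmin_r _ _)). lra.
Qed.

Lemma tcont_ext d g h : (forall x, g x = h x) -> tcont d g -> tcont d h.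
Proof. by move=> e; rewrite (functional_extensionality g h e). Qed.

Lemma tcont_scal d c g : tcont d g -> tcont d (fun x => c * g x).
Proof. move=> hg; apply (tcont_comp_cont d g (fun t => c * t) hg). reg. Qed.

(** Polarisation: with squares available, composition with functions of one variable is enough. *)
Lemma tcont_mult d g h : tcont d g -> tcont d h -> tcont d (fun x => g x * h x).
Proof.
move=> hg hh.
have sq : forall g, tcont d g -> tcont d (fun x => Rsqr (g x)).
  move=> k hk; apply tcont_comp_cont => //. exact (derivable_continuous _ derivable_Rsqr).
apply (tcont_ext d (fun x => / 4 * (Rsqr (g x + h x) + -1 * Rsqr (g x + -1 * h x)))).
  move=> x; rewrite /Rsqr; field.
apply tcont_scal, tcont_plus; first by apply sq, tcont_plus.
apply tcont_scal, sq, tcont_plus => //. by apply tcont_scal.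
Qed.

Lemma tcont_lsum {A} d (l : list A) (F : A -> (nat -> R) -> R) : (forall a, In a l -> tcont d (F a)) ->
  tcont d (fun x => lsum l (fun a => F a x)).
Proof.
elim: l => [|a l IH] h; first exact: (tcont_const d 0).
apply (tcont_ext d (fun x => F a x + lsum l (fun a => F a x))) => //.
apply tcont_plus; first by apply h; left. by apply IH => b hb; apply h; right.
Qed.

(** Where [g] vanishes [Rpower] is of no use, and [eps^(1/a)] serves as the tolerance on [g];
    elsewhere the power is differentiable. *)
Lemma tcont_rpow d g a : 0 < a -> (forall x, 0 <= g x) -> tcont d g -> tcont d (fun x => rpow (g x) a).
Proof.
move=> ha hg hc; apply (tcont_comp d g (fun z => rpow z a)) => // x eps he.
case: (Rle_dec (g x) 0) => h0.
  have e0 : g x = 0 by have := hg x; lra.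
  exists (rpow eps (/ a)); split; first pos.
  move=> y. rewrite e0 Rminus_0_r (rpow_0 0) ?Rminus_0_r; last lra.
  rewrite !Rabs_pos_eq //; last pos.
  move=> h. have : rpow (g y) a < rpow (rpow eps (/ a)) a by apply rpow_lt.
  rewrite rpow_rpow Rinv_l ?rpow_1; lra.
have hp : 0 < g x by lra.
have hcont : continuity_pt (fun z => Rpower z a) (g x).
  apply derivable_continuous_pt. exists (a * Rpower (g x) (a - 1)). by apply derivable_pt_lim_power.
have [al [hal H]] := hcont eps he.
exists (Rmin al (g x)); split; first by apply Rmin_glb_lt.
move=> y hy. have hy1 := Rlt_le_trans _ _ _ hy (Rmin_l _ _). have hy2 := Rlt_le_trans _ _ _ hy (Rmin_r _ _).
have hgy : 0 < g y by apply Rabs_def2 in hy2; lra.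
rewrite !rpow_Rpower //.
case: (Req_dec (g y) (g x)) => e; first by rewrite e Rminus_diag Rabs_R0.
apply H; split=> //. by split=> //; apply not_eq_sym.
Qed.

Lemma tcont_sqrt d g : (forall x, 0 <= g x) -> tcont d g -> tcont d (fun x => sqrt (g x)).
Proof.
move=> hg hc. apply (tcont_ext d (fun x => rpow (g x) (/ 2))).
  move=> x. case: (Rle_dec (g x) 0) => h.
    have -> : g x = 0 by have := hg x; lra. rewrite sqrt_0 rpow_0 //; lra.
  rewrite rpow_Rpower; last lra. rewrite Rpower_sqrt //; lra.
apply tcont_rpow => //; lra.
Qed.

Definition ccont (d : nat) (f : (nat -> R) -> Cx) : Prop :=
  tcont d (fun x => fst (f x)) /\ tcont d (fun x => snd (f x)).

Lemma ccont_ext d f g : (forall x, f x = g x) -> ccont d f -> ccont d g.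
Proof. by move=> e; rewrite (functional_extensionality f g e). Qed.

Lemma ccont_const d c : ccont d (fun _ => c).
Proof. split; exact: tcont_const. Qed.

Lemma ccont_mul d f g : ccont d f -> ccont d g -> ccont d (fun x => Cmul (f x) (g x)).
Proof.
move=> [f1 f2] [g1 g2]; split => /=.
  apply (tcont_ext d (fun x => fst (f x) * fst (g x) + -1 * (snd (f x) * snd (g x)))); first by move=> x; ring.
  apply tcont_plus; first by apply tcont_mult. by apply tcont_scal, tcont_mult.
by apply tcont_plus; apply tcont_mult.
Qed.

Lemma ccont_lsumC {A} d (l : list A) (F : A -> (nat -> R) -> Cx) : (forall a, In a l -> ccont d (F a)) ->
  ccont d (fun x => lsumC l (fun a => F a x)).
Proof.
move=> h; split.
  apply (tcont_ext d (fun x => lsum l (fun a => fst (F a x)))); first by move=> x; rewrite lsumC_pair.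
  apply (tcont_lsum d l (fun a x => fst (F a x))) => a /h; by case.
apply (tcont_ext d (fun x => lsum l (fun a => snd (F a x)))); first by move=> x; rewrite lsumC_pair.
apply (tcont_lsum d l (fun a x => snd (F a x))) => a /h; by case.
Qed.

Lemma ccont_Cexpi d g : tcont d g -> ccont d (fun x => Cexpi (g x)).
Proof.
move=> hg; split; [exact: (tcont_comp_cont d g cos hg continuity_cos)|exact: (tcont_comp_cont d g sin hg continuity_sin)].
Qed.

Lemma ccont_cprod d n (F : nat -> (nat -> R) -> Cx) : (forall i, (i < n)%nat -> ccont d (F i)) ->
  ccont d (fun x => cprod n (fun i => F i x)).
Proof.
elim: n => [|n IH] h; first exact: (ccont_const d C1).
apply (ccont_ext d (fun x => Cmul (cprod n (fun i => F i x)) (F n x))); first by move=> x; rewrite cprod_S.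
apply ccont_mul; last by apply h; lia. apply IH => i hi; apply h; lia.
Qed.

Lemma tcont_Cmod d f : ccont d f -> tcont d (fun x => Cmod (f x)).
Proof.
move=> [h1 h2]. apply (tcont_sqrt d (fun x => fst (f x) ^ 2 + snd (f x) ^ 2)); first by move=> x; nra.
apply tcont_plus.
  apply (tcont_ext d (fun x => fst (f x) * fst (f x))); first by move=> x; ring. by apply tcont_mult.
apply (tcont_ext d (fun x => snd (f x) * snd (f x))); first by move=> x; ring. by apply tcont_mult.
Qed.

Lemma ccont_tpoly d D g : tpoly d D g -> ccont d g.
Proof.
move=> [l [_ h]]. apply (ccont_ext d _ _ (fun x => eq_sym (h x))).
apply (ccont_lsumC d l (fun q y => Cmul (snd q) (cprod d (fun i => Cexpi (IZR (fst q i) * y i))))) => q _.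
apply ccont_mul; first exact: ccont_const.
apply (ccont_cprod d d (fun i y => Cexpi (IZR (fst q i) * y i))) => i hi.
apply ccont_Cexpi, tcont_scal. by apply tcont_coord.
Qed.

Lemma ccont_torus d f : torus_fun d f -> ccont d f.
Proof.
move=> [h1 [_ h2]]; split; split; try by move=> x y e; rewrite (h1 x y e).
  move=> x eps he. have [del [hd H]] := h2 x eps he. exists del; split=> // y /H h.
  exact: Rle_lt_trans (fst_le_Cmod (Csub (f y) (f x))) h.
move=> x eps he. have [del [hd H]] := h2 x eps he. exists del; split=> // y /H h.
exact: Rle_lt_trans (snd_le_Cmod (Csub (f y) (f x))) h.
Qed.

Lemma ccont_kdot d k : ccont d (fun x => Cexpi (- kdot d k x)).
Proof.
apply ccont_Cexpi. apply (tcont_ext d (fun x => -1 * lsum (seq 0 d) (fun i => IZR (k i) * x i))).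
  move=> x; rewrite /kdot rsum_lsum; ring.
apply tcont_scal, (tcont_lsum d (seq 0 d) (fun i x => IZR (k i) * x i)) => i /in_seq hi.
apply tcont_scal, tcont_coord; lia.
Qed.

(** Passage between coordinate functions and the nested tuples for which Coquelicot states the
    compactness of boxes. *)
Fixpoint toT (n : nat) (x : nat -> R) : Coquelicot.Compactness.Tn n R :=
  match n with O => tt | S n' => (x n', toT n' x) end.
Fixpoint ofT (n : nat) : Coquelicot.Compactness.Tn n R -> nat -> R :=
  match n with O => fun _ _ => 0 | S n' => fun t => upd (ofT n' (snd t)) n' (fst t) end.

Lemma bounded_toT n x a b : (forall i, (i < n)%nat -> a <= x i <= b) ->
  Coquelicot.Compactness.bounded_n n (toT n (fun _ => a)) (toT n (fun _ => b)) (toT n x).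
Proof. elim: n => [//|n IH] h /=; split; [apply h; lia|apply IH => i hi; apply h; lia]. Qed.

Lemma close_toT n d x t : Coquelicot.Compactness.close_n n d (toT n x) t ->
  forall i, (i < n)%nat -> Rabs (x i - ofT n t i) < d.
Proof.
elim: n t => [|n IH] t; first by move=> _ i; lia.
case: t => t1 t2 /= [h1 h2] i hi.
case: (Nat.eq_dec i n) => [->|hne]; first by rewrite upd_eq.
rewrite upd_neq //; apply IH => //; lia.
Qed.

(** Lebesgue number argument with halved radii: a point near [x] is then still within the full
    radius of the centre that covers [x]. Only [x] has to lie in the cube. *)
Lemma uniform_continuity_cube d g a b eps : tcont d g -> 0 < eps -> exists del, 0 < del /\
  forall x y, (forall i, (i < d)%nat -> a <= x i <= b) -> (forall i, (i < d)%nat -> Rabs (y i - x i) < del) ->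
    Rabs (g y - g x) < eps.
Proof.
move=> [_ hg] he.
have H : forall t, {del : R | 0 < del /\ forall y, (forall i, (i < d)%nat -> Rabs (y i - t i) < del) -> Rabs (g y - g t) < eps / 2}.
  move=> t. apply constructive_indefinite_description, hg; lra.
pose dl t := proj1_sig (H t).
have hdl : forall t, 0 < dl t / 2 by move=> t; have [h _] := proj2_sig (H t); rewrite /dl; lra.
pose delta t := mkposreal _ (hdl (ofT d t)).
have [del hdel] := Coquelicot.Compactness.compactness_value d (toT d (fun _ => a)) (toT d (fun _ => b)) delta.
exists (pos del); split; first exact: cond_pos.
(* [compactness_value] yields the covering centre only under a double negation, hence the argument
   by contradiction. *)
move=> x y hx hy. apply Rnot_le_lt => hcon.
apply (hdel (toT d x) (bounded_toT d x a b hx)) => -[t [_ [hc hd]]].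
have hxt := close_toT d _ x t hc. rewrite /delta /= in hd hxt.
have [_ hH] := proj2_sig (H (ofT d t)). rewrite -/(dl _) in hH.
have hp := hdl (ofT d t).
have e1 : Rabs (g x - g (ofT d t)) < eps / 2.
  apply hH => i hi. have := hxt i hi. lra.
have e2 : Rabs (g y - g (ofT d t)) < eps / 2.
  apply hH => i hi. have h1 := hy i hi. have h2 := hxt i hi.
  replace (y i - ofT d t i) with ((y i - x i) + (x i - ofT d t i)) by ring.
  apply: Rle_lt_trans (Rabs_triang _ _) _. lra.
have : Rabs (g y - g x) <= Rabs (g y - g (ofT d t)) + Rabs (g x - g (ofT d t)).
  rewrite -(Rabs_Ropp (g x - _)). replace (g y - g x) with ((g y - g (ofT d t)) + - (g x - g (ofT d t))) by ring.
  apply Rabs_triang.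
lra.
Qed.

Lemma lsum_ubox_split d A B F : lsum (ubox d (A * B)) F =
  lsum (ubox d A) (fun u => lsum (ubox d B) (fun v => F (fun i => (u i * B + v i)%nat))).
Proof.
elim: d F => [|d IH] F; first by rewrite /lsum /= !Rplus_0_r.
rewrite /ubox !lsum_mlist_S.
have split1 : forall G : nat -> R, lsum (seq 0 (A * B)) G = lsum (seq 0 A) (fun a => lsum (seq 0 B) (fun b => G (a * B + b)%nat)).
  move=> G. elim: A {IH} => [//|A IHA]. rewrite seq_S lsum_app lsum_cons lsum_nil -IHA Rplus_0_r.
  replace (S A * B)%nat with (A * B + B)%nat by lia. rewrite seq_app lsum_app. f_equal.
  have h : forall n s, seq s n = map (fun a => (s + a)%nat) (seq 0 n).
    elim => [//|n IHn] s. rewrite !seq_S map_app -IHn /=. do 3 f_equal; lia.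
  by rewrite (h B (0 + A * B)%nat) lsum_map.
rewrite split1. apply lsum_ext => a _.
transitivity (lsum (seq 0 B) (fun b => lsum (ubox d A) (fun u => lsum (ubox d B) (fun v => F (upd (fun i => (u i * B + v i)%nat) d (a * B + b)%nat))))).
  by apply lsum_ext => b _; rewrite -/(ubox d _) IH.
rewrite lsum_exch. apply lsum_ext => u _. rewrite lsum_mlist_S. apply lsum_ext => b _. apply lsum_ext => v _.
f_equal. apply functional_extensionality => i. rewrite /upd. by case: (Nat.eqb i d).
Qed.

(** An average, that is, a Riemann sum for normalised measure: the form in which [kavg_schur]
    returns its right-hand side. *)
Definition riem (d : nat) (g : (nat -> R) -> R) (n : nat) : R :=
  lsum (ubox d (2 ^ n)) (fun u => (/ INR (2 ^ n)) ^ d * g (pt (2 ^ n) u)).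

Lemma length_ubox d N : INR (length (ubox d N)) = INR N ^ d.
Proof.
have := lsum_const (ubox d N) 1. rewrite Rmult_1_r => <-.
rewrite (lsum_ext _ _ (fun j : nat -> nat => rprod d (fun _ => 1))); last by move=> j _; rewrite rprod_const pow1.
rewrite (lsum_mlist_prod O d (fun _ => seq 0 N) (fun _ _ => 1)) lsum_const length_seq rprod_const Rmult_1_r //.
Qed.

Lemma lsum_ubox_avg d N c : (0 < N)%nat -> lsum (ubox d N) (fun _ => (/ INR N) ^ d * c) = c.
Proof.
move=> hN. have h : 0 < INR N by pos.
rewrite lsum_const length_ubox -Rmult_assoc -Rpow_mult_distr Rinv_r ?pow1; lra.
Qed.

Lemma node_range N c : (c < N)%nat -> - PI <= node (- PI) N c <= PI.
Proof.
move=> hc. have hN : 0 < INR N by apply lt_0_INR; lia. have h := lt_INR _ _ hc. have h0 := pos_INR c. have hpi := PI_RGT_0.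
have h1 : 0 <= INR c / INR N <= 1.
  split; first by apply Rdiv_ge0. apply Rmult_le_reg_r with (INR N) => //. unfold Rdiv; rewrite Rmult_assoc Rinv_l; lra.
rewrite /node. replace (2 * PI * INR c / INR N) with (2 * PI * (INR c / INR N)) by (field; lra). nra.
Qed.

Lemma pow2_nat_pos n : (0 < 2 ^ n)%nat.
Proof. have : (2 ^ n <> 0)%nat by apply Nat.pow_nonzero. lia. Qed.

(** Refinement by [2^k] divides each cell into equal subcells whose nodes lie within one coarse mesh
    width of the coarse node, so uniform continuity gives the Cauchy property. *)
Lemma riem_cv d g : tcont d g -> exists l, Un_cv (riem d g) l.
Proof.
move=> hg.
suff hc : Cauchy_crit (riem d g) by have [l hl] := R_complete _ hc; exists l.
have key : forall eps, 0 < eps -> exists n0, forall n k, (n0 <= n)%nat -> Rabs (riem d g (n + k) - riem d g n) <= eps.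
  move=> eps he. have [del [hd H]] := uniform_continuity_cube d g (- PI) PI eps hg he.
  have [n0 hn0] : exists n0, 2 * PI / del < INR n0 by apply INR_unbounded.
  exists n0 => n k hn.
  set A := (2 ^ n)%nat. set B := (2 ^ k)%nat.
  have hA : 0 < INR A by apply lt_0_INR, pow2_nat_pos. have hB : 0 < INR B by apply lt_0_INR, pow2_nat_pos.
  have eAB : (2 ^ (n + k) = A * B)%nat by rewrite Nat.pow_add_r.
  have hmesh : 2 * PI / INR A < del.
    have h1 : INR n0 < INR A.
      apply: Rle_lt_trans (le_INR _ _ hn) _. apply lt_INR. apply Nat.pow_gt_lin_r; lia.
    apply Rmult_lt_reg_r with (INR A) => //. replace (2 * PI / INR A * INR A) with (2 * PI) by (field; lra).
    have : 2 * PI < del * INR n0; last nra.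
    apply Rmult_lt_reg_r with (/ del); first by apply Rinv_0_lt_compat.
    replace (del * INR n0 * / del) with (INR n0) by (field; lra). exact hn0.
  have -> : riem d g n = lsum (ubox d A) (fun u => lsum (ubox d B) (fun v => (/ INR (A * B)) ^ d * g (pt A u))).
    apply lsum_ext => u _.
    rewrite (lsum_ext _ _ (fun _ => (/ INR B) ^ d * ((/ INR A) ^ d * g (pt A u)))); last first.
      move=> v _. rewrite mult_INR Rinv_mult Rpow_mult_distr; ring.
    rewrite lsum_ubox_avg //. apply pow2_nat_pos.
  have -> : riem d g (n + k) = lsum (ubox d A) (fun u => lsum (ubox d B) (fun v => (/ INR (A * B)) ^ d * g (pt (A * B) (fun i => (u i * B + v i)%nat)))).
    by rewrite /riem eAB lsum_ubox_split.
  have eM : forall (F G : (nat -> nat) -> (nat -> nat) -> R) l l', lsum l (fun u => lsum l' (F u)) - lsum l (fun u => lsum l' (G u)) = lsum l (fun u => lsum l' (fun v => F u v - G u v)).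
    move=> F G l l'.
    have e : forall (l : list (nat -> nat)) f g, lsum l f - lsum l g = lsum l (fun a => f a - g a).
      move=> l1 f1 g1. rewrite (lsum_ext _ (fun a => f1 a - g1 a) (fun a => f1 a + -1 * g1 a)); last by move=> *; ring.
      rewrite lsum_plus lsum_scal; ring.
    rewrite e. apply lsum_ext => u _. by rewrite e.
  rewrite eM.
  have habs : forall (l : list (nat -> nat)) f, Rabs (lsum l f) <= lsum l (fun a => Rabs (f a)).
    move=> l f; elim: l => [|a l IH]; first by rewrite !lsum_nil Rabs_R0; lra.
    rewrite !lsum_cons; apply: Rle_trans (Rabs_triang _ _) _; lra.
  apply: Rle_trans (habs _ _) _.
  apply: Rle_trans (_ : _ <= lsum (ubox d A) (fun u => lsum (ubox d B) (fun v => (/ INR (A * B)) ^ d * eps))) _; last first.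
    rewrite -(lsum_ubox_split d A B (fun _ => (/ INR (A * B)) ^ d * eps)) lsum_ubox_avg; first lra.
    have := pow2_nat_pos n; have := pow2_nat_pos k; rewrite -/A -/B; nia.
  apply lsum_le => u hu. apply: Rle_trans (habs _ _) _. apply lsum_le => v hv.
  have hi0 : 0 <= (/ INR (A * B)) ^ d.
    apply pow_le, Rlt_le, Rinv_0_lt_compat. rewrite mult_INR. by apply Rmult_lt_0_compat.
  rewrite -Rmult_minus_distr_l Rabs_mult Rabs_pos_eq //. apply Rmult_le_compat_l => //.
  apply Rlt_le, H.
    move=> i hi. apply node_range. have := mlist_in _ _ _ _ hu i hi => /in_seq; lia.
  move=> i hi. rewrite /pt /node.
  have hvi : INR (v i) < INR B by apply lt_INR; have := mlist_in _ _ _ _ hv i hi => /in_seq; lia.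
  have hv0 := pos_INR (v i). have hpi := PI_RGT_0.
  rewrite plus_INR !mult_INR.
  replace (- PI + 2 * PI * (INR (u i) * INR B + INR (v i)) / (INR A * INR B) - (- PI + 2 * PI * INR (u i) / INR A))
    with (2 * PI / INR A * (INR (v i) / INR B)) by (field; lra).
  have h1 : 0 <= INR (v i) / INR B <= 1.
    split; first by apply Rdiv_ge0. apply Rmult_le_reg_r with (INR B) => //. unfold Rdiv; rewrite Rmult_assoc Rinv_l; lra.
  have h2 : 0 < 2 * PI / INR A by apply Rdiv_lt_0_compat; lra.
  rewrite Rabs_pos_eq; nra.
move=> eps he. have [n0 H] := key (eps / 3) ltac:(lra). exists n0 => n m hn hm.
rewrite /Rdist.
have h1 := H n0 (n - n0)%nat ltac:(lia). have h2 := H n0 (m - n0)%nat ltac:(lia).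
replace (n0 + (n - n0))%nat with n in h1 by lia. replace (n0 + (m - n0))%nat with m in h2 by lia.
replace (riem d g n - riem d g m) with ((riem d g n - riem d g n0) + - (riem d g m - riem d g n0)) by ring.
apply: Rle_lt_trans (Rabs_triang _ _) _. rewrite Rabs_Ropp; lra.
Qed.

Lemma integ_cv d g : tcont d g -> Un_cv (riem d g) (/ (2 * PI) ^ d * integ d g).
Proof.
move=> hg. have [l hl] := riem_cv d g hg. have hpi := PI_RGT_0.
have hp : 0 < (2 * PI) ^ d by pos.
have e : integ d g = (2 * PI) ^ d * l.
  apply lim_cv. apply (Un_cv_ext (fun n => (2 * PI) ^ d * riem d g n)).
    move=> n. rewrite sumbox_lsum /riem lsum_scal -Rmult_assoc.
    have -> : (2 * PI) ^ d * (/ INR (2 ^ n)) ^ d = (2 * PI / 2 ^ n) ^ d.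
      rewrite -Rpow_mult_distr pow2_INR //.
    f_equal. apply lsum_ext => u _. f_equal. apply functional_extensionality => i. by rewrite /pt /node pow2_INR.
  apply (CV_mult (fun _ => (2 * PI) ^ d)) => //. apply Un_cv_const.
rewrite e -Rmult_assoc Rinv_l ?Rmult_1_l //; lra.
Qed.

Definition riemC (d : nat) (f : (nat -> R) -> Cx) (n : nat) : Cx :=
  lsumC (ubox d (2 ^ n)) (fun u => Cmul (Cof ((/ INR (2 ^ n)) ^ d)) (f (pt (2 ^ n) u))).

Lemma riemC_cv d f : ccont d f ->
  Cx_cv (riemC d f) (Cscale (/ (2 * PI) ^ d) (integ d (fun x => fst (f x)), integ d (fun x => snd (f x)))).
Proof.
move=> [h1 h2]; split => /=.
  apply (Un_cv_ext (riem d (fun x => fst (f x)))); last by apply integ_cv.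
  move=> n. rewrite /riemC lsumC_pair /=. apply lsum_ext => u _; ring.
apply (Un_cv_ext (riem d (fun x => snd (f x)))); last by apply integ_cv.
move=> n. rewrite /riemC lsumC_pair /=. apply lsum_ext => u _; ring.
Qed.

Lemma fhat_cv d f k : torus_fun d f -> Cx_cv (riemC d (fun x => Cmul (f x) (Cexpi (- kdot d k x)))) (fhat d f k).
Proof.
move=> hf. apply (riemC_cv d (fun x => Cmul (f x) (Cexpi (- kdot d k x)))).
apply ccont_mul; [exact: ccont_torus|exact: ccont_kdot].
Qed.

(** * Fourier coefficients and Fejer means *)

Definition Zlist (K : nat) : list Z := map (fun a => (Z.of_nat a - Z.of_nat K)%Z) (seq 0 (2 * K + 1)).
Definition zbox (d : nat) (K : nat -> nat) : list (nat -> Z) := mlist 0%Z d (fun i => Zlist (K i)).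

Definition dependsZ (d : nat) {T : Type} (G : (nat -> Z) -> T) : Prop :=
  forall k k', (forall i, (i < d)%nat -> k i = k' i) -> G k = G k'.

Lemma dependsZ_upd d {T} (G : (nat -> Z) -> T) a : dependsZ (S d) G -> dependsZ d (fun j => G (upd j d a)).
Proof.
move=> h k k' e; apply h => i hi. case: (Nat.eq_dec i d) => [->|hne]; first by rewrite !upd_eq.
rewrite !upd_neq //; apply e; lia.
Qed.

Lemma in_Zlist K z : In z (Zlist K) -> (Z.abs z <= Z.of_nat K)%Z.
Proof. move=> /in_map_iff [a [<- /in_seq h]]; lia. Qed.

Lemma lsumC_mlist_image {B} (b0 : B) d (ls : nat -> list B) (h : nat -> B -> Z) G : dependsZ d G ->
  lsumC (mlist 0%Z d (fun i => map (h i) (ls i))) G = lsumC (mlist b0 d ls) (fun j => G (fun i => h i (j i))).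
Proof.
elim: d G => [|d IH] G hG.
  rewrite /lsumC /=. f_equal. apply hG => i; lia.
rewrite !lsumC_mlist_S lsumC_map. apply lsumC_ext => a _.
rewrite IH; last by apply dependsZ_upd. apply lsumC_ext => j _. apply hG => i hi.
case: (Nat.eq_dec i d) => [->|hne]; first by rewrite !upd_eq. by rewrite !upd_neq.
Qed.

Lemma Zlist_S_sum K g : lsumC (Zlist (S K)) g =
  Cadd (Cadd (g (- Z.of_nat (S K))%Z) (g (Z.of_nat (S K)))) (lsumC (Zlist K) g).
Proof.
rewrite /Zlist !lsumC_map. replace (2 * S K + 1)%nat with (S (S (2 * K + 1))) by lia.
rewrite seq_S lsumC_app lsumC_cons lsumC_nil.
change (seq 0 (S (2 * K + 1))) with (0%nat :: seq 1 (2 * K + 1)). rewrite lsumC_cons -seq_shift lsumC_map.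
rewrite (lsumC_ext (seq 0 (2 * K + 1)) _ (fun a => g (Z.of_nat a - Z.of_nat K)%Z)); last first.
  move=> a _; f_equal; lia.
replace (Z.of_nat 0 - Z.of_nat (S K))%Z with (- Z.of_nat (S K))%Z by lia.
replace (Z.of_nat (0 + S (2 * K + 1)) - Z.of_nat (S K))%Z with (Z.of_nat (S K)) by lia. ring.
Qed.

Lemma Zlist_restrict D K g : (D <= K)%nat -> (forall z, (Z.of_nat D < Z.abs z)%Z -> g z = C0) ->
  lsumC (Zlist K) g = lsumC (Zlist D) g.
Proof.
move=> hDK hg. elim: K hDK => [|K IH] hDK; first by replace D with O by lia.
case: (Nat.eq_dec D (S K)) => [->//|hne].
rewrite Zlist_S_sum IH; last lia. rewrite !hg; [ring|lia|lia].
Qed.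

Lemma zbox_restrict d D K G : (forall i, (i < d)%nat -> (D i <= K i)%nat) ->
  (forall k i, (i < d)%nat -> (Z.of_nat (D i) < Z.abs (k i))%Z -> G k = C0) ->
  lsumC (zbox d K) G = lsumC (zbox d D) G.
Proof.
elim: d G => [//|d IH] G hDK hG.
rewrite /zbox !lsumC_mlist_S.
rewrite (Zlist_restrict (D d) (K d)); [|apply hDK; lia|].
  apply lsumC_ext => a _. apply IH; first by move=> i hi; apply hDK; lia.
  move=> k i hi hk. apply (hG _ i); first lia. by rewrite upd_neq; last lia.
move=> z hz. apply lsumC_zero => k _. apply (hG _ d); first lia. by rewrite upd_eq.
Qed.

Definition kron (d : nat) (k k' : nat -> Z) : Cx := cprod d (fun i => if (k' i =? k i)%Z then C1 else C0).

Lemma Zlist_kron K k g : (Z.abs k <= Z.of_nat K)%Z ->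
  lsumC (Zlist K) (fun z => Cmul (if (z =? k)%Z then C1 else C0) (g z)) = g k.
Proof.
elim: K => [|K IH] hk.
  rewrite /Zlist /= lsumC_cons lsumC_nil. have -> : k = 0%Z by lia. rewrite /=; ring.
rewrite Zlist_S_sum. case: (Z_le_gt_dec (Z.abs k) (Z.of_nat K)) => h.
  rewrite IH //. case: Z.eqb_spec => h1; first lia. case: Z.eqb_spec => h2; first lia. ring.
rewrite lsumC_zero; last first.
  move=> z /in_Zlist hz. case: Z.eqb_spec => h1; [lia|ring].
case: Z.eqb_spec => h1; case: Z.eqb_spec => h2; try lia.
  rewrite h1; ring.
rewrite h2; ring.
Qed.

Lemma zbox_kron d K k G : (forall i, (i < d)%nat -> (Z.abs (k i) <= Z.of_nat (K i))%Z) -> dependsZ d G ->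
  lsumC (zbox d K) (fun k' => Cmul (kron d k k') (G k')) = G k.
Proof.
elim: d G => [|d IH] G hk hG.
  rewrite /zbox /= lsumC_cons lsumC_nil /kron /cprod /=. rewrite (hG (fun _ => 0%Z) k); [ring|lia].
rewrite /zbox lsumC_mlist_S.
rewrite (lsumC_ext _ _ (fun a => Cmul (if (a =? k d)%Z then C1 else C0) (G (upd k d a)))); last first.
  move=> a _. rewrite -(IH (fun j => G (upd j d a))); last by apply dependsZ_upd.
    rewrite -lsumC_scal. apply lsumC_ext => j _. rewrite /kron cprod_S upd_eq.
    rewrite (cprod_ext d _ (fun i => if (j i =? k i)%Z then C1 else C0)); first ring.
    move=> i hi; rewrite upd_neq //; lia.
  move=> i hi; apply hk; lia.
rewrite Zlist_kron; last by apply hk.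
apply hG => i hi. case: (Nat.eq_dec i d) => [->|hne]; first by rewrite upd_eq. by rewrite upd_neq.
Qed.

Lemma kdot_ext d k k' x : (forall i, (i < d)%nat -> k i = k' i) -> kdot d k x = kdot d k' x.
Proof. move=> h; apply rsum_ext => i hi; by rewrite h. Qed.

Lemma fhat_dependsZ d f : dependsZ d (fhat d f).
Proof.
move=> k k' h. rewrite /fhat.
have -> : (fun x => fst (Cmul (f x) (Cexpi (- kdot d k x)))) = (fun x => fst (Cmul (f x) (Cexpi (- kdot d k' x)))).
  apply functional_extensionality => x; by rewrite (kdot_ext d k k').
have -> // : (fun x => snd (Cmul (f x) (Cexpi (- kdot d k x)))) = (fun x => snd (Cmul (f x) (Cexpi (- kdot d k' x)))).
apply functional_extensionality => x; by rewrite (kdot_ext d k k').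
Qed.

Definition dterm (d : nat) (phi : nat -> R -> R) (f : (nat -> R) -> Cx) (l : nat -> nat) (k : nat -> Z) : Cx :=
  Cmul (Cof (rprod d (fun i => phi (l i) (IZR (k i))))) (fhat d f k).

Lemma dterm_dependsZ d phi f l : dependsZ d (dterm d phi f l).
Proof.
move=> k k' h. rewrite /dterm (fhat_dependsZ d f k k' h). do 2 f_equal.
apply rprod_ext => i hi; by rewrite h.
Qed.

(** The outer support condition at integer frequencies, with one integer constant for all levels. It
    makes the limit in [delta] a finite sum and each block a trigonometric polynomial. *)
Definition cutoff (phi : nat -> R -> R) (c0 : nat) : Prop :=
  forall j z, (Z.of_nat (c0 * 2 ^ j) < Z.abs z)%Z -> phi j (IZR z) = 0.

Lemma delta_zbox d phi f c0 l x K : cutoff phi c0 -> (forall i, (i < d)%nat -> (c0 * 2 ^ l i <= K i)%nat) ->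
  delta d phi f l x = lsumC (zbox d K) (fun k => Cmul (dterm d phi f l k) (Cexpi (kdot d k x))).
Proof.
move=> hc hK.
have hvan : forall k i, (i < d)%nat -> (Z.of_nat (c0 * 2 ^ l i) < Z.abs (k i))%Z ->
   Cmul (dterm d phi f l k) (Cexpi (kdot d k x)) = C0.
  move=> k i hi hk. rewrite /dterm (rprod_zero d _ i hi (hc _ _ hk)) -/C0.
  change (Cof 0) with C0. ring.
have hdep : dependsZ d (fun k => Cmul (dterm d phi f l k) (Cexpi (kdot d k x))).
  move=> k k' e; by rewrite (dterm_dependsZ d phi f l k k' e) (kdot_ext d k k').
rewrite (zbox_restrict d (fun i => c0 * 2 ^ l i)%nat K) //.
have [K0 hK0] : exists K0, forall i, (i < d)%nat -> (c0 * 2 ^ l i <= K0)%nat.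
  elim: d {hK hvan hdep} => [|d [K0 IH]]; first by exists O; lia.
  exists (K0 + c0 * 2 ^ l d)%nat => i hi. case: (Nat.eq_dec i d) => [->|hne]; first lia.
  have := IH i ltac:(lia). lia.
rewrite /delta. apply (limC_eventually _ _ K0) => n hn.
rewrite csumbox_lsumC -(zbox_restrict d _ (fun _ => n)) //; last by move=> i /hK0; lia.
rewrite /zbox /Zlist (lsumC_mlist_image O d (fun _ => seq 0 (2 * n + 1)) (fun _ a => (Z.of_nat a - Z.of_nat n)%Z) _ hdep).
apply lsumC_ext => a _. rewrite /dterm Cscale_mul. ring.
Qed.

Lemma delta_tpoly d phi f c0 l : cutoff phi c0 -> tpoly d (fun i => c0 * 2 ^ l i)%nat (delta d phi f l).
Proof.
move=> hc. exists (map (fun k => (k, dterm d phi f l k)) (zbox d (fun i => c0 * 2 ^ l i)%nat)); split.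
  move=> q /in_map_iff [k [<- hk]] i hi /=. exact: in_Zlist (mlist_in _ _ _ _ hk i hi).
move=> y. rewrite (delta_zbox d phi f c0 l y _ hc (fun i _ => Nat.le_refl _)) lsumC_map.
apply lsumC_ext => k _ /=. by rewrite Cexpi_kdot.
Qed.

Lemma admissible_cutoff phi : admissible phi -> exists c0, cutoff phi c0.
Proof.
move=> [_ [[A [hA h1]] [[B [Cc [hB [hC h2]]]] _]]].
have [n hn] : exists n, A + Cc < INR n by apply INR_unbounded.
exists n => j z hz.
have h : INR n * 2 ^ j < Rabs (IZR z).
  rewrite -abs_IZR -pow2_INR -mult_INR INR_IZR_INZ. by apply IZR_lt.
have h2j := pow2_ge1 j.
case: j hz h h2j => [|j] hz h h2j; first pos.
apply h2; first lia. right. nra.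
Qed.

(** The supports move to infinity, so at an integer frequency the series is a finite sum and its
    partial sums equal 1 exactly, from a rank common to all [|z| <= R0]. *)
Lemma admissible_partition phi : admissible phi -> forall R0 : nat, exists n0, forall n z, (n0 <= n)%nat ->
  (Z.abs z <= Z.of_nat R0)%Z -> rsum n (fun l => phi l (IZR z)) = 1.
Proof.
move=> [_ [_ [[B [Cc [hB [hC h2]]]] hsum]]] R0.
have [n0 hn0] : exists n, INR R0 / B < INR n by apply INR_unbounded.
exists (S n0) => n z hn hz.
have hzero : forall l, (S n0 <= l)%nat -> phi l (IZR z) = 0.
  move=> l hl. apply h2; first lia. left. rewrite -abs_IZR.
  have a1 : IZR (Z.abs z) <= INR R0 by rewrite INR_IZR_INZ; apply IZR_le.
  have a2 : INR n0 <= 2 ^ l.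
    rewrite -pow2_INR. apply le_INR. have : (l < 2 ^ l)%nat by apply Nat.pow_gt_lin_r; lia. lia.
  have a3 : INR R0 < B * INR n0.
    apply Rmult_lt_reg_r with (/ B); first pos.
    replace (B * INR n0 * / B) with (INR n0) by (field; lra). exact hn0.
  nra.
have hconst : forall m, (S n0 <= m)%nat -> rsum m (fun l => phi l (IZR z)) = rsum (S n0) (fun l => phi l (IZR z)).
  move=> m. elim: m => [|m IH] hm; first lia.
  case: (Nat.eq_dec n0 m) => [->//|hne]. rewrite rsum_S IH ?hzero; try lia. ring.
rewrite hconst //.
have hcv : Un_cv (fun m => sum_f_R0 (fun l => phi l (IZR z)) m) (rsum (S n0) (fun l => phi l (IZR z))).
  apply (Un_cv_eventually _ _ n0) => m hm. rewrite -(hconst (S m)); last lia.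
  elim: m {hm} => [|m IH]; first by rewrite /rsum /=; ring.
  by rewrite /= IH (rsum_S (S m)).
exact: UL_sequence hcv (hsum (IZR z)).
Qed.

(** * Exact quadrature and Fejer kernels *)

Lemma node_mean N q : (Z.abs q < Z.of_nat N)%Z ->
  csum N (fun u => Cmul (Cof (/ INR N)) (Cexpi (IZR q * node (- PI) N u))) = if (q =? 0)%Z then C1 else C0.
Proof.
move=> hq. have hN : 0 < INR N by apply lt_0_INR; lia.
rewrite csum_lsumC (lsumC_ext _ _ (fun u => Cmul (Cmul (Cof (/ INR N)) (Cexpi (IZR q * - PI))) (Cexpi (INR u * (2 * PI * IZR q / INR N))))); last first.
  move=> u _. rewrite (_ : Cexpi (IZR q * node (- PI) N u) = Cmul (Cexpi (IZR q * - PI)) (Cexpi (INR u * (2 * PI * IZR q / INR N)))); first ring.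
  rewrite -Cexpi_add. f_equal. rewrite /node. field; lra.
rewrite lsumC_scal -csum_lsumC orthogonality //. case: Z.eqb_spec => h; last ring.
rewrite h Rmult_0_l Cexpi_0.
transitivity (Cmul (Cof (/ INR N * INR N)) C1); first by rewrite Cof_mul; ring.
rewrite Rinv_l; [rewrite -/C1; ring|lra].
Qed.

Lemma riemC_character d k k' n : (forall i, (i < d)%nat -> (Z.abs (k' i - k i) < Z.of_nat (2 ^ n))%Z) ->
  riemC d (fun x => Cmul (Cexpi (kdot d k' x)) (Cexpi (- kdot d k x))) n = kron d k k'.
Proof.
move=> h. rewrite /riemC.
rewrite (lsumC_ext _ _ (fun u => cprod d (fun i => Cmul (Cof (/ INR (2 ^ n))) (Cexpi (IZR (k' i - k i) * node (- PI) (2 ^ n) (u i)))))); last first.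
  move=> u _. rewrite cprod_mul cprod_Cof rprod_const. f_equal.
  rewrite -Cexpi_add -(Cexpi_kdot d (fun i => k' i - k i)%Z (pt (2 ^ n) u)). f_equal.
  rewrite /kdot (rsum_ext d (fun i => IZR (k' i - k i) * pt (2 ^ n) u i) (fun i => IZR (k' i) * pt (2 ^ n) u i + -1 * (IZR (k i) * pt (2 ^ n) u i))).
    rewrite rsum_plus rsum_scal; ring.
  move=> i _; rewrite minus_IZR; ring.
rewrite (lsumC_mlist_prod O d (fun _ => seq 0 (2 ^ n)) (fun i a => Cmul (Cof (/ INR (2 ^ n))) (Cexpi (IZR (k' i - k i) * node (- PI) (2 ^ n) a)))).
apply cprod_ext => i hi. rewrite -csum_lsumC node_mean; last pos.
case: Z.eqb_spec => h1; case: Z.eqb_spec => h2 //; lia.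
Qed.

Lemma riemC_lsumC {A} (l : list A) d (F : A -> (nat -> R) -> Cx) n :
  riemC d (fun x => lsumC l (fun a => F a x)) n = lsumC l (fun a => riemC d (F a) n).
Proof.
rewrite /riemC lsumC_exch. apply lsumC_ext => u _. by rewrite lsumC_scal.
Qed.

Lemma riemC_scal d c f n : riemC d (fun x => Cmul c (f x)) n = Cmul c (riemC d f n).
Proof. rewrite /riemC -lsumC_scal. apply lsumC_ext => u _; ring. Qed.

Lemma riemC_ext d f g n : (forall x, f x = g x) -> riemC d f n = riemC d g n.
Proof. by move=> h; rewrite (functional_extensionality f g h). Qed.

Definition Spart (d : nat) (phi : nat -> R -> R) (f : (nat -> R) -> Cx) (n : nat) (x : nat -> R) : Cx :=
  lsumC (ubox d n) (fun l => delta d phi f l x).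

(** Quadrature on a fine grid is exact for characters, so the coefficient of [Spart] is obtained
    without a limit, and the partition of unity identifies it with that of [f]. *)
Lemma Spart_coef d phi f c0 R0 n k : cutoff phi c0 ->
  (forall z, (Z.abs z <= Z.of_nat R0)%Z -> rsum n (fun l => phi l (IZR z)) = 1) ->
  (forall i, (i < d)%nat -> (Z.abs (k i) <= Z.of_nat R0)%Z) ->
  exists v0, forall v, (v0 <= v)%nat -> riemC d (fun x => Cmul (Spart d phi f n x) (Cexpi (- kdot d k x))) v = fhat d f k.
Proof.
move=> hc hpart hk.
pose K := (c0 * 2 ^ n + R0)%nat.
exists (2 * K + 1)%nat => v hv.
have hvv : (v < 2 ^ v)%nat by apply Nat.pow_gt_lin_r; lia.
have hvK : (2 * K < 2 ^ v)%nat by lia.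
rewrite (riemC_ext d _ (fun x => lsumC (ubox d n) (fun l => lsumC (zbox d (fun _ => K)) (fun k' => Cmul (dterm d phi f l k') (Cmul (Cexpi (kdot d k' x)) (Cexpi (- kdot d k x))))))); last first.
  move=> x. rewrite /Spart -lsumC_scalr. apply lsumC_ext => l hl.
  rewrite (delta_zbox d phi f c0 l x (fun _ => K) hc).
    rewrite -lsumC_scalr. apply lsumC_ext => k' _; ring.
  move=> i hi. have := mlist_in _ _ _ _ hl i hi => /in_seq h.
  have : (2 ^ l i <= 2 ^ n)%nat by apply Nat.pow_le_mono_r; lia. rewrite /K; nia.
rewrite (riemC_lsumC (ubox d n)).
rewrite (lsumC_ext _ _ (fun l => dterm d phi f l k)); last first.
  move=> l _. rewrite (riemC_lsumC (zbox d (fun _ => K))).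
  rewrite (lsumC_ext _ _ (fun k' => Cmul (kron d k k') (dterm d phi f l k'))).
    apply zbox_kron; last by apply dterm_dependsZ. move=> i /hk; rewrite /K; lia.
  move=> k' hk'. rewrite (riemC_scal d (dterm d phi f l k') (fun x => Cmul (Cexpi (kdot d k' x)) (Cexpi (- kdot d k x)))) riemC_character; first ring.
  move=> i hi. have h1 := hk i hi. have h2 := in_Zlist _ _ (mlist_in _ _ _ _ hk' i hi). rewrite /K in hvK h2. lia.
rewrite /dterm lsumC_scalr lsumC_Cof (lsum_mlist_prod O d (fun _ => seq 0 n) (fun i a => phi a (IZR (k i)))).
rewrite (rprod_ext d _ (fun _ => 1)).
  rewrite rprod_const pow1 -/C1; ring.
move=> i hi. apply hpart. by apply hk.
Qed.

Definition fej (R0 : nat) (t : R) : R := / INR R0 * (Cmod (dir 0 R0 t)) ^ 2.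

Lemma fej_ge0 R0 t : (0 < R0)%nat -> 0 <= fej R0 t.
Proof.
move=> h; apply Rmult_le_pos; last pos. apply Rlt_le, Rinv_0_lt_compat. by apply lt_0_INR.
Qed.

Lemma fej_decay R0 t : (0 < R0)%nat -> fej R0 t * rho t ^ 2 <= / INR R0.
Proof.
move=> h.
rewrite /fej Rmult_assoc -[X in _ <= X]Rmult_1_r. mul_l.
rewrite -Rpow_mult_distr -(pow1 2). apply pow_incr. split; last by apply dir_decay.
pos.
Qed.

Lemma dir_conj_mul R0 t : Cmul (dir 0 R0 t) (dir 0 R0 (- t)) = Cof (Cmod (dir 0 R0 t) ^ 2).
Proof.
have e : dir 0 R0 (- t) = (fst (dir 0 R0 t), - snd (dir 0 R0 t)).
  rewrite /dir !csum_lsumC !lsumC_pair /=. apply Cx_eq => /=.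
    apply lsum_ext => a _. by rewrite -Ropp_mult_distr_r cos_neg.
  replace (- lsum (seq 0 R0) (fun a => sin (IZR (Z.of_nat a + 0) * t))) with (-1 * lsum (seq 0 R0) (fun a => sin (IZR (Z.of_nat a + 0) * t))) by ring.
  rewrite -lsum_scal. apply lsum_ext => a _. rewrite -Ropp_mult_distr_r sin_neg; ring.
rewrite e. set z := dir 0 R0 t.
have hz : Cmod z ^ 2 = fst z ^ 2 + snd z ^ 2 by rewrite /Cmod pow2_sqrt //; nra.
rewrite hz. apply Cx_eq; rewrite /=; ring.
Qed.

Lemma tpoly1_fej R0 : tpoly1 (- Z.of_nat R0) (Z.of_nat R0) (fun t => Cof (fej R0 t)).
Proof.
apply (tpoly1_ext _ _ (fun t => Cmul (Cof (/ INR R0)) (Cmul (dir 0 R0 t) (dir 0 R0 (0 - t))))).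
  move=> t. rewrite Rminus_0_l dir_conj_mul -Cof_mul //.
apply tpoly1_scale.
have := tpoly1_mul _ _ _ _ _ _ (tpoly1_dir 0 R0) (tpoly1_reflect _ _ _ 0 (tpoly1_dir 0 R0)).
apply tpoly1_weaken; lia.
Qed.

(** The Dirichlet kernel reproduces its own translate; at the point [z] the translate has the value
    [R0], and the reproducing sum is that of the squared modulus. *)
Lemma fej_mean R0 N z : (0 < R0)%nat -> (R0 <= N)%nat -> rsum N (fun u => / INR N * fej R0 (z - node (- PI) N u)) = 1.
Proof.
move=> hR hN. have hR' : 0 < INR R0 by pos.
have hP : tpoly1 0 (0 + Z.of_nat R0 - 1) (fun t => dir 0 R0 (t - z)).
  have h2 : tpoly1 0 (0 + Z.of_nat R0 - 1) (fun t => dir 0 R0 (- z - (0 - t))).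
    have := tpoly1_reflect _ _ _ 0 (tpoly1_reflect _ _ _ (- z) (tpoly1_dir 0 R0)).
    apply tpoly1_weaken; lia.
  move: h2. apply tpoly1_ext => t. f_equal; ring.
have := dir_reproduces N R0 0 (- PI) z (fun t => dir 0 R0 (t - z)) hN hP.
rewrite Rminus_diag.
have -> : dir 0 R0 0 = Cof (INR R0).
  rewrite dir_factor Rmult_0_r Cexpi_0 csum_lsumC (lsumC_ext _ _ (fun _ => C1)).
    rewrite lsumC_const length_seq; ring.
  move=> a _; by rewrite Rmult_0_r Cexpi_0.
rewrite csum_lsumC (lsumC_ext _ _ (fun u => Cof (INR R0 * (/ INR N * fej R0 (z - node (- PI) N u))))); last first.
  move=> u _. rewrite Cscale_mul (Cof_mul (INR R0)) Cof_mul /fej Cof_mul -dir_conj_mul.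
  replace (- (z - node (- PI) N u)) with (node (- PI) N u - z) by ring.
  transitivity (Cmul (Cof (INR R0 * / INR R0)) (Cmul (dir 0 R0 (node (- PI) N u - z)) (Cmul (Cof (/ INR N)) (dir 0 R0 (z - node (- PI) N u))))).
    rewrite Rinv_r; last lra. rewrite -/C1; ring.
  rewrite Cof_mul; ring.
rewrite lsumC_Cof lsum_scal => h. injection h => h1.
apply Rmult_eq_reg_l with (INR R0); last lra. rewrite Rmult_1_r. exact h1.
Qed.

Definition periodic (d : nat) {T : Type} (f : (nat -> R) -> T) : Prop :=
  forall x i, (i < d)%nat -> f (updR x i (x i + 2 * PI)) = f x.

Lemma torus_of_ccont d f : ccont d f -> periodic d f -> torus_fun d f.
Proof.
move=> [[h1 h2] [h3 h4]] hp; split; last split=> //.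
  move=> x y e; apply Cx_eq; [by apply h1|by apply h3].
move=> x eps he.
have [d1 [p1 H1]] := h2 x (eps / 2) ltac:(lra). have [d2 [p2 H2]] := h4 x (eps / 2) ltac:(lra).
exists (Rmin d1 d2); split; first by apply Rmin_glb_lt.
move=> y hy. apply: Rle_lt_trans (Cmod_le_sum _) _ => /=.
have := H1 y (fun i hi => Rlt_le_trans _ _ _ (hy i hi) (Rmin_l _ _)).
have := H2 y (fun i hi => Rlt_le_trans _ _ _ (hy i hi) (Rmin_r _ _)). lra.
Qed.

Lemma ccont_sub d f g : ccont d f -> ccont d g -> ccont d (fun x => Csub (f x) (g x)).
Proof.
move=> [f1 f2] [g1 g2]; split => /=.
  apply (tcont_ext d (fun x => fst (f x) + -1 * fst (g x))); first by move=> x; ring.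
  apply tcont_plus => //; by apply tcont_scal.
apply (tcont_ext d (fun x => snd (f x) + -1 * snd (g x))); first by move=> x; ring.
apply tcont_plus => //; by apply tcont_scal.
Qed.

Lemma tpoly_periodic d D g : tpoly d D g -> periodic d g.
Proof.
move=> [l [_ h]] x i hi. rewrite !h. apply lsumC_ext => q _. f_equal. apply cprod_ext => k _.
rewrite /updR. case: Nat.eqb_spec => [->|//].
rewrite -(Cexpi_2PI (fst q i) (IZR (fst q i) * x i)). f_equal. ring.
Qed.

Lemma ccont_Spart d phi f c0 n : cutoff phi c0 -> ccont d (Spart d phi f n).
Proof.
move=> hc. apply (ccont_lsumC d (ubox d n) (fun l => delta d phi f l)) => l _.
exact: ccont_tpoly (delta_tpoly d phi f c0 l hc).
Qed.

Lemma periodic_Spart d phi f c0 n : cutoff phi c0 -> periodic d (Spart d phi f n).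
Proof.
move=> hc x i hi. apply lsumC_ext => l _. exact: (tpoly_periodic d _ _ (delta_tpoly d phi f c0 l hc) x i hi).
Qed.

Lemma torus_shift1 d f x i (m : Z) : torus_fun d f -> (i < d)%nat -> f (upd x i (x i + 2 * PI * IZR m)) = f x.
Proof.
move=> [h1 [h2 _]] hi.
have H : forall n y, f (upd y i (y i + 2 * PI * INR n)) = f y.
  elim => [|n IH] y.
    apply h1 => k hk. rewrite /upd. case: Nat.eqb_spec => [->|//]. rewrite /=; ring.
  rewrite -(IH y) -(h2 (upd y i (y i + 2 * PI * INR n)) i hi). apply h1 => k hk.
  rewrite /updR /upd Nat.eqb_refl. case: (Nat.eqb_spec k i) => [_|//]. rewrite S_INR; ring.
case: (Z_le_gt_dec 0 m) => hm.
  rewrite -(H (Z.to_nat m) x). do 2 f_equal. rewrite INR_IZR_INZ Z2Nat.id //.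
rewrite -(H (Z.to_nat (- m)) (upd x i _)). apply h1 => k hk.
rewrite /upd Nat.eqb_refl. case: (Nat.eqb_spec k i) => [->|//]. rewrite INR_IZR_INZ Z2Nat.id; last lia.
rewrite opp_IZR; ring.
Qed.

Lemma torus_shift d f x (m : nat -> Z) : torus_fun d f -> f (fun i => x i + 2 * PI * IZR (m i)) = f x.
Proof.
move=> hf. have [h1 _] := hf.
have H : forall n, (n <= d)%nat -> f (fun i => if (i <? n)%nat then x i + 2 * PI * IZR (m i) else x i) = f x.
  elim => [|n IH] hn; first by apply h1 => i _; rewrite /=.
  rewrite -(IH ltac:(lia)).
  rewrite -(torus_shift1 d f (fun i => if (i <? n)%nat then x i + 2 * PI * IZR (m i) else x i) n (m n) hf hn).
  apply h1 => k hk. rewrite /upd Nat.ltb_irrefl. case: Nat.eqb_spec => [->|hne].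
    have -> // : (n <? S n)%nat = true by apply Nat.ltb_lt.
  case: (Nat.ltb_spec k (S n)) => a; case: (Nat.ltb_spec k n) => b //; lia.
rewrite -(H d (Nat.le_refl d)). apply h1 => i hi. have -> // : (i <? d)%nat = true by apply Nat.ltb_lt.
Qed.

Lemma rho_near t : exists m : Z, Rabs (t + 2 * PI * IZR m) <= 12 * rho t.
Proof.
have hpi := PI_RGT_0. have h4 := PI_4.
have [h1 h2] := base_Int_part (t / (2 * PI) + / 2). set k := Int_part _ in h1 h2.
exists (- k)%Z. rewrite -(rho_2PI t (- k)).
set s := t + 2 * PI * IZR (- k).
have es : s = 2 * PI * (t / (2 * PI) - IZR k) by rewrite /s opp_IZR; field; lra.
have hs : Rabs s <= 22 / 5 by apply Rabs_le; rewrite es; nra.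
have := rho_ge_abs s hs. lra.
Qed.

(** The segment from the origin to [x] is walked in [n] steps shorter than the modulus for
    [eps = 1], each of which changes [g] by less than 1. *)
Lemma tcont_bounded_cube d g : tcont d g -> exists B, 0 <= B /\ forall x, (forall i, (i < d)%nat -> - PI <= x i <= PI) -> Rabs (g x) <= B.
Proof.
move=> hg. have hpi := PI_RGT_0.
have [del [hd H]] := uniform_continuity_cube d g (- PI) PI 1 hg ltac:(lra).
have [n hn] : exists n, PI / del < INR n by apply INR_unbounded.
have hpd : 0 < PI / del by pos.
have hn0 : 0 < INR n by lra.
have hstep : PI / INR n < del.
  apply Rmult_lt_reg_r with (INR n / del); first pos.
  replace (PI / INR n * (INR n / del)) with (PI / del) by (field; lra).
  replace (del * (INR n / del)) with (INR n) by (field; lra). exact hn.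
exists (Rabs (g (fun _ => 0)) + INR n); split; first by have := Rabs_pos (g (fun _ => 0)); lra.
move=> x hx.
have K : forall k, (k <= n)%nat -> Rabs (g (fun i => INR k / INR n * x i)) <= Rabs (g (fun _ => 0)) + INR k.
  elim => [|k IH] hk.
    have -> : (fun i => INR 0 / INR n * x i) = (fun _ : nat => 0).
      apply functional_extensionality => i. rewrite /=; field; lra.
    rewrite [INR 0]/=; lra.
  have {}IH := IH ltac:(lia).
  have hkn : INR k + 1 <= INR n by rewrite -S_INR; apply le_INR.
  have h : Rabs (g (fun i => INR (S k) / INR n * x i) - g (fun i => INR k / INR n * x i)) < 1.
    apply H.
      move=> i hi. have := hx i hi => h. have h1 : 0 <= INR k / INR n <= 1.
        split; first pos. apply Rmult_le_reg_r with (INR n) => //. unfold Rdiv; rewrite Rmult_assoc Rinv_l; lra.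
      nra.
    move=> i hi. replace (INR (S k) / INR n * x i - INR k / INR n * x i) with (x i / INR n) by (rewrite S_INR; field; lra).
    rewrite /Rdiv Rabs_mult (Rabs_pos_eq (/ INR n)); last pos.
    have hxi : Rabs (x i) <= PI by apply Rabs_le; have := hx i hi; lra.
    apply: Rle_lt_trans hstep. apply Rmult_le_compat_r => //. by apply Rlt_le, Rinv_0_lt_compat.
  rewrite [X in _ <= _ + X]S_INR.
  replace (g (fun i => INR (S k) / INR n * x i)) with ((g (fun i => INR (S k) / INR n * x i) - g (fun i => INR k / INR n * x i)) + g (fun i => INR k / INR n * x i)) by ring.
  apply: Rle_trans (Rabs_triang _ _) _. lra.
have := K n (Nat.le_refl n).
have -> // : (fun i => INR n / INR n * x i) = x.
apply functional_extensionality => i. field; lra.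
Qed.

Lemma rprod_1p_ge d (a : nat -> R) i : (i < d)%nat -> (forall k, (k < d)%nat -> 0 <= a k) -> 1 + a i <= rprod d (fun k => 1 + a k).
Proof.
elim: d => [|d IH] hi ha; first lia. rewrite rprod_S.
have h1 : 1 <= rprod d (fun k => 1 + a k).
  rewrite -{1}(pow1 d) -(rprod_const d 1). apply rprod_le => k hk. have := ha k ltac:(lia). lra.
have had := ha d ltac:(lia).
case: (Nat.eq_dec i d) => [->|hne]; first nra.
have := IH ltac:(lia) (fun k hk => ha k ltac:(lia)). nra.
Qed.

Lemma pow_1p_le d x : 0 <= x <= 1 -> (1 + x) ^ d <= 1 + 2 ^ d * x.
Proof.
move=> hx. suff h : (1 + x) ^ d <= 1 + (2 ^ d - 1) * x by lra.
elim: d => [|d IH]; first pos.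
rewrite [(1 + x) ^ S d]/= [2 ^ S d]/=. have h2 := pow2_ge1 d.
have h3 : (1 + x) * (1 + x) ^ d <= (1 + x) * (1 + (2 ^ d - 1) * x) by apply Rmult_le_compat_l; lra.
have h4 : 0 <= (2 ^ d - 1) * (x * (1 - x)) by pos.
lra.
Qed.

(* [prod (1 + (rho_i / del)^2) - 1] dominates the indicator of the set where some [rho_i >= del]. *)
Lemma fejer_approx d E x eta : torus_fun d E -> 0 < eta -> exists R0, (0 < R0)%nat /\ forall N, (R0 <= N)%nat ->
  Cmod (Csub (lsumC (ubox d N) (fun u => Cmul (Cof ((/ INR N) ^ d)) (Cmul (E (pt N u)) (Cof (rprod d (fun i => fej R0 (x i - pt N u i))))))) (E x)) <= eta.
Proof.
move=> hE heta. have [hdep [_ hcont]] := hE.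
have [del [hdel H]] := hcont x (eta / 2) ltac:(lra).
have [B [hB HB]] := tcont_bounded_cube d _ (tcont_Cmod d E (ccont_torus d E hE)).
(* [rho < dl] gives a distance modulo [2 PI] of at most [12 dl < del], by [rho_near]. *)
set dl := del / 13. have hdl : 0 < dl by rewrite /dl; lra.
set M := B + Cmod (E x). have hM : 0 <= M by have := Cmod_ge0 (E x); rewrite /M; lra.
(* The first summand makes [x := / (R0 dl^2)] at most 1, as [pow_1p_le] requires; the second makes
   [M 2^d x] at most [eta / 2]. *)
have [R0 hR0] : exists n, / dl ^ 2 + 2 * M * 2 ^ d / (dl ^ 2 * eta) < INR n by apply INR_unbounded.
have hdl2 : 0 < dl ^ 2 by pos.
have hp1 : 0 < / dl ^ 2 by pos.
have hp2 : 0 <= 2 * M * 2 ^ d / (dl ^ 2 * eta) by pos.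
have hRp : 0 < INR R0 by lra.
exists R0; split; first by apply INR_lt; rewrite [INR 0]/=.
have hR0n : (0 < R0)%nat by apply INR_lt; rewrite [INR 0]/=.
move=> N hN. have hNp : 0 < INR N by apply Rlt_le_trans with (INR R0) => //; apply le_INR.
have hiN : 0 < / INR N by pos.
pose w u := rprod d (fun i => / INR N * fej R0 (x i - pt N u i)).
have hw : forall u, 0 <= w u.
  move=> u; apply rprod_ge0 => i _; apply Rmult_le_pos; [lra|by apply fej_ge0].
have hw1 : lsum (ubox d N) w = 1.
  rewrite /w (lsum_ubox_prod d N (fun i t => / INR N * fej R0 (x i - t))) (rprod_ext d _ (fun _ => 1)); first by rewrite rprod_const pow1.
  move=> i _. by apply fej_mean.
have hwe : forall u, (/ INR N) ^ d * rprod d (fun i => fej R0 (x i - pt N u i)) = w u.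
  move=> u; by rewrite /w rprod_mul rprod_const.
have -> : Csub (lsumC (ubox d N) (fun u => Cmul (Cof ((/ INR N) ^ d)) (Cmul (E (pt N u)) (Cof (rprod d (fun i => fej R0 (x i - pt N u i))))))) (E x)
  = lsumC (ubox d N) (fun u => Cmul (Cof (w u)) (Csub (E (pt N u)) (E x))).
  have e : E x = lsumC (ubox d N) (fun u => Cmul (Cof (w u)) (E x)).
    rewrite lsumC_scalr lsumC_Cof hw1 -/C1; ring.
  rewrite [X in Csub _ X]e -lsumC_sub. apply lsumC_ext => u _. rewrite -hwe Cof_mul; ring.
apply: Rle_trans (Cmod_lsumC _ _) _.
pose Q u := rprod d (fun i => 1 + rho (x i - pt N u i) ^ 2 / dl ^ 2).
have hq0 : forall u i, 0 <= rho (x i - pt N u i) ^ 2 / dl ^ 2 by pos.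
have hQ1 : forall u, 1 <= Q u.
  move=> u. rewrite /Q -{1}(pow1 d) -(rprod_const d 1). apply rprod_le => i _; have := hq0 u i; lra.
apply: Rle_trans (_ : _ <= lsum (ubox d N) (fun u => eta / 2 * w u + M * (w u * Q u + -1 * w u))) _.
  apply lsum_le => u hu. rewrite Cmod_mul Cmod_Cof Rabs_pos_eq //.
  suff h : Cmod (Csub (E (pt N u)) (E x)) <= eta / 2 + M * (Q u - 1).
    have := Rmult_le_compat_l _ _ _ (hw u) h. lra.
  case: (classic (exists i, (i < d)%nat /\ dl <= rho (x i - pt N u i))) => [[i [hi hfar]]|hnear].
    have h1 : Cmod (Csub (E (pt N u)) (E x)) <= M.
      apply: Rle_trans (Cmod_sub_tri _ _) _. rewrite /M. apply Rplus_le_compat_r.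
      have := HB (pt N u). rewrite Rabs_pos_eq; last pos. apply.
      move=> k hk. apply node_range. have := mlist_in _ _ _ _ hu k hk => /in_seq; lia.
    have h2 : 2 <= Q u.
      have := rprod_1p_ge d (fun i => rho (x i - pt N u i) ^ 2 / dl ^ 2) i hi (fun k _ => hq0 u k).
      have : 1 <= rho (x i - pt N u i) ^ 2 / dl ^ 2.
        apply Rmult_le_reg_r with (dl ^ 2) => //. unfold Rdiv; rewrite Rmult_assoc Rinv_l; last lra. rewrite Rmult_1_l Rmult_1_r.
        apply pow_incr; lra.
      rewrite /Q; lra.
    nra.
  have hm : forall i, {m : Z | Rabs ((pt N u i - x i) + 2 * PI * IZR m) <= 12 * rho (pt N u i - x i)}.
    move=> i. apply constructive_indefinite_description, rho_near.
  have h1 : Cmod (Csub (E (pt N u)) (E x)) < eta / 2.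
    rewrite -(torus_shift d E (pt N u) (fun i => proj1_sig (hm i)) hE). apply H => i hi.
    have h2 := proj2_sig (hm i).
    have h3 : rho (pt N u i - x i) < dl.
      rewrite -rho_opp. replace (- (pt N u i - x i)) with (x i - pt N u i) by ring.
      apply Rnot_le_lt => h. apply hnear. by exists i.
    replace (pt N u i + 2 * PI * IZR (proj1_sig (hm i)) - x i) with (pt N u i - x i + 2 * PI * IZR (proj1_sig (hm i))) by ring.
    rewrite /dl in h3. lra.
  have := hQ1 u. nra.
rewrite lsum_plus !lsum_scal lsum_plus lsum_scal hw1 Rmult_1_r.
(* The majorant factorises, and [fej rho^2 <= / R0] holds pointwise, so every variable contributes
   at most [1 + / (R0 dl^2)]. *)
have hQ : lsum (ubox d N) (fun u => w u * Q u) <= (1 + / (INR R0 * dl ^ 2)) ^ d.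
  rewrite (lsum_ext _ _ (fun u => rprod d (fun i => / INR N * fej R0 (x i - pt N u i) * (1 + rho (x i - pt N u i) ^ 2 / dl ^ 2)))); last first.
    move=> u _; by rewrite /w /Q -rprod_mul.
  rewrite (lsum_ubox_prod d N (fun i t => / INR N * fej R0 (x i - t) * (1 + rho (x i - t) ^ 2 / dl ^ 2))).
  apply rprod_const_le => i _. split.
    apply rsum_ge0 => a _. apply Rmult_le_pos; first by apply Rmult_le_pos; [lra|by apply fej_ge0].
    have : 0 <= rho (x i - node (- PI) N a) ^ 2 / dl ^ 2 by pos. lra.
  apply: Rle_trans (_ : _ <= rsum N (fun a => / INR N * fej R0 (x i - node (- PI) N a) + / INR N * / (INR R0 * dl ^ 2))) _.
    apply rsum_le => a _. have h1 := fej_decay R0 (x i - node (- PI) N a) hR0n.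
    have h2 : / INR N * (fej R0 (x i - node (- PI) N a) * rho (x i - node (- PI) N a) ^ 2) * / dl ^ 2 <= / INR N * / INR R0 * / dl ^ 2.
      mul_r. apply Rmult_le_compat_l; lra.
    rewrite Rinv_mult. unfold Rdiv. lra.
  rewrite rsum_plus fej_mean // rsum_lsum lsum_const length_seq -Rmult_assoc Rinv_r; lra.
have hx : 0 <= / (INR R0 * dl ^ 2) <= 1.
  split; first by apply Rlt_le, Rinv_0_lt_compat, Rmult_lt_0_compat.
  rewrite -Rinv_1. apply Rinv_le_contravar; first lra.
  have : / dl ^ 2 * dl ^ 2 <= INR R0 * dl ^ 2 by apply Rmult_le_compat_r; lra. rewrite Rinv_l; lra.
have hpw := pow_1p_le d _ hx.
have hfin : M * (2 ^ d * / (INR R0 * dl ^ 2)) <= eta / 2.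
  apply Rmult_le_reg_r with (2 * (INR R0 * dl ^ 2)); first nra.
  replace (M * (2 ^ d * / (INR R0 * dl ^ 2)) * (2 * (INR R0 * dl ^ 2))) with (2 * M * 2 ^ d) by (field; split; lra).
  replace (eta / 2 * (2 * (INR R0 * dl ^ 2))) with (INR R0 * (dl ^ 2 * eta)) by field.
  have h1 : 2 * M * 2 ^ d / (dl ^ 2 * eta) * (dl ^ 2 * eta) <= INR R0 * (dl ^ 2 * eta).
    mul_r. lra.
  replace (2 * M * 2 ^ d / (dl ^ 2 * eta) * (dl ^ 2 * eta)) with (2 * M * 2 ^ d) in h1 by (field; split; lra). exact h1.
have := Rmult_le_compat_l M _ _ hM (Rle_trans _ _ _ hQ hpw). lra.
Qed.

(** The Fejer kernel is a finite sum of exponentials of frequency at most [R0], so only the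
    coefficients assumed to vanish enter. *)
Lemma fejer_riem_zero d g x R0 : ccont d g ->
  (forall k, (forall i, (i < d)%nat -> (Z.abs (k i) <= Z.of_nat R0)%Z) -> Cx_cv (riemC d (fun y => Cmul (g y) (Cexpi (- kdot d k y)))) C0) ->
  Cx_cv (riemC d (fun y => Cmul (g y) (Cof (rprod d (fun i => fej R0 (x i - y i)))))) C0.
Proof.
move=> hg hk. have [l [h1 h2]] := tpoly1_fej R0.
pose c (e : nat -> Z * Cx) := cprod d (fun i => Cmul (snd (e i)) (Cexpi (IZR (fst (e i)) * x i))).
pose E := mlist (0%Z, C0) d (fun _ => l).
have e1 : forall y, Cmul (g y) (Cof (rprod d (fun i => fej R0 (x i - y i)))) =
  lsumC E (fun e => Cmul (c e) (Cmul (g y) (Cexpi (- kdot d (fun i => fst (e i)) y)))).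
  move=> y. rewrite -cprod_Cof (cprod_ext d _ (fun i => lsumC l (fun q => Cmul (snd q) (Cexpi (IZR (fst q) * (x i - y i)))))); last pos.
  rewrite -(lsumC_mlist_prod (0%Z, C0) d (fun _ => l) (fun i q => Cmul (snd q) (Cexpi (IZR (fst q) * (x i - y i))))) -lsumC_scal.
  apply lsumC_ext => e _.
  have -> : Cexpi (- kdot d (fun i => fst (e i)) y) = cprod d (fun i => Cexpi (IZR (fst (e i)) * - y i)).
    rewrite -(Cexpi_kdot d (fun i => fst (e i)) (fun i => - y i)). f_equal. rewrite /kdot.
    rewrite (rsum_ext d (fun i => IZR (fst (e i)) * - y i) (fun i => -1 * (IZR (fst (e i)) * y i))); last by move=> i _; ring.
    rewrite rsum_scal; ring.
  rewrite /c (cprod_ext d _ (fun i => Cmul (Cmul (snd (e i)) (Cexpi (IZR (fst (e i)) * x i))) (Cexpi (IZR (fst (e i)) * - y i)))).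
    rewrite cprod_mul; ring.
  move=> i _. replace (IZR (fst (e i)) * (x i - y i)) with (IZR (fst (e i)) * x i + IZR (fst (e i)) * - y i) by ring.
  rewrite Cexpi_add; ring.
have hcv : Cx_cv (fun n => lsumC E (fun e => Cmul (c e) (riemC d (fun y => Cmul (g y) (Cexpi (- kdot d (fun i => fst (e i)) y))) n))) (lsumC E (fun e => Cmul (c e) C0)).
  apply (Cx_cv_lsumC E (fun e n => Cmul (c e) (riemC d (fun y => Cmul (g y) (Cexpi (- kdot d (fun i => fst (e i)) y))) n))) => e he.
  apply Cx_cv_mul_l, hk => i hi. have := h1 _ (mlist_in _ _ _ _ he i hi). lia.
rewrite (lsumC_zero E (fun e => Cmul (c e) C0)) in hcv; last by move=> e _; ring.
move: hcv. have -> // : (fun n => lsumC E (fun e => Cmul (c e) (riemC d (fun y => Cmul (g y) (Cexpi (- kdot d (fun i => fst (e i)) y))) n)))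
  = riemC d (fun y => Cmul (g y) (Cof (rprod d (fun i => fej R0 (x i - y i))))).
apply functional_extensionality => n.
rewrite (riemC_ext d _ _ n e1) (riemC_lsumC E). apply lsumC_ext => e _. by rewrite riemC_scal.
Qed.

(* Up to an error that vanishes on fine grids, the Fejer means of [f - S_n] only see [S_{n'} - S_n] for a large [n']. *)
Lemma Spart_error d phi f x n eps : admissible phi -> torus_fun d f -> 0 <= eps ->
  (forall n' y, (n <= n')%nat -> Cmod (Csub (Spart d phi f n' y) (Spart d phi f n y)) <= eps) ->
  Cmod (Csub (f x) (Spart d phi f n x)) <= eps.
Proof.
move=> hphi hf heps htail.
have [c0 hc] := admissible_cutoff phi hphi.
apply le_epsilon => eta heta.
pose E y := Csub (f y) (Spart d phi f n y).
have hE : torus_fun d E.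
  apply torus_of_ccont; first by apply ccont_sub; [exact: ccont_torus|exact: ccont_Spart hc].
  move=> y i hi. rewrite /E. have [_ [h2 _]] := hf. rewrite h2 //. f_equal. exact: (periodic_Spart d phi f c0 n hc y i hi).
have [R0 [hR0 hfej]] := fejer_approx d E x (eta / 2) hE ltac:(lra).
have [n1 hn1] := admissible_partition phi hphi R0.
set n' := (n + n1)%nat.
have hpart : forall z, (Z.abs z <= Z.of_nat R0)%Z -> rsum n' (fun l => phi l (IZR z)) = 1.
  by move=> z hz; apply hn1 => //; rewrite /n'; lia.
have hzero := fejer_riem_zero d (fun y => Csub (f y) (Spart d phi f n' y)) x R0.
have {}hzero : Cx_cv (riemC d (fun y => Cmul (Csub (f y) (Spart d phi f n' y)) (Cof (rprod d (fun i => fej R0 (x i - y i)))))) C0.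
  apply hzero; first by apply ccont_sub; [exact: ccont_torus|exact: ccont_Spart hc].
  move=> k hk. have [v0 hv0] := Spart_coef d phi f c0 R0 n' k hc hpart hk.
  apply Cx_cv_Cmod => e he. have [N1 hN1] := Cx_cv_Cmod_inv _ _ e (fhat_cv d f k hf) he.
  exists (v0 + N1)%nat => v hv.
  have -> : Csub (riemC d (fun y => Cmul (Csub (f y) (Spart d phi f n' y)) (Cexpi (- kdot d k y))) v) C0
    = Csub (riemC d (fun x => Cmul (f x) (Cexpi (- kdot d k x))) v) (fhat d f k).
    rewrite -(hv0 v ltac:(lia)) /riemC.
    rewrite (lsumC_ext _ _ (fun u => Csub (Cmul (Cof ((/ INR (2 ^ v)) ^ d)) (Cmul (f (pt (2 ^ v) u)) (Cexpi (- kdot d k (pt (2 ^ v) u)))))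
       (Cmul (Cof ((/ INR (2 ^ v)) ^ d)) (Cmul (Spart d phi f n' (pt (2 ^ v) u)) (Cexpi (- kdot d k (pt (2 ^ v) u))))))).
      rewrite lsumC_sub; ring.
    move=> u _; ring.
  apply hN1; lia.
have [N1 hN1] := Cx_cv_Cmod_inv _ _ (eta / 2) hzero ltac:(lra).
set v := (N1 + R0)%nat.
have hvv : (v < 2 ^ v)%nat by apply Nat.pow_gt_lin_r; lia.
have hvR : (R0 <= 2 ^ v)%nat by lia.
have {}hfej := hfej (2 ^ v)%nat hvR.
have {}hN1 := hN1 v ltac:(rewrite /v; lia).
set J := fun y : nat -> R => rprod d (fun i => fej R0 (x i - y i)) in hzero hN1.
have hJ0 : forall y, 0 <= J y by move=> y; apply rprod_ge0 => i _; apply fej_ge0.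
have hvp := pow2_nat_pos v.
have hJ1 : lsum (ubox d (2 ^ v)) (fun u => (/ INR (2 ^ v)) ^ d * J (pt (2 ^ v) u)) = 1.
  rewrite (lsum_ext _ _ (fun u => rprod d (fun i => / INR (2 ^ v) * fej R0 (x i - pt (2 ^ v) u i)))); last first.
    by move=> u _; rewrite rprod_mul rprod_const.
  rewrite (lsum_ubox_prod d (2 ^ v) (fun i t => / INR (2 ^ v) * fej R0 (x i - t))) (rprod_ext d _ (fun _ => 1)); first by rewrite rprod_const pow1.
  move=> i _. by apply fej_mean.
pose T1 := riemC d (fun y => Cmul (Csub (f y) (Spart d phi f n' y)) (Cof (J y))) v.
pose T2 := lsumC (ubox d (2 ^ v)) (fun u => Cmul (Cof ((/ INR (2 ^ v)) ^ d * J (pt (2 ^ v) u))) (Csub (Spart d phi f n' (pt (2 ^ v) u)) (Spart d phi f n (pt (2 ^ v) u)))).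
have eT : lsumC (ubox d (2 ^ v)) (fun u => Cmul (Cof ((/ INR (2 ^ v)) ^ d)) (Cmul (E (pt (2 ^ v) u)) (Cof (rprod d (fun i => fej R0 (x i - pt (2 ^ v) u i)))))) = Cadd T1 T2.
  rewrite /T1 /T2 /riemC -lsumC_plus. apply lsumC_ext => u _. rewrite Cof_mul /E /J. ring.
rewrite eT in hfej.
have hT1 : Cmod T1 < eta / 2.
  move: hN1. rewrite -/T1. by have -> : Csub T1 C0 = T1 by ring.
have hT2 : Cmod T2 <= eps.
  apply: Rle_trans (Cmod_lsumC _ _) _. rewrite -[X in _ <= X]Rmult_1_r -hJ1 -lsum_scal.
  apply lsum_le => u _. rewrite Cmod_mul Cmod_Cof.
  have h0 : 0 <= (/ INR (2 ^ v)) ^ d * J (pt (2 ^ v) u) by pos.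
  rewrite Rabs_pos_eq // Rmult_comm. apply Rmult_le_compat_r => //. apply htail; rewrite /n'; lia.
rewrite -/(E x).
have -> : E x = Csub (Cadd T1 T2) (Csub (Cadd T1 T2) (E x)) by ring.
apply: Rle_trans (Cmod_sub_tri _ _) _. have := Cmod_tri T1 T2. lra.
Qed.

(** * Proof of the theorem *)

Lemma Rmax_sum a b : Rmax a b = / 2 * (a + b + Rabs (a + -1 * b)).
Proof. rewrite /Rmax /Rabs; case: Rle_dec => h; case: Rcase_abs => h'; lra. Qed.

Lemma tcont_Rmax d g h : tcont d g -> tcont d h -> tcont d (fun x => Rmax (g x) (h x)).
Proof.
move=> hg hh. apply (tcont_ext d (fun x => / 2 * (g x + h x + Rabs (g x + -1 * h x)))); first by move=> x; rewrite Rmax_sum.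
apply tcont_scal, tcont_plus; first by apply tcont_plus.
apply (tcont_comp_cont d (fun x => g x + -1 * h x) Rabs); last exact Rcontinuity_abs.
apply tcont_plus => //. by apply tcont_scal.
Qed.

Lemma tcont_maxbox d n N (F : (nat -> nat) -> (nat -> R) -> R) : (forall j, tcont d (F j)) ->
  tcont d (fun x => maxbox n N (fun j => F j x)).
Proof.
elim: n F => [|n IH] F hF; first by apply hF.
rewrite /=. elim: (seq 0 N) => [|a l IHl]; first exact: tcont_const.
apply tcont_Rmax => //. apply (IH (fun j => F (updN j n a))) => j. apply hF.
Qed.

Lemma maxbox_ge0 d N F : (forall j, 0 <= F j) -> 0 <= maxbox d N F.
Proof.
case: d => [|d] hF; first by apply hF. rewrite /=. elim: (seq 0 N) => [|a l IH] /=; first lra.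
apply: Rle_trans IH _. apply Rmax_r.
Qed.

Lemma maxbox_ge d N F j : (forall j, 0 <= F j) -> In j (ubox d N) -> F j <= maxbox d N F.
Proof.
elim: d F j => [|d IH] F j hF; first by move=> [<-|[]] /=; lra.
rewrite /ubox [mlist _ _ _]/= => /in_flat_map [a [ha /in_map_iff [j' [<- hj']]]].
apply: Rle_trans (IH (fun j => F (updN j d a)) j' (fun j => hF _) hj') _.
rewrite /=. elim: (seq 0 N) ha => [//|b l IHl] [->|h] /=; first by apply Rmax_l.
apply: Rle_trans (IHl h) _. apply Rmax_r.
Qed.

Lemma tcont_Cmod_delta d phi f c0 l : cutoff phi c0 -> tcont d (fun x => Cmod (delta d phi f l x)).
Proof. move=> hc. apply tcont_Cmod. exact: ccont_tpoly (delta_tpoly d phi f c0 l hc). Qed.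

Lemma tcont_GN d phi p theta r f n c0 : cutoff phi c0 -> 0 < p -> theta_ok theta -> tcont d (GN d phi p theta r f n).
Proof.
move=> hc hp ht. rewrite /GN. case: theta ht => [t|] /= ht.
  have hpt : 0 < p / t by pos.
  apply (tcont_ext d (fun x => rpow (lsum (ubox d n) (fun j => rpow 2 (t * dotR d r j) * rpow (Cmod (delta d phi f j x)) t)) (p / t))).
    by move=> x; rewrite sumbox_lsum.
  apply tcont_rpow => //.
    move=> x; apply lsum_ge0 => j _; apply Rmult_le_pos; apply rpow_ge0.
  apply (tcont_lsum d (ubox d n) (fun j x => rpow 2 (t * dotR d r j) * rpow (Cmod (delta d phi f j x)) t)) => j _.
  apply tcont_scal, tcont_rpow => //; first pos. exact: tcont_Cmod_delta hc.
apply (tcont_rpow d (fun x => maxbox d n (fun j => rpow 2 (dotR d r j) * Cmod (delta d phi f j x)))) => //.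
  move=> x; apply maxbox_ge0 => j; apply Rmult_le_pos; [apply rpow_ge0|apply Cmod_ge0].
apply (tcont_maxbox d d n (fun j x => rpow 2 (dotR d r j) * Cmod (delta d phi f j x))) => j.
apply tcont_scal. exact: tcont_Cmod_delta hc.
Qed.

Lemma GN_ge0 d phi p theta r f n x : 0 <= GN d phi p theta r f n x.
Proof. rewrite /GN; case: theta => [t|]; apply rpow_ge0. Qed.

(** An [l^theta] norm dominates each of its terms: from here on every [theta] is treated like
    [theta = oo]. *)
Lemma GN_lower d phi p theta r f n x l : 0 < p -> theta_ok theta -> In l (ubox d n) ->
  Cmod (delta d phi f l x) <= rpow 2 (- dotR d r l) * rpow (GN d phi p theta r f n x) (/ p).
Proof.
move=> hp ht hl. set z := Cmod _. have hz : 0 <= z by apply Cmod_ge0.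
suff h : rpow 2 (dotR d r l) * z <= rpow (GN d phi p theta r f n x) (/ p).
  have := Rmult_le_compat_l _ _ _ (rpow_ge0 2 (- dotR d r l)) h.
  rewrite -Rmult_assoc -rpow_add Rplus_opp_l rpow_exp0; lra.
rewrite /GN. case: theta ht => [t|] /= ht; last first.
  rewrite rpow_rpow Rinv_r ?rpow_1; try lra.
    apply (maxbox_ge d n (fun j => rpow 2 (dotR d r j) * Cmod (delta d phi f j x))) => // j.
    pos.
  apply maxbox_ge0 => j; apply Rmult_le_pos; [apply rpow_ge0|apply Cmod_ge0].
rewrite rpow_rpow sumbox_lsum. replace (p / t * / p) with (/ t) by (field; lra).
apply rpow_root_le => //.
  pos.
rewrite rpow_mul //; last pos. rewrite rpow_rpow (Rmult_comm _ t).
apply (lsum_ge_term (ubox d n) (fun j => rpow 2 (t * dotR d r j) * rpow (Cmod (delta d phi f j x)) t)) => // j _.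
pos.
Qed.

(** The strict inequality [M^p < W] leaves room for the Riemann sums to exceed their limit; passing
    to averages is harmless because [2 PI >= 1]. *)
Lemma riem_GN_le d phi p theta r f n c0 M W : cutoff phi c0 -> 0 < p -> theta_ok theta -> Snorm_le d phi p theta r f M ->
  rpow M p < W -> exists v0, forall v, (v0 <= v)%nat -> riem d (GN d phi p theta r f n) v <= W.
Proof.
move=> hc hp ht hM hW. have hcv := integ_cv d _ (tcont_GN d phi p theta r f n c0 hc hp ht).
have hpi : 1 <= 2 * PI by have := PI2_3_2; lra.
have h1 : 1 <= (2 * PI) ^ d by apply pow_R1_Rle.
set l := / (2 * PI) ^ d * _ in hcv.
have hl : l <= rpow M p.
  have hi : 0 < / (2 * PI) ^ d <= 1.
    split; first by apply Rinv_0_lt_compat; lra. rewrite -Rinv_1; apply Rinv_le_contravar; lra.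
  apply: Rle_trans (_ : _ <= / (2 * PI) ^ d * rpow M p) _; first by apply Rmult_le_compat_l; [lra|apply hM].
  have := rpow_ge0 M p. nra.
have [v0 hv] := hcv (W - l) ltac:(lra). exists v0 => v hv'. have := hv v hv'. rewrite /Rdist => /Rabs_def2. lra.
Qed.

(** A Nikolskii inequality: [peetre] with exponent [p] and the decay discarded loses [2^(l/p)]. Here
    [K] may depend on [f], as only convergence is drawn from it. *)
Lemma delta_sup_bound d phi p theta r f c0 M : cutoff phi c0 -> 0 < p -> theta_ok theta -> Snorm_le d phi p theta r f M ->
  exists K, 0 <= K /\ forall n l y, In l (ubox d n) ->
    Cmod (delta d phi f l y) <= K * rpow 2 (- dotR d (fun i => r i - 1 / p) l).
Proof.
move=> hc hp ht hM.
have [C [K0 [hC H]]] := peetre d c0 p 3 hp ltac:(lra).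
set W := rpow M p + 1. have hW0 : 0 < W by rewrite /W; have := rpow_ge0 M p; lra.
exists (rpow (C * W) (/ p)); split; first pos.
move=> n l y hl.
have [v0 hv0] := riem_GN_le d phi p theta r f n c0 M W hc hp ht hM ltac:(rewrite /W; lra).
set v := (v0 + K0 + n)%nat. have {}hv0 := hv0 v ltac:(rewrite /v; lia).
have hN := pow2_nat_pos v.
have hK : forall i, (i < d)%nat -> (K0 * 2 ^ l i <= 2 ^ v)%nat.
  move=> i hi. have := mlist_in _ _ _ _ hl i hi => /in_seq h1.
  have h2 : (2 ^ l i <= 2 ^ n)%nat by apply Nat.pow_le_mono_r; lia.
  have h3 : (K0 < 2 ^ K0)%nat by apply Nat.pow_gt_lin_r; lia.
  have h4 : (2 ^ (K0 + n) <= 2 ^ v)%nat by apply Nat.pow_le_mono_r; rewrite /v; lia.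
  rewrite Nat.pow_add_r in h4. nia.
have h := H l (delta d phi f l) (2 ^ v)%nat (delta_tpoly d phi f c0 l hc) hN hK y.
have hV : 0 <= rprod d (fun i => 2 ^ l i) by pos.
have hb : rpow (Cmod (delta d phi f l y)) p <= C * W * (rprod d (fun i => 2 ^ l i) * rpow (rpow 2 (- dotR d r l)) p).
  apply: Rle_trans h _. rewrite Rmult_assoc. mul_l.
  apply: Rle_trans (_ : _ <= rprod d (fun i => 2 ^ l i) * rpow (rpow 2 (- dotR d r l)) p * riem d (GN d phi p theta r f n) v) _; last first.
    rewrite Rmult_comm. apply Rmult_le_compat_r => //. apply Rmult_le_pos => //; apply rpow_ge0.
  rewrite /riem -lsum_scal. apply lsum_le => u _.
  have h1 : rprod d (fun i => 2 ^ l i / INR (2 ^ v) * rpow (1 + 2 ^ l i * rho (y i - pt (2 ^ v) u i)) (- (3))) <= rprod d (fun i => 2 ^ l i) * (/ INR (2 ^ v)) ^ d.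
    rewrite -(rprod_const d (/ _)) -rprod_mul. apply rprod_le => i _.
    have h2 := pow2_pos (l i). have r0 := rho_ge0 (y i - pt (2 ^ v) u i).
    have h3 : rpow (1 + 2 ^ l i * rho (y i - pt (2 ^ v) u i)) (- (3)) <= 1.
      have := rpow_le_neg 1 (1 + 2 ^ l i * rho (y i - pt (2 ^ v) u i)) (- (3)) ltac:(lra) ltac:(nra). by rewrite rpow_base1.
    have h4 : 0 < 2 ^ l i / INR (2 ^ v) by pos.
    split; first pos. rewrite -/(2 ^ l i / INR (2 ^ v)). nra.
  have h2 : rpow (Cmod (delta d phi f l (pt (2 ^ v) u))) p <= rpow (rpow 2 (- dotR d r l)) p * GN d phi p theta r f n (pt (2 ^ v) u).
    have h3 := GN_lower d phi p theta r f n (pt (2 ^ v) u) l hp ht hl.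
    apply: Rle_trans (rpow_le _ _ p ltac:(lra) h3) _.
    rewrite rpow_mul; try apply rpow_ge0. rewrite (rpow_rpow (GN _ _ _ _ _ _ _ _)) Rinv_l; last lra.
    rewrite rpow_1; last by apply GN_ge0. lra.
  have h6 : 0 <= rprod d (fun i => 2 ^ l i / INR (2 ^ v) * rpow (1 + 2 ^ l i * rho (y i - pt (2 ^ v) u i)) (- (3))) by pos.
  have := Rmult_le_compat _ _ _ _ h6 (rpow_ge0 _ _) h1 h2. lra.
have hCW : 0 < C * W by pos.
have hnn : 0 <= C * W * (rprod d (fun i => 2 ^ l i) * rpow (rpow 2 (- dotR d r l)) p) by pos.
apply: Rle_trans (rpow_root_le _ _ p hp hnn hb) _. apply Req_le.
rewrite rpow_mul; [|lra|apply Rmult_le_pos => //; apply rpow_ge0]. f_equal.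
rewrite rpow_mul //; last pos.
rewrite !rpow_rpow ?Rmult_assoc Rinv_r ?Rmult_1_r; last lra.
rewrite !rpow2_dot_opp rprod_rpow; last pos.
rewrite -rprod_mul. apply rprod_ext => i _. rewrite rpow2_INR_mul -rpow_add. f_equal. field; lra.
Qed.

(** A product, so that restriction to a smaller box can be carried out one coordinate at a time. *)
Definition chi (d n : nat) (l : nat -> nat) : R := rprod d (fun i => if (l i <? n)%nat then 1 else 0).

Lemma chi_01 d n l : 0 <= chi d n l <= 1.
Proof.
split; first by apply rprod_ge0 => i _; case: (_ <? _)%nat; lra.
rewrite /chi -[X in _ <= X](pow1 d) -(rprod_const d 1). apply rprod_le => i _; case: (_ <? _)%nat; lra.
Qed.

Lemma ubox_restrict d n n' F : (n <= n')%nat -> lsum (ubox d n') (fun l => chi d n l * F l) = lsum (ubox d n) F.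
Proof.
move=> hn. elim: d F => [|d IH] F; first by rewrite /ubox /chi /rprod /lsum /= Rmult_1_l.
rewrite /ubox !lsum_mlist_S.
have one : forall g : nat -> R, lsum (seq 0 n') (fun a => (if (a <? n)%nat then 1 else 0) * g a) = lsum (seq 0 n) g.
  move=> g. have -> : n' = (n + (n' - n))%nat by lia. rewrite seq_app lsum_app (lsum_zero (seq (0 + n) _)).
    rewrite Rplus_0_r. apply lsum_ext => a /in_seq ha. have -> : (a <? n)%nat = true by apply Nat.ltb_lt; lia. ring.
  move=> a /in_seq ha. have -> : (a <? n)%nat = false by apply Nat.ltb_ge; lia. ring.
rewrite -one. apply lsum_ext => a _. rewrite -(IH (fun l => F (upd l d a))) -lsum_scal. apply lsum_ext => l _.
rewrite /chi rprod_S upd_eq (rprod_ext d _ (fun i => if (l i <? n)%nat then 1 else 0)); first ring.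
move=> i hi; rewrite upd_neq //; lia.
Qed.

Lemma ubox_restrictC d n n' F : (n <= n')%nat -> lsumC (ubox d n') (fun l => Cmul (Cof (chi d n l)) (F l)) = lsumC (ubox d n) F.
Proof.
move=> hn. rewrite !lsumC_pair -!(ubox_restrict d n n') //. f_equal; apply lsum_ext => l _ /=; ring.
Qed.

(** As [r_i > 1/p], the bounds of [delta_sup_bound] sum to an increasing bounded sequence, whose
    Cauchy tails dominate uniformly in [y]. *)
Lemma Spart_tail d phi p theta r f c0 M : cutoff phi c0 -> 0 < p -> theta_ok theta -> Snorm_le d phi p theta r f M ->
  (forall i, (i < d)%nat -> 1 / p < r i) -> forall eps, 0 < eps -> exists n0, forall n n' y, (n0 <= n)%nat -> (n <= n')%nat ->
    Cmod (Csub (Spart d phi f n' y) (Spart d phi f n y)) <= eps.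
Proof.
move=> hc hp ht hM hr eps he.
have [K [hK H]] := delta_sup_bound d phi p theta r f c0 M hc hp ht hM.
pose b l := K * rpow 2 (- dotR d (fun i => r i - 1 / p) l).
pose P n := lsum (ubox d n) b.
have hb : forall l, 0 <= b l by move=> l; apply Rmult_le_pos => //; apply rpow_ge0.
have hdiff : forall n n' y, (n <= n')%nat -> Cmod (Csub (Spart d phi f n' y) (Spart d phi f n y)) <= P n' - P n.
  move=> n n' y hn. rewrite /Spart -(ubox_restrictC d n n') // -lsumC_sub.
  rewrite (lsumC_ext _ _ (fun l => Cmul (Cof (1 - chi d n l)) (delta d phi f l y))); last first.
    move=> l _. apply Cx_eq; rewrite /=; ring.
  apply: Rle_trans (Cmod_lsumC _ _) _.
  rewrite /P -(ubox_restrict d n n' b hn).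
  apply: Rle_trans (_ : _ <= lsum (ubox d n') (fun l => b l + -1 * (chi d n l * b l))) _; last first.
    rewrite lsum_plus lsum_scal; lra.
  apply lsum_le => l hl. rewrite Cmod_mul Cmod_Cof. have hchi := chi_01 d n l.
  rewrite Rabs_pos_eq; last lra. have := Rmult_le_compat_l (1 - chi d n l) _ _ ltac:(lra) (H n' l y hl). rewrite -/(b l). lra.
have hgrow : Un_growing P.
  move=> n. rewrite /P -(ubox_restrict d n (S n)); last lia. apply lsum_le => l _.
  have := chi_01 d n l; have := hb l; nra.
have hub : has_ub P.
  exists (K * rprod d (fun i => tailC 0 (r i - 1 / p))) => z [n ->]. rewrite /P /b lsum_scal. apply Rmult_le_compat_l => //.
  rewrite (lsum_ext _ _ (fun l => rprod d (fun i => rpow 2 (- ((r i - 1 / p) * INR (l i)))))); last first.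
    by move=> l _; rewrite rpow2_dot_opp.
  rewrite (lsum_mlist_prod O d (fun _ => seq 0 n) (fun i a => rpow 2 (- ((r i - 1 / p) * INR a)))).
  apply rprod_le => i hi. split; first pos.
  have h0 := geometric_tail 0 (r i - 1 / p) n 0 ltac:(have := hr i hi; lra).
  rewrite [INR 0]/= Rmult_0_r Ropp_0 rpow_exp0 in h0; last lra. apply: Rle_trans h0 _; lra.
have [l hl] := growing_cv P hgrow hub.
have [n0 hn0] := hl (eps / 2) ltac:(lra).
exists n0 => n n' y hn hn'. apply: Rle_trans (hdiff n n' y hn') _.
have := hn0 n ltac:(lia). have := hn0 n' ltac:(lia). rewrite /Rdist => /Rabs_def2 h1 /Rabs_def2 h2. lra.
Qed.

Lemma Spart_cv d phi p theta r f M x : admissible phi -> torus_fun d f -> 0 < p -> theta_ok theta -> Snorm_le d phi p theta r f M ->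
  (forall i, (i < d)%nat -> 1 / p < r i) -> Cx_cv (fun n => Spart d phi f n x) (f x).
Proof.
move=> hphi hf hp ht hM hr. have [c0 hc] := admissible_cutoff phi hphi.
apply Cx_cv_Cmod => eps he.
have [n0 hn0] := Spart_tail d phi p theta r f c0 M hc hp ht hM hr (eps / 2) ltac:(lra).
exists n0 => n hn. rewrite Cmod_sub_sym.
have := Spart_error d phi f x n (eps / 2) hphi hf ltac:(lra) (fun n' y hn' => hn0 n n' y hn hn'). lra.
Qed.

Lemma Cx_cv_sub u v z w : Cx_cv u z -> Cx_cv v w -> Cx_cv (fun n => Csub (u n) (v n)) (Csub z w).
Proof. move=> [h1 h2] [h3 h4]; split => /=; by apply CV_minus. Qed.

Lemma Cx_cv_bound u z B n0 : Cx_cv u z -> (forall n, (n0 <= n)%nat -> Cmod (u n) <= B) -> Cmod z <= B.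
Proof.
move=> h H. apply le_epsilon => eps he. have [N hN] := Cx_cv_Cmod_inv u z eps h he.
have h1 := hN (N + n0)%nat ltac:(lia). have h2 := H (N + n0)%nat ltac:(lia).
have -> : z = Csub (u (N + n0)%nat) (Csub (u (N + n0)%nat) z) by ring.
apply: Rle_trans (Cmod_sub_tri _ _) _. lra.
Qed.

Lemma qop_cv d L j (F : nat -> (nat -> R) -> Cx) f x : (forall y, Cx_cv (fun n => F n y) (f y)) ->
  Cx_cv (fun n => qop d L j (F n) x) (qop d L j f x).
Proof.
move=> h. rewrite qop_expand.
rewrite (functional_extensionality _ _ (fun n => qop_expand d L j (F n) x)).
apply (Cx_cv_lsumC _ (fun e n => Cmul (cprod d (fun i => snd (e i))) (F n (fun i => if (i <? d)%nat then fst (e i) else x i)))) => e _.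
by apply Cx_cv_mul_l.
Qed.

(** [N0] depends only on [d], [eta] and [m], so one finite set of indices serves [f] and all its
    partial sums. *)
Lemma smolyak_finite d L eta m : (forall i, (i < d)%nat -> 0 < eta i) -> exists N0, forall N g x, (N0 <= N)%nat ->
  smolyak d L eta m g x = lsumC (ubox d N) (fun j => Cmul (Cof (1 - above (eta O * INR m) (dotR d eta j))) (qop d L j g x)).
Proof.
move=> heta.
have [e [he hmin]] : exists e, 0 < e /\ forall i, (i < d)%nat -> e <= eta i.
  elim: d heta => [|d IH] heta; first by exists 1; split; [lra|lia].
  have [e [he H]] := IH (fun i hi => heta i ltac:(lia)). have hd := heta d ltac:(lia).
  exists (Rmin e (eta d)); split; first by apply Rmin_glb_lt.
  move=> i hi. case: (Nat.eq_dec i d) => [->|hne]; first by apply Rmin_r.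
  apply: Rle_trans (Rmin_l _ _) _. apply H; lia.
have [N0 hN0] : exists N0, eta O * INR m / e < INR N0 by apply INR_unbounded.
exists N0 => N g x hN.
pose T j := Cmul (Cof (1 - above (eta O * INR m) (dotR d eta j))) (qop d L j g x).
have hcut : forall n, (N0 <= n)%nat -> lsumC (ubox d n) T = lsumC (ubox d N0) T.
  move=> n hn. rewrite -(ubox_restrictC d N0 n T hn). apply lsumC_ext => j hj.
  case: (forall_or_fail d (fun i => j i <? N0)%nat) => [hall|[i [hi hf]]].
    rewrite /chi (rprod_ext d _ (fun _ => 1)); last by move=> i hi; rewrite hall.
    rewrite rprod_const pow1 -/C1; ring.
  have -> : T j = C0; last ring.
  rewrite /T /above. case: Rle_dec => h.
    exfalso. move: hf => /Nat.ltb_ge hf.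
    have h1 : eta i * INR (j i) <= dotR d eta j.
      apply (lsum_ge_term (seq 0 d) (fun i => eta i * INR (j i)) i); last by apply in_seq; lia.
      move=> k /in_seq hk. apply Rmult_le_pos; last pos. have := heta k ltac:(lia); lra.
    have h2 := le_INR _ _ hf. have h3 := hmin i hi.
    have h4 : eta O * INR m < e * INR N0.
      apply Rmult_lt_reg_r with (/ e); first pos.
      replace (e * INR N0 * / e) with (INR N0) by (field; lra). exact hN0.
    have : e * INR N0 <= eta i * INR (j i) by apply Rmult_le_compat; try lra; apply pos_INR.
    lra.
  rewrite Rminus_diag. change (Cof 0) with C0. ring.
rewrite -/T hcut // /smolyak. apply (limC_eventually _ _ N0) => n hn.
rewrite csumbox_lsumC -(hcut n hn). apply lsumC_ext => j _. rewrite /T /above.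
case: Rle_dec => h.
  rewrite Rminus_0_r -/C1; ring.
rewrite Rminus_diag. change (Cof 0) with C0. ring.
Qed.

Theorem theorem6 (d : nat) (p : R) (theta : option R) (L : nat) (r : nat -> R) (mu : nat)
    (nu : nat -> R) (phi : nat -> R -> R) :
  0 < p -> theta_ok theta -> (1 <= L)%nat -> smoothness_vector d mu r -> 1 / p < r O ->
  (forall s, (s < mu)%nat -> nu s = r s) ->
  (forall s, (mu <= s)%nat -> (s < d)%nat -> r O < nu s /\ nu s < r s) ->
  admissible phi ->
  exists C, 0 < C /\
    forall (m : nat) (f : (nat -> R) -> Cx) (M : R),
      (1 <= m)%nat -> torus_fun d f -> 0 <= M -> Snorm_le d phi p theta r f M ->
      forall x : nat -> R,
        Cmod (Csub (f x) (smolyak d L (fun s => nu s - 1 / p) m f x))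
          <= C * rpow (INR m) ((INR mu - 1) * Rmax (1 - 1 / p) 0)
               * rpow 2 (- INR m * (r O - 1 / p)) * M.
Proof.
move=> hp ht hL [hmu [hmud [hrlow _]]] hr0 hnulow hnuhigh hphi.
have [c0 hc] := admissible_cutoff phi hphi.
have hrge : forall i, (i < d)%nat -> r O <= r i.
  move=> i hi. case: (Nat.lt_ge_cases i mu) => h; first by rewrite hrlow //; lra.
  have := hnuhigh i h hi; lra.
have hr : forall i, (i < d)%nat -> 1 / p < r i by move=> i /hrge; lra.
have [Cb [K0 [c [hCb [hcc Hb]]]]] := block_estimate d L c0 p (r O) r hL hp hr0 hrge.
pose lam i := r i - 1 / p. pose eta i := nu i - 1 / p.
have hlow : forall i, (i < mu)%nat -> lam i = r O - 1 / p /\ eta i = r O - 1 / p.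
  by move=> i hi; rewrite /lam /eta hnulow // hrlow.
have hhigh : forall i, (mu <= i)%nat -> (i < d)%nat -> 0 < eta i < lam i.
  move=> i h1 h2; have := hnuhigh i h1 h2; rewrite /eta /lam; lra.
have heta : forall i, (i < d)%nat -> 0 < eta i.
  move=> i hi. case: (Nat.lt_ge_cases i mu) => h; first by have [_ ->] := hlow i h; lra.
  have := hhigh i h hi; lra.
have eta0 : eta O = r O - 1 / p by have [_ ->] := hlow O hmu.
have [Co [hCo Ho]] := outer_sum_bound d mu p (r O - 1 / p) lam eta hmu hmud hp ltac:(lra) hlow hhigh.
(* [Cb] from the sum over blocks, [Co] from the sum over exceptional indices, and [Cb^(1/p)] from
   the Schur bound on [a]. *)
exists (Cb * Co * rpow Cb (/ p)); split.
  pos.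
move=> m f M hm hf hM hS x.
have hm1 : 1 <= INR m by rewrite -INR_1; apply le_INR.
set X := rpow (INR m) _. set Y := rpow 2 (- INR m * _).
have hX : 0 < X by apply rpow_gt0; lra. have hY : 0 < Y by apply rpow_gt0; lra.
set Kc := Cb * Co * rpow Cb (/ p) * X * Y.
have hKc : 0 < Kc.
  rewrite /Kc; do 2 (apply Rmult_lt_0_compat => //). apply Rmult_lt_0_compat; last by apply rpow_gt0. by apply Rmult_lt_0_compat.
have [N0 hN0] := smolyak_finite d L eta m heta.
(* The slack needed by [riem_GN_le]; a violation of the bound for [M] would persist for the midpoint
   choice of [M']. *)
suff main : forall M', M < M' -> Cmod (Csub (f x) (smolyak d L eta m f x)) <= Kc * M'.
  apply Rnot_lt_le => hlt. set Z := Cmod _ in hlt. 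
  have h1 := main (M + (Z - Kc * M) / (2 * Kc)). rewrite -/eta -/Z in h1.
  have h2 : 0 < (Z - Kc * M) / (2 * Kc) by pos.
  replace (Kc * (M + (Z - Kc * M) / (2 * Kc))) with (Kc * M + (Z - Kc * M) / 2) in h1 by (field; lra). lra.
move=> M' hM'.
have hcv := fun y => Spart_cv d phi p theta r f M y hphi hf hp ht hS hr.
(* The error of [f] is the limit of the errors of its partial sums, because the operator is a finite
   combination of point values. It remains to bound these uniformly in [n >= N0]. *)
apply (Cx_cv_bound (fun n => Csub (Spart d phi f n x) (smolyak d L eta m (Spart d phi f n) x)) _ _ N0).
  apply Cx_cv_sub; first exact: hcv.
  rewrite (hN0 N0 f x (Nat.le_refl _)).
  rewrite (functional_extensionality _ _ (fun n => hN0 N0 (Spart d phi f n) x (Nat.le_refl _))).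
  apply (Cx_cv_lsumC _ (fun j n => Cmul (Cof (1 - above (eta O * INR m) (dotR d eta j))) (qop d L j (Spart d phi f n) x))) => j _.
  by apply Cx_cv_mul_l, qop_cv.
move=> n hn. set J := (n + c + 1)%nat.
have eJ : J = S (n + c) by rewrite /J; lia.
(* Beyond level [n + c] nothing is missing: the cube of [q_j] reproduces every block of [Spart n],
   so the error consists of the terms outside the Smolyak set. *)
have hrep : lsumC (ubox d J) (fun j => qop d L j (Spart d phi f n) x) = Spart d phi f n x.
  rewrite (lsumC_ext _ _ (fun j => lsumC (ubox d n) (fun l => qop d L j (delta d phi f l) x))); last first.
    move=> j _. exact: (qop_lsumC (ubox d n) d L j (fun l => delta d phi f l) x).
  rewrite lsumC_exch. apply lsumC_ext => l hl. rewrite eJ.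
  apply (qop_sum_reproduces d L _ _ x (n + c) hL (delta_tpoly d phi f c0 l hc)); first lia.
  move=> i hi. have := mlist_in _ _ _ _ hl i hi => /in_seq h1.
  have h2 : (2 ^ (l i + c0) <= 2 ^ (n + c - L))%nat by apply Nat.pow_le_mono_r; lia.
  rewrite Nat.pow_add_r in h2. have h3 : (c0 < 2 ^ c0)%nat by apply Nat.pow_gt_lin_r; lia.
  have := pow2_nat_pos (l i). nia.
rewrite (hN0 J (Spart d phi f n) x); last lia.
rewrite -{1}hrep -lsumC_sub.
rewrite (lsumC_ext _ _ (fun j => Cmul (Cof (above ((r O - 1 / p) * INR m) (dotR d eta j))) (lsumC (ubox d n) (fun l => qop d L j (delta d phi f l) x)))); last first.
  move=> j _. rewrite -(qop_lsumC (ubox d n) d L j (fun l => delta d phi f l) x) eta0.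
  rewrite -/(Spart d phi f n). apply Cx_eq; rewrite /=; ring.
have hMM : rpow M p < rpow M' p by apply rpow_lt; lra.
have [v0 hv0] := riem_GN_le d phi p theta r f n c0 M _ hc hp ht hS hMM.
(* Fine enough both for the Riemann sum of the square function and for the frequencies up to
   [2^(n + c)]; this depends on [f] and [n], but the constants do not. *)
set v := (v0 + K0 + (n + c))%nat. have {}hv0 := hv0 v ltac:(rewrite /v; lia).
pose h u := rpow (GN d phi p theta r f n (pt (2 ^ v) u)) (/ p).
have hK0 : (K0 * 2 ^ (n + c) <= 2 ^ v)%nat.
  have h3 : (K0 < 2 ^ K0)%nat by apply Nat.pow_gt_lin_r; lia.
  have h4 : (2 ^ (K0 + (n + c)) <= 2 ^ v)%nat by apply Nat.pow_le_mono_r; rewrite /v; lia.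
  rewrite Nat.pow_add_r in h4. nia.
have [a [ha [ha1 ha2]]] := Hb n (2 ^ v)%nat (fun l => delta d phi f l) h x
  (fun l _ => delta_tpoly d phi f c0 l hc) (pow2_nat_pos v) hK0 (fun u => rpow_ge0 _ _)
  (fun l u hl => GN_lower d phi p theta r f n (pt (2 ^ v) u) l hp ht hl).
have hA : rpow (lsum (ubox d J) (fun j => rpow (a j) p)) (/ p) <= rpow Cb (/ p) * M'.
  have hip : 0 < / p by pos.
  apply: Rle_trans (_ : _ <= rpow (Cb * rpow M' p) (/ p)) _; last first.
    rewrite rpow_mul; [|lra|apply rpow_ge0]. rewrite rpow_rpow Rinv_r ?rpow_1; lra.
  apply rpow_le; first lra. apply: Rle_trans (ha2 J (Nat.le_refl _)) _. mul_l.
  apply: Rle_trans hv0. apply Req_le, lsum_ext => u _. f_equal. rewrite /h rpow_rpow Rinv_l ?rpow_1 //; [apply GN_ge0|lra].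
apply: Rle_trans (Cmod_lsumC _ _) _.
apply: Rle_trans (_ : _ <= Cb * lsum (ubox d J) (fun j => above ((r O - 1 / p) * INR m) (dotR d eta j) * (rpow 2 (- dotR d lam j) * a j))) _.
  rewrite -lsum_scal. apply lsum_le => j _. rewrite Cmod_mul Cmod_Cof.
  have h01 := above_01 ((r O - 1 / p) * INR m) (dotR d eta j). rewrite Rabs_pos_eq; last lra.
  have h1 : Cmod (lsumC (ubox d n) (fun l => qop d L j (delta d phi f l) x)) <= Cb * (rpow 2 (- dotR d lam j) * a j).
    exact: Rle_trans (Cmod_lsumC _ _) (ha1 j).
  have := Rmult_le_compat_l _ _ _ (proj1 h01) h1. lra.
have h1 := Ho J m a hm ha.
apply: Rle_trans (Rmult_le_compat_l Cb _ _ ltac:(lra) h1) _. rewrite -/X -/Y.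
have hpre : 0 <= Cb * (Co * X * Y) by pos.
have := Rmult_le_compat_l _ _ _ hpre hA. rewrite /Kc. lra.
Qed.
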